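(* Let $p_1,q_1,q_2\in(0,\infty]$ and $p_2\in(0,\infty)$ with $(p_1,q_1)\ne(p_2,q_2)$, let $n\in\mathbb{N}$ be fixed, and let $t\in(0,\infty)$. Let $\Theta_1$ be distributed according to the cone measure on $\mathbb{S}_{q_1}^{n-1}$ and define $$A_{p_1,q_1;p_2,q_2;n}:=\Biggl(\frac{\omega_{q_1}^n\,\Gamma(\frac{n}{p_1}+1)}{\omega_{q_2}^n\,\Gamma(\frac{n}{p_2}+1)}\Biggr)^{1/n}\Bigl(\frac{e}{n}\Bigr)^{1/p_1-1/p_2}\frac{p_1^{1/p_1}}{p_2^{1/p_2}}\,\frac{1}{\bigl(M_{p_1/n}^{p_2/n}\,\mathbb{E}[\lVert\Theta_1\rVert_{q_2}^{p_2}]\bigr)^{1/p_2}}.$$ Then $$\lim_{m\to\infty}V^{m,n}(t)=\begin{cases}0&\text{if }tA_{p_1,q_1;p_2,q_2;n}<1,\\ \frac12&\text{if }tA_{p_1,q_1;p_2,q_2;n}=1,\\ 1&\text{if }tA_{p_1,q_1;p_2,q_2;n}>1.\end{cases}$$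
   Context: For $p\in(0,\infty]$, $\lVert x\rVert_p=(\sum_{i}|x_i|^p)^{1/p}$ if $p<\infty$ and $\lVert x\rVert_\infty=\max_i|x_i|$ on $\mathbb{R}^n$; $\mathbb{B}_p^n$, $\mathbb{S}_p^{n-1}$ are the unit ball and unit sphere, $\omega_p^n$ is the volume of $\mathbb{B}_p^n$. For $x\in\mathbb{R}^{m\times n}$, $\lVert x\rVert_{p,q}:=\bigl\lVert\bigl(\lVert(x_{i,j})_{j\le n}\rVert_q\bigr)_{i\le m}\bigr\rVert_p$ and $\mathbb{B}_{p,q}^{m,n}:=\{x\in\mathbb{R}^{m\times n}:\lVert x\rVert_{p,q}\le1\}$. Write $\mathrm{vol}_{mn}$ for Lebesgue measure on $\mathbb{R}^{m\times n}$, $r_{p,q}^{m,n}:=\mathrm{vol}_{mn}(\mathbb{B}_{p,q}^{m,n})^{1/(mn)}$, and $$V^{m,n}(t):=\mathrm{vol}_{mn}\bigl((r_{p_1,q_1}^{m,n})^{-1}\mathbb{B}_{p_1,q_1}^{m,n}\cap t\,(r_{p_2,q_2}^{m,n})^{-1}\mathbb{B}_{p_2,q_2}^{m,n}\bigr).$$ The cone measure on $\mathbb{S}_q^{n-1}$ is $\kappa_q^{n-1}(B):=\mathrm{vol}_n(\{sb:s\in[0,1],b\in B\})/\omega_q^n$ for Borel $B\subset\mathbb{S}_q^{n-1}$. Conventions for $p=\infty$: $c/p:=0$ for $c\in\mathbb{R}$, $p/c:=\infty$ for $c\in(0,\infty)$, $p^{1/p}:=1$ (also $p^{\alpha/p}:=1$).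 $M_p^\alpha:=\frac{p^{\alpha/p}}{\alpha+1}\frac{\Gamma(\frac{\alpha+1}{p}+1)}{\Gamma(\frac1p+1)}$ for $p\in(0,\infty]$, $\alpha\in(0,\infty)$ (superscripts are indices, not powers).
   Formalization: The formal theorem excludes the case n = 1, p_1 = p_2, t = 1: there the two normalized balls coincide, so tA = 1 while V^{m,1}(1) = 1 for all m, and the stated limit 1/2 is false. *)

(* Defs.v *)
From HB Require Import structures.
From mathcomp Require Import all_boot all_order all_algebra.
From mathcomp Require Import all_classical all_reals all_analysis.

Set Implicit Arguments.
Unset Strict Implicit.
Unset Printing Implicit Defensive.

Import Order.TTheory GRing.Theory Num.Theory.
Import numFieldNormedType.Exports.

Local Open Scope classical_set_scope.
Local Open Scope ring_scope.

Section product_measure_cons.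
Context {R : realType} d (T : measurableType d) (n : nat).
Variables (mu : {sigma_finite_measure set T -> \bar R})
          (nu : {sigma_finite_measure set (n.-tuple T) -> \bar R}).

Definition cons_pair (x : T * n.-tuple T) : n.+1.-tuple T :=
  [tuple of x.1 :: x.2].

Lemma measurable_cons_pair : measurable_fun [set: T * n.-tuple T] cons_pair.
Proof. by apply: measurable_cons. Qed.

(* mu \x nu, transported along the identification of T * T^n with T^(n+1) *)
Definition product_cons : set (n.+1.-tuple T) -> \bar R :=
  pushforward (mu \x nu)%E cons_pair.

Let product_cons0 : product_cons set0 = 0%E.
Proof. by rewrite /product_cons /pushforward preimage_set0 measure0. Qed.

Let product_cons_ge0 A : (0 <= product_cons A)%E.
Proof. by rewrite /product_cons /pushforward; exact: measure_ge0. Qed.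

Let product_cons_sigma_additive : semi_sigma_additive product_cons.
Proof.
move=> F mF tF mUF; rewrite /product_cons /pushforward preimage_bigcup.
apply: measure_semi_sigma_additive.
- by move=> k; rewrite -[X in measurable X]setTI; exact: measurable_cons_pair.
- apply/trivIsetP => /= i j _ _ ij; rewrite -preimage_setI.
  by move/trivIsetP : tF => /(_ _ _ _ _ ij) ->//; rewrite preimage_set0.
- rewrite -preimage_bigcup -[X in measurable X]setTI.
  exact: measurable_cons_pair.
Qed.

HB.instance Definition _ := isMeasure.Build _ _ _
  product_cons product_cons0 product_cons_ge0 product_cons_sigma_additive.

Let product_cons_sigma_finite : sigma_finite setT product_cons.
Proof.
have /sigma_finiteP[F [TF ndF Foo]] := sigma_finiteT mu.
have /sigma_finiteP[G [TG ndG Goo]] := sigma_finiteT nu.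
pose g (y : n.+1.-tuple T) : T * n.-tuple T := (thead y, [tuple of behead y]).
have mg : measurable_fun setT g.
  by apply/measurable_fun_pair; [exact: measurable_tnth|exact: measurable_behead].
exists (fun k => g @^-1` (F k `*` G k)).
  rewrite -preimage_bigcup (_ : \bigcup_k (F k `*` G k) = setT).
    by rewrite preimage_setT.
  rewrite -subTset => -[x y] _.
  have [i _ Fx] : (\bigcup_k F k) x by rewrite -TF.
  have [j _ Gy] : (\bigcup_k G k) y by rewrite -TG.
  exists (maxn i j) => //; split.
  - by move: x Fx; exact/subsetPset/ndF/leq_maxl.
  - by move: y Gy; exact/subsetPset/ndG/leq_maxr.
move=> k; have [mF Fk] := Foo k; have [mG Gk] := Goo k; split.
  by rewrite -[X in measurable X]setTI; apply: mg => //; exact: measurableX.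
rewrite /product_cons /pushforward -comp_preimage (_ : g \o cons_pair = id).
  by rewrite preimage_id product_measure1E// lte_mul_pinfty// ge0_fin_numE.
by apply/funext => -[x y]; rewrite /g /cons_pair /=; congr pair; exact/val_inj.
Qed.

HB.instance Definition _ := Measure_isSigmaFinite.Build _ _ _
  product_cons product_cons_sigma_finite.

End product_measure_cons.


(* the n-fold product measure mu \x ... \x mu on T^n *)
Fixpoint tuple_measure {R : realType} d (T : measurableType d)
    (mu : {sigma_finite_measure set T -> \bar R}) (n : nat) :
    {sigma_finite_measure set (n.-tuple T) -> \bar R} :=
  if n is k.+1 then product_cons mu (tuple_measure mu k) else \d_ [tuple].

(* measurableTypeR R is R with the sigma-algebra on which lebesgue_measure is
   defined; the measurable subsets of Rvec R n are the Borel subsets of R^n. *)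
Notation Rvec R n := (n.-tuple (measurableTypeR R)).
Notation Rmat R m n := (m.-tuple (n.-tuple (measurableTypeR R))).

Section lp_norms.
Context {R : realType}.

Definition vol (n : nat) : {sigma_finite_measure set (Rvec R n) -> \bar R} :=
  tuple_measure (@lebesgue_measure R) n.

(* Lebesgue measure on R^(m x n), seen as (R^n)^m *)
Definition mxvol (m n : nat) :
    {sigma_finite_measure set (Rmat R m n) -> \bar R} :=
  tuple_measure (vol n) m.

(* All exponents p : \bar R below are meant to be positive; the catch-all
   branches are for p = +oo. *)
Definition lpnorm (p : \bar R) (n : nat) (x : n.-tuple R) : R :=
  if p is r%:E then (\sum_(i < n) `|tnth x i| `^ r) `^ r^-1
  else \big[Num.max/0]_(i < n) `|tnth x i|.

Definition lpqnorm (p q : \bar R) (m n : nat) (x : Rmat R m n) : R :=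
  lpnorm p [tuple lpnorm q (tnth x i) | i < m].

Definition lpball (p : \bar R) {n : nat} : set (Rvec R n) :=
  [set x | lpnorm p x <= 1].

Definition lpsphere (p : \bar R) {n : nat} : set (Rvec R n) :=
  [set x | lpnorm p x = 1].

Definition lpqball (p q : \bar R) {m n : nat} : set (Rmat R m n) :=
  [set x | lpqnorm p q x <= 1].

Definition scalev (n : nat) (c : R) (x : Rvec R n) : Rvec R n :=
  [tuple c * tnth x i | i < n].

Definition scalemx (m n : nat) (c : R) (x : Rmat R m n) : Rmat R m n :=
  [tuple scalev c (tnth x i) | i < m].

Definition omega (p : \bar R) (n : nat) : R := fine (vol n (lpball p)).

Definition lpq_radius (p q : \bar R) (m n : nat) : R :=
  fine (mxvol m n (lpqball p q)) `^ (m * n)%:R^-1.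

Definition volV (p1 q1 p2 q2 : \bar R) (m n : nat) (t : R) : \bar R :=
  mxvol m n
    (scalemx (lpq_radius p1 q1 m n)^-1 @` lpqball p1 q1 `&`
     scalemx (t * (lpq_radius p2 q2 m n)^-1) @` lpqball p2 q2).

Definition cone (n : nat) (B : set (Rvec R n)) : set (Rvec R n) :=
  [set x | exists s b, [/\ 0 <= s <= 1, B b & x = scalev s b]].

Definition cone_measure (q : \bar R) (n : nat) (B : set (Rvec R n)) : \bar R :=
  (vol n (cone B) / (omega q n)%:E)%E.

Definition cone_distributed (q : \bar R) (n : nat) d (T : measurableType d)
    (P : probability T R) (Theta : {RV P >-> Rvec R n}) : Prop :=
  forall B : set (Rvec R n), measurable B -> B `<=` lpsphere q ->
    distribution P Theta B = cone_measure q B.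

Definition Gamma (x : R) : R :=
  \int[lebesgue_measure]_(u in `]0, +oo[) (u `^ (x - 1) * expR (- u)).

(* c / p, with c / oo = 0 *)
Definition divp (c : R) (p : \bar R) : R := if p is r%:E then c / r else 0.

(* p^(a / p), with oo^(a / oo) = 1 *)
Definition powp (p : \bar R) (a : R) : R := if p is r%:E then r `^ (a / r) else 1.

Definition Mom (p : \bar R) (a : R) : R :=
  powp p a / (a + 1) * (Gamma (divp (a + 1) p + 1) / Gamma (divp 1 p + 1)).

(* In \bar R, +oo / n%:R%:E = +oo for 0 < n. *)
Definition Acst (p1 q1 : \bar R) (p2 : R) (q2 : \bar R) (n : nat)
    d (T : measurableType d) (P : probability T R)
    (Theta : {RV P >-> Rvec R n}) : R :=
  ((omega q1 n * Gamma (divp n%:R p1 + 1)) /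
     (omega q2 n * Gamma (n%:R / p2 + 1))) `^ n%:R^-1 *
  (expR 1 / n%:R) `^ (divp 1 p1 - p2^-1) *
  (powp p1 1 / p2 `^ p2^-1) *
  ((Mom (p1 / n%:R%:E)%E (p2 / n%:R) *
     fine ('E_P[fun w => (lpnorm q2 (Theta w) `^ p2)%R])%E) `^ p2^-1)^-1.

End lp_norms.

(* Main.v *)
(* Let Z_1, .., Z_m be independent vectors of R^n with density proportional to
   exp(-|x|_q1^p1) (uniform on the ball when p1 = oo).  The volume of a cone inside
   the unit ball of the (p1,q1)-norm, relative to that ball, is the probability
   that (Z_1, .., Z_m) lies in the cone, so up to an exponentially small error V(t)
   is the probability that |Z|_(p2,q2) <= s_m |Z|_(p1,q1).  In logarithmic form
   this compares (1/p2) log of the mean of the |Z_i|_q2^p2 with (1/p1) log of the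
   mean of the |Z_i|_q1^p1 through a threshold which, by Stirling's formula for the
   radii, is log(tA) + O(log m / m).  Chebyshev's inequality decides the cases
   tA <> 1.  If tA = 1 the threshold is o(1/sqrt m), and one needs that a sum of
   m centered i.i.d. variables is at most o(sqrt m) with probability at most
   1/2 + o(1); the lower bound follows by exchanging the two norms.  That estimate
   is Lindeberg's replacement by a simple random walk together with the bound
   C(m,k) <= 2^m / sqrt(m+1). *)

Require Import Defs.
From HB Require Import structures.
From mathcomp Require Import all_boot all_order all_algebra.
From mathcomp Require Import all_classical all_reals all_analysis.
From mathcomp Require Import measurable_realfun.
From mathcomp Require Import ring lra zify.
Import Order.TTheory GRing.Theory Num.Theory.
Import numFieldNormedType.Exports.
Local Open Scope classical_set_scope.
Local Open Scope ring_scope.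

Set Implicit Arguments.
Unset Strict Implicit.
Unset Printing Implicit Defensive.

(** * Smoothing and the simple random walk *)

(** The critical case tA = 1 dictates the form of the estimates: the threshold is then o(1/sqrt m),
    so every error must be small against 1/sqrt m on the logarithmic scale. Three free parameters
    are placed between two conflicting demands. Removing the ball of radius exp(-h) needs m h large
    but sqrt m * h small, so h is of order 1/sqrt m. Replacing log X by X - 1 when |X - 1| <= h
    costs order h^2, while Chebyshev's inequality needs m h^2 large, so h^2 is a small multiple of
    1/sqrt m. Smoothing the indicator of a half-line over a width w costs order m / w^3 in
    Lindeberg's argument, while the walk must have few atoms inside that width, so w is a small
    multiple of sqrt m. No Gaussian limit appears. Two opposite comparisons of the means always
    cover the whole space, so an upper bound 1/2 + o(1) for both of them already forces the limit
    1/2. The only facts used about the comparison walk are its symmetry and the smallness of its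
    atoms. *)

Definition cubic_taylor (R : realType) (K : R) (f : R -> R) :=
  exists a b : R -> R, forall x y,
    `|f (x + y) - f x - a x * y - b x * y ^+ 2| <= K * `|y| ^+ 3.

Definition posc (R : realType) (x : R) : R := Num.max x 0 ^+ 3.

(** The third derivative of [posc] takes the values 0 and 6 only, which gives the remainder constant
    6/3! = 1. The four cases are the signs of x and x + y. *)
Lemma cubic_taylor_posc (R : realType) : cubic_taylor 1 (@posc R).
Proof.
exists (fun x => 3 * Num.max x 0 ^+ 2), (fun x => 3 * Num.max x 0) => x y.
rewrite mul1r -normrX /posc.
have [x0|x0] := leP x 0; have [xy0|xy0] := leP (x + y) 0.
- by rewrite !expr0n /= !mulr0 !mul0r !subr0 normr0.
- rewrite !expr0n /= !mulr0 !mul0r !subr0 !ger0_norm ?exprn_ge0//; try lra.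
  by apply: lerXn2r; rewrite ?nnegrE; lra.
- rewrite expr0n /= sub0r.
  have -> : - x ^+ 3 - 3 * x ^+ 2 * y - 3 * x * y ^+ 2 = y ^+ 3 - (x + y) ^+ 3 by ring.
  have -> : y ^+ 3 - (x + y) ^+ 3 = - ((- y) ^+ 3 - (- (x + y)) ^+ 3) by ring.
  have -> : y ^+ 3 = - (- y) ^+ 3 by ring.
  have h : (- (x + y)) ^+ 3 <= (- y) ^+ 3 by apply: lerXn2r; rewrite ?nnegrE; lra.
  have h0 : 0 <= (- (x + y)) ^+ 3 by apply: exprn_ge0; lra.
  rewrite !normrN !ger0_norm; lra.
- suff -> : (x + y) ^+ 3 - x ^+ 3 - 3 * x ^+ 2 * y - 3 * x * y ^+ 2 = y ^+ 3 by [].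
  by ring.
Qed.

Lemma cubic_taylorD (R : realType) (K L : R) f g :
  cubic_taylor K f -> cubic_taylor L g ->
  cubic_taylor (K + L) (fun x => f x + g x).
Proof.
move=> [a [b H]] [c [d H']]; exists (fun x => a x + c x), (fun x => b x + d x) => x y.
rewrite (mulrDl K L); apply: le_trans (lerD (H x y) (H' x y)).
apply: le_trans (ler_normD _ _); rewrite le_eqVlt; apply/orP; left; apply/eqP.
by congr `| _ |; ring.
Qed.

Lemma cubic_taylorZ (R : realType) (K c : R) f :
  cubic_taylor K f -> cubic_taylor (`|c| * K) (fun x => c * f x).
Proof.
move=> [a [b H]]; exists (fun x => c * a x), (fun x => c * b x) => x y.
have -> : c * f (x + y) - c * f x - c * a x * y - c * b x * y ^+ 2 =
   c * (f (x + y) - f x - a x * y - b x * y ^+ 2) by ring.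
by rewrite normrM -mulrA ler_wpM2l.
Qed.

Lemma cubic_taylor_comp (R : realType) (K c s : R) f :
  cubic_taylor K f -> cubic_taylor (K * `|s| ^+ 3) (fun x => f (s * x + c)).
Proof.
move=> [a [b H]].
exists (fun x => s * a (s * x + c)), (fun x => s ^+ 2 * b (s * x + c)) => x y.
have := H (s * x + c) (s * y); rewrite normrM (exprMn _ `|s|) (mulrA K).
have -> : s * x + c + s * y = s * (x + y) + c by ring.
by apply: le_trans; rewrite le_eqVlt; apply/orP; left; apply/eqP; congr `| _ |; ring.
Qed.

(* The integral of the quadratic B-spline with knots 0, 1, 2, 3. *)
Definition spline_step (R : realType) (x : R) : R :=
  1 + (-6^-1) * (posc x + (-3) * posc (x - 1) + 3 * posc (x - 2)
    + (-1) * posc (x - 3)).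

(** The truncated cubes carry the weights 1, 3, 3, 1 over 6, with sum 8/6. *)
Lemma cubic_taylor_spline_step (R : realType) : cubic_taylor (4/3) (@spline_step R).
Proof.
have P := @cubic_taylor_posc R.
have S c : cubic_taylor 1 (fun x => posc (x + c) : R).
  have := cubic_taylor_comp c 1 P; rewrite normr1 expr1n mulr1.
  by congr cubic_taylor; apply/funext => x; rewrite mul1r.
have C : cubic_taylor 0 (fun _ : R => 1 : R).
  by exists (fun=> 0), (fun=> 0) => x y; rewrite !mul0r !subr0 subrr normr0.
have := cubic_taylorD C (cubic_taylorZ (-6^-1) (cubic_taylorD (cubic_taylorD
 (cubic_taylorD P (cubic_taylorZ (-3) (S (-1)))) (cubic_taylorZ 3 (S (-2))))
  (cubic_taylorZ (-1) (S (-3))))).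
rewrite !normrN !normfV !normr_nat normr1.
by congr cubic_taylor; field.
Qed.

Lemma spline_step_le0 (R : realType) (x : R) : x <= 0 -> spline_step x = 1.
Proof.
move=> x0; rewrite /spline_step /posc !max_r; try lra.
Qed.

(** Beyond the last knot the bracket is the third difference of the cube, the constant 6, which
    cancels the leading 1. *)
Lemma spline_step_ge3 (R : realType) (x : R) : 3 <= x -> spline_step x = 0.
Proof.
by move=> x0; rewrite /spline_step /posc !max_l; [field|lra..].
Qed.

Lemma spline_step_itv (R : realType) (x : R) : 0 <= spline_step x <= 1.
Proof.
have [x0|x0] := leP x 0; first by rewrite spline_step_le0// ler01 lexx.
have [x3|x3] := leP 3 x; first by rewrite spline_step_ge3// ler01 lexx.
rewrite /spline_step /posc (max_l (ltW x0)) (@max_r _ _ (x - 3)); last lra.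
rewrite expr0n /= mulr0 addr0.
have [x1|x1] := leP x 1.
  rewrite !max_r; try lra.
  rewrite expr0n /= !mulr0 !addr0.
  have : x ^+ 3 <= 1 by apply: exprn_ile1; lra.
  have : 0 <= x ^+ 3 by apply: exprn_ge0; lra.
  by lra.
rewrite (@max_l _ _ (x - 1)); last lra.
have [x2|x2] := leP x 2.
  rewrite max_r; last lra.
  rewrite expr0n /= !mulr0 !addr0.
  have -> : x ^+ 3 + -3 * (x - 1) ^+ 3 = 1 + 3 * (x - 1) + 3 * (x - 1) ^+2 - 2 * (x - 1) ^+ 3 by ring.
  set y := x - 1.
  have y0 : 0 <= y by rewrite /y; lra.
  have y1 : y <= 1 by rewrite /y; lra.
  have h2 : y ^+ 2 <= y by rewrite expr2 ler_piMl.
  have h3 : y ^+ 3 <= y ^+ 2 by rewrite exprS ler_piMl// exprn_ge0.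
  have h0 : 0 <= y ^+ 3 by rewrite exprn_ge0.
  have : 1 - 2 * y ^+ 3 + 3 * y ^+ 2 + 3 * y <= 6.
    (* This is 3 y^2 - 2 y^3 <= 1, which leaves 2 + 3 y <= 6. *)
    have : 0 <= (1 - y) * (1 - y) * (1 + y *+ 2) by rewrite !mulr_ge0//; lra.
    have -> : (1 - y) * (1 - y) * (1 + y *+ 2) = 1 - 3 * y ^+ 2 + 2 * y ^+ 3 by ring.
    by lra.
  by lra.
rewrite max_l; last lra.
have -> : 1 + -6^-1 * (x ^+ 3 + -3 * (x - 1) ^+ 3 + 3 * (x - 2) ^+ 3) = (3 - x) ^+ 3 / 6 by field.
have : (3 - x) ^+ 3 <= 1 by apply: exprn_ile1; lra.
have : 0 <= (3 - x) ^+ 3 by apply: exprn_ge0; lra.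
by lra.
Qed.

Definition walk (R : realType) (s : R) (f : R -> R) : R -> R :=
  fun x => (f (x + s) + f (x - s)) / 2.

(** The coefficients a and b in [cubic_taylor] are arbitrary functions standing for f' and f''/2, so
    averaging two translates needs no differentiability and keeps the same K. *)
Lemma cubic_taylor_walk (R : realType) (K s : R) f :
  cubic_taylor K f -> cubic_taylor K (walk s f).
Proof.
move=> H; have := cubic_taylorZ 2^-1 (cubic_taylorD (cubic_taylor_comp s 1 H)
  (cubic_taylor_comp (- s) 1 H)).
rewrite normr1 expr1n mulr1 ger0_norm; last by rewrite invr_ge0.
congr cubic_taylor; first by field.
by apply/funext => x; rewrite /walk !mul1r mulrC.
Qed.

Lemma walk_itv (R : realType) (s : R) f : (forall x, 0 <= f x <= 1) ->
  forall x, 0 <= walk s f x <= 1.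
Proof. by move=> h x; have := h (x + s); have := h (x - s); rewrite /walk; lra. Qed.

(** With k upward steps out of m the displacement is (2k - m) s. The induction is Pascal's rule: the
    two halves of the last [walk] supply its two terms. *)
Lemma iter_walkE (R : realType) (s : R) f m x :
  iter m (walk s) f x =
  \sum_(k < m.+1) 'C(m, k)%:R / 2 ^+ m * f (x + (k%:R * 2 - m%:R) * s).
Proof.
elim: m x => [|m IH] x.
  by rewrite big_ord1 bin0 expr0 divr1 mul1r !mul0r subr0 mul0r addr0.
rewrite iterS {1}/walk !IH big_ord_recr/= binn.
rewrite [RHS]big_ord_recr big_ord_recl/= binn bin0.
under [X in _ = _ + X + _]eq_bigr => i _ do
  rewrite /bump/= add1n binS natrD mulrDl mulrDl.
rewrite big_split/= addrC.
rewrite (_ : \sum_(i < m) 'C(m, i)%:R / 2 ^+ m.+1 * f (x + ((1 + i)%N%:R * 2 - m.+1%:R) * s)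
 = 2^-1 * \sum_(i < m) 'C(m, i)%:R / 2 ^+ m * f (x + s + (i%:R * 2 - m%:R) * s)); last first.
  rewrite mulr_sumr; apply: eq_bigr => i _; rewrite exprS invfM.
  rewrite [RHS]mulrA; congr (_ * f _); first by ring.
  by rewrite -[m.+1]addn1 !natrD; ring.
rewrite big_ord_recl/= bin0.
rewrite (_ : \sum_(i < m) 'C(m, i.+1)%:R / 2 ^+ m.+1 * _ 
 = 2^-1 * \sum_(i < m) 'C(m, bump 0 i)%:R / 2 ^+ m * f (x - s + ((bump 0 i)%:R * 2 - m%:R) * s)); last first.
  rewrite mulr_sumr; apply: eq_bigr => i _; rewrite exprS invfM /bump/= add1n.
  rewrite [RHS]mulrA; congr (_ * f _); first by ring.
  by rewrite -[m.+1]addn1 !natrD; ring.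
rewrite exprS invfM.
have -> : x + s + (m%:R * 2 - m%:R) * s = x + (m.+1%:R * 2 - m.+1%:R) * s.
  by rewrite -[m.+1]addn1 !natrD; ring.
have -> : x - s + (0 * 2 - m%:R) * s = x + (0 * 2 - m.+1%:R) * s.
  by rewrite -[m.+1]addn1 !natrD; ring.
by ring.
Qed.

Lemma bin_step n k : ((k.+1).*2 <= n.+1)%N -> ('C(n, k) <= 'C(n, k.+1))%N.
Proof.
move=> h; have := mul_bin_left n k => e.
have : (k.+1 * 'C(n, k) <= k.+1 * 'C(n, k.+1))%N.
  by rewrite e leq_mul2r; apply/orP; right; lia.
by rewrite leq_mul2l.
Qed.

Lemma bin_half_max n k : ('C(n, k) <= 'C(n, n./2))%N.
Proof.
have low j : (j <= n./2)%N -> ('C(n, j) <= 'C(n, n./2))%N.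
  move=> jn; rewrite -(subKn jn); move: (n./2 - j)%N (leq_subr j n./2) => i.
  elim: i => [|i IH] ih; first by rewrite subn0.
  apply: leq_trans (IH (ltnW ih)).
  have -> : (n./2 - i = (n./2 - i.+1).+1)%N by lia.
  by apply: bin_step; lia.
have [kn|nk] := leqP k n; last by rewrite bin_small.
have [|nk] := leqP k n./2; first exact: low.
by rewrite -bin_sub//; apply: low; lia.
Qed.

(** Consecutive central weights have ratio (2k+1)/(2k+2), so the induction step is (2k+1)(2k+3) <=
    (2k+2)^2. *)
Lemma central_bin_le (R : realType) k :
  ('C(k.*2, k)%:R / 4 ^+ k) ^+ 2 * (k.*2.+1)%:R <= 1 :> R.
Proof.
elim: k => [|k IH]; first by rewrite bin0 expr0 divr1 expr1n mulr1.
have e : (k.+1 * 'C(k.+1.*2, k.+1) = 2 * k.*2.+1 * 'C(k.*2, k))%N.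
  have h1 := mul_bin_left k.*2.+1 k.
  have h2 := mul_bin_down k.*2.+1 k.
  have h3 : 'C(k.*2.+2, k.+1) = ('C(k.*2.+1, k.+1) + 'C(k.*2.+1, k))%N by rewrite binS.
  rewrite doubleS h3 mulnDr h1.
  move: h2; rewrite /=; have -> : (k.*2.+1 - k = k.+1)%N by lia.
  by lia.
have e' : ('C(k.+1.*2, k.+1)%:R / 4 ^+ k.+1 : R) =
    'C(k.*2, k)%:R / 4 ^+ k * ((k%:R * 2 + 1) / (k%:R * 2 + 2)).
  have k2 : k%:R * 2 + 2 != 0 :> R by rewrite gt_eqF// ltr_wpDl// mulr_ge0.
  have k1 : k%:R + 1 != 0 :> R by rewrite gt_eqF// ltr_wpDl.
  have := congr1 (fun x => x%:R : R) e; rewrite !natrM -[k.+1]addn1 -[k.*2.+1]addn1 -[k.*2]muln2.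
  rewrite !(natrM, natrD) => E.
  have -> : 'C((k+1).*2, k + 1)%:R = 'C(k * 2, k)%:R * (2 * (k%:R * 2 + 1) / (k%:R + 1)) :> R.
    apply: (mulfI k1); rewrite E; field.
    by rewrite addrC.
  rewrite exprD expr1; field.
  by rewrite k2 k1 expf_neq0.
rewrite e' exprMn -mulrA.
apply: le_trans IH; rewrite mulrC [leRHS]mulrC.
rewrite ler_wpM2r ?sqr_ge0//.
have k0 : 0 <= k%:R :> R by [].
rewrite doubleS -[k.*2.+3]addn1 -[k.*2.+2]addn1 -[k.*2.+1]addn1 !natrD -muln2 natrM.
rewrite expr_div_n mulrAC ler_pdivrMr ?exprn_gt0//; last lra.
Qed.

(** For even m this is the central estimate. For odd m the two central coefficients of row m are
    equal and add up to the central one of row m+1, so the bound for m+1 applies. *)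
Lemma bin_le_sqrt (R : realType) m k :
  'C(m, k)%:R / 2 ^+ m <= (Num.sqrt m.+1%:R)^-1 :> R.
Proof.
have evn j i : 'C(j.*2, i)%:R / 2 ^+ j.*2 <= (Num.sqrt j.*2.+1%:R)^-1 :> R.
  have s0 : 0 < Num.sqrt j.*2.+1%:R :> R by rewrite sqrtr_gt0.
  have le1 : 'C(j.*2, i)%:R / 2 ^+ j.*2 <= 'C(j.*2, j)%:R / 4 ^+ j :> R.
    have -> : 4 ^+ j = 2 ^+ j.*2 :> R.
      by rewrite -mul2n exprM; congr (_ ^+ _); ring.
    rewrite ler_wpM2r ?invr_ge0 ?exprn_ge0// ler_nat.
    by have := bin_half_max j.*2 i; rewrite doubleK.
  apply: le_trans le1 _; rewrite -[leRHS]div1r ler_pdivlMr//.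
  have := central_bin_le R j; rewrite -[X in _ * X <= 1]sqr_sqrtr// -exprMn.
  by rewrite expr_le1// mulr_ge0// divr_ge0// exprn_ge0.
have [modd|meven] := boolP (odd m); last first.
  by have := evn m./2 k; rewrite even_halfK.
have le2 : ('C(m, k).*2 <= 'C(m.+1.*2./2, m./2.+1))%N.
  have := bin_half_max m k; rewrite doubleK binS.
  have -> : 'C(m, m./2.+1) = 'C(m, m./2).
    rewrite -bin_sub; last by have := odd_double_half m; rewrite modd; lia.
    by congr 'C(_, _); have := odd_double_half m; rewrite modd; lia.
  by lia.
have := evn m./2.+1 m./2.+1.
have em : (m./2.+1).*2 = m.+1 by have := odd_double_half m; rewrite modd; lia.
move: le2; rewrite -em doubleK em => le2 h.
have : 'C(m, k)%:R / 2 ^+ m <= 'C(m.+1, m./2.+1)%:R / 2 ^+ m.+1 :> R.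
  rewrite exprS invfM mulrA ler_wpM2r ?invr_ge0 ?exprn_ge0//.
  by rewrite ler_pdivlMr// -natrM ler_nat muln2.
move=> /le_trans; apply; apply: le_trans h _.
by rewrite lef_pV2 ?posrE ?sqrtr_gt0// ler_wsqrtr// ler_nat.
Qed.

(* The terms with k < m/2 have total weight at most 1/2 by symmetry, and at
   most L/(2s) + 1 further terms are nonzero. *)
Lemma iter_walk_le (R : realType) (s L : R) (f : R -> R) m : 0 < s -> 0 <= L ->
  (forall x, 0 <= f x <= 1) -> (forall x, L <= x -> f x = 0) ->
  iter m (walk s) f 0 <= 2^-1 + (L / (2 * s) + 1) / Num.sqrt m.+1%:R.
Proof.
move=> s0 L0 f01 fL; rewrite iter_walkE.
pose w k : R := 'C(m, k)%:R / 2 ^+ m.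
have w0 k : 0 <= w k by rewrite /w divr_ge0// exprn_ge0.
pose g k := f (0 + (k%:R * 2 - m%:R) * s).
rewrite (bigID (fun k : 'I_m.+1 => (k.*2 < m)%N))/=.
have sumw : \sum_(k < m.+1) w k = 1.
  rewrite -mulr_suml -natr_sum.
  have := Pascal 1 1 m; rewrite addn1 => e.
  under eq_bigr do [].
  rewrite (_ : (\sum_(i < m.+1) 'C(m, i) = 2 ^ m)%N).
    by rewrite natrX divff// expf_neq0.
  by rewrite e; apply: eq_bigr => i _; rewrite !exp1n !muln1.
apply: lerD.
  apply: (@le_trans _ _ (\sum_(k < m.+1 | (k.*2 < m)%N) w k)).
    apply: ler_sum => k _; rewrite ler_piMr ?w0//.
    by have /andP[] := f01 (0 + (k%:R * 2 - m%:R) * s).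
  have e : \sum_(k < m.+1 | (k.*2 < m)%N) w k = \sum_(k < m.+1 | (m < k.*2)%N) w k.
    rewrite (reindex_inj rev_ord_inj)/=; apply: eq_big => [k|k _].
      by have := ltn_ord k; lia.
    by rewrite /w subSS bin_sub// -ltnS ltn_ord.
  have : \sum_(k < m.+1 | (k.*2 < m)%N) w k + \sum_(k < m.+1 | (m < k.*2)%N) w k <= 1.
    rewrite -sumw [leRHS](bigID (fun k : 'I_m.+1 => (k.*2 < m)%N))/=.
    rewrite lerD2l; rewrite big_mkcond [leRHS]big_mkcond/=.
    by apply: ler_sum => k _; case: ifP; case: ifP => //; have := w0 k; lia.
  by rewrite -e; lra.
pose N := (Num.truncn (L / (2 * s))).+1.
have Ls0 : 0 <= L / (2 * s) by rewrite divr_ge0// mulr_ge0// ltW.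
have NL : N%:R <= L / (2 * s) + 1.
  by rewrite /N -addn1 natrD lerD2r; have /andP[] := truncn_itv Ls0.
have LN : L / (2 * s) < N%:R by have /andP[] := truncn_itv Ls0.
have cntE M a : (\sum_(k < M | a <= k < a + N) 1 = minn N (M - a))%N.
  elim: M => [|M IH]; first by rewrite big_ord0 sub0n minn0.
  by rewrite big_mkcond big_ord_recr/= -big_mkcond/= IH; case: ifP; lia.
(* [uphalf m] is the least k with m <= 2k. From k = [uphalf m + N] on, the position (2k - m) s is at
   least 2 N s > L, where f vanishes. *)
apply: (@le_trans _ _ (\sum_(k < m.+1 | (uphalf m <= k < uphalf m + N)%N)
    (Num.sqrt m.+1%:R)^-1)).
  rewrite big_mkcond [leRHS]big_mkcond/=; apply: ler_sum => k _.
  have [h1|h1] := boolP (k.*2 < m)%N.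
    by rewrite /= ifF//; lia.
  have [h2|h2] := ltnP k (uphalf m + N)%N.
    have -> : (uphalf m <= k)%N by lia.
    rewrite /=; apply: le_trans (bin_le_sqrt R m k).
    by rewrite ler_piMr ?w0//; have /andP[] := f01 (0 + (k%:R * 2 - m%:R) * s).
  rewrite andbF /= fL ?mulr0// add0r.
  rewrite -ler_pdivrMr//.
  have h3 : m%:R + N%:R * 2 <= k%:R * 2 :> R.
    by rewrite -!natrM -natrD ler_nat; lia.
  have : L / s = L / (2 * s) * 2 by field; rewrite gt_eqF.
  by lra.
rewrite sumr_const -[leLHS]mulr_natl.
rewrite ler_wpM2r ?invr_ge0 ?sqrtr_ge0//.
apply: le_trans NL; rewrite ler_nat -sum1_card.
by rewrite cntE geq_minl.
Qed.

(** * Product measures on tuples *)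

Section tuple_measure_theory.
Context {R : realType} d (T : measurableType d).
Implicit Types mu : {sigma_finite_measure set T -> \bar R}.
Local Open Scope ereal_scope.

Lemma ge0_integral_tuple_measure0 mu (F : 0.-tuple T -> \bar R) :
  measurable_fun setT F -> \int[tuple_measure mu 0]_x F x = F [tuple].
Proof. by move=> mF; rewrite /= integral_dirac// diracT mul1e. Qed.

Lemma ge0_integral_tuple_measureS mu n (F : n.+1.-tuple T -> \bar R) :
  measurable_fun setT F -> (forall x, 0 <= F x) ->
  \int[tuple_measure mu n.+1]_x F x =
  \int[mu]_x \int[tuple_measure mu n]_y F [tuple of x :: y].
Proof.
move=> mF F0; have mc := @measurable_cons_pair _ T n.
transitivity (\int[(mu \x tuple_measure mu n)]_z (F \o @cons_pair _ T n) z).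
  by rewrite /= [LHS](ge0_integral_pushforward mc).
rewrite fubini_tonelli1//; first exact: measurableT_comp mF mc.
by move=> x; exact: F0.
Qed.

Lemma measurable_tuple_consr n (F : n.+1.-tuple T -> \bar R) (x : T) :
  measurable_fun setT F ->
  measurable_fun setT (fun y : n.-tuple T => F [tuple of x :: y]).
Proof. by move=> mF; apply: measurableT_comp mF _; exact: measurable_cons. Qed.

Lemma measurable_integral_tuple_cons mu n (F : n.+1.-tuple T -> \bar R) :
  measurable_fun setT F -> (forall x, 0 <= F x) ->
  measurable_fun setT (fun x => \int[tuple_measure mu n]_y F [tuple of x :: y]).
Proof.
move=> mF F0; have mc := @measurable_cons_pair _ T n.
apply: (measurable_fun_fubini_tonelli_F (F \o @cons_pair _ T n)) => //.
  exact: measurableT_comp mF mc.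
by move=> x; exact: F0.
Qed.

(** Applied twice: to multiplication by a scalar on R, which gives the scaling of [vol], and to
    [scalev], which gives that of [mxvol]. The constant c is the reciprocal of the Jacobian. *)
Lemma ge0_integral_tuple_measure_map mu (f : T -> T) (c : R) :
  measurable_fun setT f -> (0 <= c)%R ->
  (forall F : T -> \bar R, measurable_fun setT F -> (forall x, 0 <= F x) ->
     \int[mu]_x F (f x) = c%:E * \int[mu]_x F x) ->
  forall n (F : n.-tuple T -> \bar R), measurable_fun setT F ->
  (forall x, 0 <= F x) ->
  \int[tuple_measure mu n]_x F (map_tuple f x) =
  (c ^+ n)%:E * \int[tuple_measure mu n]_x F x.
Proof.
move=> mf c0 fc.
have mm k : measurable_fun setT (fun x : k.-tuple T => map_tuple f x).
  apply/measurable_fun_tnthP => i; rewrite (_ : _ \o _ = fun x => f (tnth x i)).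
    exact: measurableT_comp mf (measurable_tnth i).
  by apply/funext => x /=; rewrite tnth_map.
elim => [|n IH] F mF F0.
  rewrite !ge0_integral_tuple_measure0//; last exact: measurableT_comp mF (mm _).
  by rewrite expr0 mul1e; congr F; exact/val_inj.
rewrite ge0_integral_tuple_measureS//; last exact: measurableT_comp mF (mm _).
rewrite ge0_integral_tuple_measureS//.
under eq_integral => x _.
  under eq_integral => y _.
    rewrite (_ : map_tuple f _ = [tuple of f x :: map_tuple f y]); last exact: val_inj.
    over.
  rewrite (IH (fun y => F [tuple of f x :: y]))//; last exact: measurable_tuple_consr.
  over.
rewrite ge0_integralZl_EFin; [|by []| | |exact: exprn_ge0].
- rewrite (fc (fun x => \int[tuple_measure mu n]_y F [tuple of x :: y])).
  + by rewrite muleA -EFinM exprSr.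
  + exact: measurable_integral_tuple_cons.
  + by move=> x; exact: integral_ge0.
- by move=> x _; exact: integral_ge0.
- apply: (measurableT_comp (f := fun x => \int[tuple_measure mu n]_y F [tuple of x :: y])) => //.
  exact: measurable_integral_tuple_cons.
Qed.

Lemma tuple_measure_setT mu n : mu setT = 1 -> tuple_measure mu n setT = 1.
Proof.
move=> mu1; elim: n => [|n IH]; first by rewrite /= diracT.
transitivity (\int[tuple_measure mu n.+1]_x (\1_[set: n.+1.-tuple T] x)%:E).
  by rewrite integral_indic// setIT.
rewrite ge0_integral_tuple_measureS//.
  rewrite -[RHS]mu1 -[RHS]mul1e -(integral_cst mu measurableT 1).
  apply: eq_integral => x _.
  rewrite -[RHS]IH -[RHS]mul1e -(integral_cst (tuple_measure mu n) measurableT 1).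
  by apply: eq_integral => y _; rewrite indicT.
exact/measurable_EFinP/measurable_indic.
Qed.

(** A density is expressed by integrals of nonnegative functions, the form in which [radial_law]
    states it; the product density then comes from one application of [gd] per coordinate. *)
Lemma ge0_integral_tuple_measure_density mu (nu : {sigma_finite_measure set T -> \bar R})
    (g : T -> R) : measurable_fun setT g -> (forall x, 0 <= g x)%R ->
  (forall F : T -> \bar R, measurable_fun setT F -> (forall x, 0 <= F x) ->
     \int[nu]_x F x = \int[mu]_x ((g x)%:E * F x)) ->
  forall n (F : n.-tuple T -> \bar R), measurable_fun setT F ->
  (forall x, 0 <= F x) ->
  \int[tuple_measure nu n]_x F x =
  \int[tuple_measure mu n]_x ((\prod_(i < n) g (tnth x i))%:E * F x).
Proof.
move=> mg g0 gd.
have mp n : measurable_fun setT (fun x : n.-tuple T => \prod_(i < n) g (tnth x i))%R.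
  apply: measurable_prod => i _; exact: measurableT_comp mg (measurable_tnth i).
have p0 n (x : n.-tuple T) : (0 <= \prod_(i < n) g (tnth x i))%R by exact: prodr_ge0.
have mpF n (F : n.-tuple T -> \bar R) : measurable_fun setT F ->
    measurable_fun setT (fun x => (\prod_(i < n) g (tnth x i))%:E * F x).
  by move=> mF; apply: emeasurable_funM => //; apply/measurable_EFinP; exact: mp.
elim => [|n IH] F mF F0.
  rewrite !ge0_integral_tuple_measure0//; last exact: mpF.
  by rewrite big_ord0 mul1e.
rewrite !ge0_integral_tuple_measureS//; last 2 first.
- exact: mpF.
- by move=> x; rewrite mule_ge0// lee_fin.
rewrite gd; last 2 first.
- exact: measurable_integral_tuple_cons.
- by move=> x; exact: integral_ge0.
apply: eq_integral => x _.
rewrite IH//; last exact: measurable_tuple_consr.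
rewrite -ge0_integralZl_EFin//; last 2 first.
- by move=> y _; rewrite mule_ge0// lee_fin.
- by apply: mpF; exact: measurable_tuple_consr.
apply: eq_integral => y _; rewrite muleA -EFinM; congr (_%:E * _).
rewrite big_ord_recl tnth0; congr (_ * _)%R; apply: eq_bigr => i _.
by rewrite tnthS.
Qed.

End tuple_measure_theory.

(** * Sums of independent identically distributed variables *)

Section sums_of_iid.
Context {R : realType} d (T : measurableType d) (P : probability T R).

Lemma probability_integral_cst (c : R) : (\int[P]_x c%:E = c%:E)%E.
Proof.
rewrite (integral_cst P measurableT); transitivity (c%:E * 1)%E; last exact: mule1.
by congr (_ * _)%E; exact: probability_setT.
Qed.

Lemma probability_Rintegral_cst (c : R) : \int[P]_x c = c.
Proof. by rewrite /Rintegral probability_integral_cst. Qed.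

(** Lower powers are dominated by 1 + |z|^k. *)
Lemma integrable_pow_le (z : T -> R) (j k : nat) : measurable_fun setT z ->
  (j <= k)%N -> P.-integrable setT (EFin \o (fun x => `|z x| ^+ k)) ->
  P.-integrable setT (EFin \o (fun x => z x ^+ j)).
Proof.
move=> mz jk ik.
have i1 : P.-integrable setT (EFin \o (fun x => 1 + `|z x| ^+ k)).
  have := integrableD measurableT (finite_measure_integrable_cst P 1 (A := setT) measurableT) ik.
  by apply: eq_integrable => // x _.
apply: le_integrable i1 => //.
  by apply/measurable_EFinP; exact: measurable_funX.
move=> x _ /=; rewrite lee_fin normrX [leRHS]ger0_norm; last by rewrite addr_ge0// exprn_ge0.
have [z1|z1] := leP `|z x| 1.
  by rewrite (le_trans (exprn_ile1 _ _ z1))// lerDl exprn_ge0.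
by rewrite (le_trans (ler_weXn2l (ltW z1) jk))// lerDr.
Qed.

Lemma measurable_sum_tnth n (z : T -> R) : measurable_fun setT z ->
  measurable_fun setT (fun x : n.-tuple T => \sum_(i < n) z (tnth x i)).
Proof.
move=> mz; apply: measurable_sum => i.
exact: measurableT_comp mz (measurable_tnth i).
Qed.

(** The variable z and a fair sign times s share the moments 0 and s^2, so the Taylor polynomials of
    g at x have equal means and only the two cubic remainders survive. *)
Lemma integral_taylor_step (z : T -> R) (s K : R) (g : R -> R) x :
  measurable_fun setT z -> P.-integrable setT (EFin \o (fun x => `|z x| ^+ 3)) ->
  \int[P]_y z y = 0 -> \int[P]_y (z y ^+ 2) = s ^+ 2 -> 0 < s ->
  measurable_fun setT g -> (forall y, 0 <= g y <= 1) -> cubic_taylor K g ->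
  (\int[P]_y (g (x + z y))%:E <=
   (walk s g x + K * ((\int[P]_y (`|z y| ^+ 3)) + s ^+ 3))%:E)%E.
Proof.
move=> mz iz3 z0 z2 s0 mg g01 [a [b tg]].
have iz1 : P.-integrable setT (EFin \o (fun y => z y)) := @integrable_pow_le z 1 3 mz isT iz3.
have iz2 := @integrable_pow_le z 2 3 mz isT iz3.
have i0 := finite_measure_integrable_cst P (g x) (A := setT) measurableT.
have j1 : P.-integrable setT (EFin \o (fun y => a x * z y)).
  by have := integrableZl measurableT (a x) iz1; apply: eq_integrable.
have j2 : P.-integrable setT (EFin \o (fun y => b x * z y ^+ 2)).
  by have := integrableZl measurableT (b x) iz2; apply: eq_integrable.
have j3 : P.-integrable setT (EFin \o (fun y => K * `|z y| ^+ 3)).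
  by have := integrableZl measurableT K iz3; apply: eq_integrable.
have k1 : P.-integrable setT (EFin \o (fun y => g x + a x * z y)).
  by have := integrableD measurableT i0 j1; apply: eq_integrable.
have k2 : P.-integrable setT (EFin \o (fun y => g x + a x * z y + b x * z y ^+ 2)).
  by have := integrableD measurableT k1 j2; apply: eq_integrable.
have k3 : P.-integrable setT (EFin \o (fun y => g x + a x * z y + b x * z y ^+ 2 + K * `|z y| ^+ 3)).
  by have := integrableD measurableT k2 j3; apply: eq_integrable.
have mgx : measurable_fun setT (fun y => g (x + z y)).
  by apply: measurableT_comp => //; exact: measurable_funD.
apply: (@le_trans _ _ (\int[P]_y (g x + a x * z y + b x * z y ^+ 2 + K * `|z y| ^+ 3)%:E)%E).
  apply: le_integral => //.
    apply: (le_integrable measurableT _ _ (finite_measure_integrable_cst P 1 (A := setT) measurableT)).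
      exact/measurable_EFinP.
    move=> y _ /=; rewrite lee_fin normr1 ger0_norm; by have /andP[] := g01 (x + z y).
  move=> y _; rewrite lee_fin; have := tg x (z y); rewrite ler_norml => /andP[_].
  by lra.
have -> : (\int[P]_y (g x + a x * z y + b x * z y ^+ 2 + K * `|z y| ^+ 3)%:E)%E =
    (\int[P]_y (g x + a x * z y + b x * z y ^+ 2 + K * `|z y| ^+ 3))%:E.
  by rewrite /Rintegral fineK//; exact: integrable_fin_num k3.
rewrite (RintegralD measurableT k2 j3) (RintegralD measurableT k1 j2).
rewrite (RintegralD measurableT i0 j1) !RintegralZl// z0 z2.
rewrite probability_Rintegral_cst.
rewrite lee_fin /walk.
(* In the average of the bounds at s and -s the linear terms cancel and the quadratic term is b x *
   s^2, the same as for z. *)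
have := tg x s; have := tg x (- s).
rewrite normrN (gtr0_norm s0) !ler_norml => /andP[+ _] /andP[+ _].
rewrite sqrrN mulrDr; set D := K * s ^+ 3; set D' := K * \int[P]_y _.
by lra.
Qed.

Lemma measurable_walk (s : R) (f : R -> R) :
  measurable_fun setT f -> measurable_fun setT (walk s f).
Proof.
move=> mf; apply: measurable_funM => //; apply: measurable_funD.
  by apply: measurableT_comp => //; exact: measurable_funD.
by apply: measurableT_comp => //; exact: measurable_funB.
Qed.

(* Lindeberg's replacement argument. The Taylor class is stable under walk, so
   replacing one summand at a time costs the same error each time. *)
Lemma integral_sum_le_iter_walk (z : T -> R) (s K : R) (f : R -> R) :
  measurable_fun setT z -> P.-integrable setT (EFin \o (fun x => `|z x| ^+ 3)) ->
  \int[P]_y z y = 0 -> \int[P]_y (z y ^+ 2) = s ^+ 2 -> 0 < s ->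
  measurable_fun setT f -> (forall y, 0 <= f y <= 1) -> cubic_taylor K f ->
  forall n x,
  (\int[tuple_measure P n]_y (f (x + \sum_(i < n) z (tnth y i)))%:E <=
   (iter n (walk s) f x + K * ((\int[P]_y (`|z y| ^+ 3)) + s ^+ 3) *+ n)%:E)%E.
Proof.
move=> mz iz3 z0 z2 s0 mf f01 tf.
set tau := K * _.
have mS n (x : R) : measurable_fun setT (fun y : n.-tuple T =>
    (f (x + \sum_(i < n) z (tnth y i)))%:E).
  apply/measurable_EFinP; apply: measurableT_comp => //; apply: measurable_funD => //.
  exact: measurable_sum_tnth.
elim => [|n IH] x.
  by rewrite ge0_integral_tuple_measure0// big_ord0 addr0 mulr0n addr0.
rewrite ge0_integral_tuple_measureS//; last first.
  by move=> y; rewrite lee_fin; have /andP[] := f01 (x + \sum_(i < n.+1) z (tnth y i)).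
have g01 k y : 0 <= iter k (walk s) f y <= 1.
  by elim: k y => //= k; exact: walk_itv.
have mg k : measurable_fun setT (iter k (walk s) f).
  by elim: k => //= k; exact: measurable_walk.
have tg k : cubic_taylor K (iter k (walk s) f).
  by elim: k => //= k; exact: cubic_taylor_walk.
have mgx : measurable_fun setT (fun y => iter n (walk s) f (x + z y)).
  by apply: measurableT_comp => //; exact: measurable_funD.
apply: (@le_trans _ _ (\int[P]_y ((iter n (walk s) f (x + z y))%:E + (tau *+ n)%:E))%E).
  apply: ge0_le_integral => //.
  - by move=> y _; apply: integral_ge0 => w _; rewrite lee_fin; case/andP: (f01 (x + \sum_(i < n.+1) z (tnth [tuple of y :: w] i))).
  - apply: (@measurable_integral_tuple_cons _ _ _ P n (fun y => (f (x + \sum_(i < n.+1) z (tnth y i)))%:E)) => // y.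
    by rewrite lee_fin; case/andP: (f01 (x + \sum_(i < n.+1) z (tnth y i))).
  - by apply: emeasurable_funD => //; exact/measurable_EFinP.
  move=> y _; rewrite -EFinD; apply: le_trans (IH (x + z y)).
  rewrite le_eqVlt; apply/orP; left; apply/eqP; apply: eq_integral => w _.
  rewrite big_ord_recl tnth0 addrA; congr (f (_ + _))%:E.
  by apply: eq_bigr => i _; rewrite tnthS.
have tau0 : 0 <= tau.
  rewrite mulr_ge0//; last by rewrite addr_ge0 ?exprn_ge0 ?(ltW s0)// Rintegral_ge0.
  (* The Taylor bound at y = 1 forces K >= 0. *)
  have [a [b /(_ 0 1)]] := tf; rewrite normr1 !expr1n !mulr1 => h; exact: le_trans (normr_ge0 _) h.
rewrite ge0_integralD//; first last.
- by move=> y _; rewrite lee_fin mulrn_wge0.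
- exact/measurable_EFinP.
- by move=> y _; rewrite lee_fin; case/andP: (g01 n (x + z y)).
rewrite probability_integral_cst.
have := integral_taylor_step x mz iz3 z0 z2 s0 (mg n) (g01 n) (tg n).
by move=> h; rewrite mulrSr [tau *+ n + _]addrC addrA [leRHS]EFinD leeD2r.
Qed.

(** The offset x carries the induction: the first summand is absorbed into it, and centering kills
    the cross term. *)
Lemma tuple_integral_sqr_sum (u : T -> R) (v : R) : measurable_fun setT u ->
  P.-integrable setT (EFin \o u) ->
  P.-integrable setT (EFin \o (fun x => u x ^+ 2)) ->
  \int[P]_x u x = 0 -> \int[P]_x (u x ^+ 2) = v ->
  forall n x, (\int[tuple_measure P n]_y ((x + \sum_(i < n) u (tnth y i)) ^+ 2)%:E =
    (x ^+ 2 + v *+ n)%:E)%E.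
Proof.
move=> mu iu iu2 u0 u2.
have v0 : 0 <= v by rewrite -u2 Rintegral_ge0// => y _; exact: sqr_ge0.
have mS n (x : R) : measurable_fun setT (fun y : n.-tuple T =>
    ((x + \sum_(i < n) u (tnth y i)) ^+ 2)%:E).
  apply/measurable_EFinP; apply: measurable_funX; apply: measurable_funD => //.
  exact: measurable_sum_tnth.
elim => [|n IH] x.
  by rewrite ge0_integral_tuple_measure0// big_ord0 addr0 mulr0n addr0.
rewrite ge0_integral_tuple_measureS//; last by move=> y; rewrite lee_fin sqr_ge0.
rewrite (eq_integral (fun y => (x ^+ 2 + (2 * x) * u y + u y ^+ 2 + v *+ n)%:E)); last first.
  move=> y _; rewrite -[RHS]/(EFin _).
  have -> : x ^+ 2 + 2 * x * u y + u y ^+ 2 + v *+ n = (x + u y) ^+ 2 + v *+ n by ring.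
  rewrite -IH; apply: eq_integral => w _.
  rewrite big_ord_recl tnth0 addrA; congr ((_ + _) ^+ 2)%:E.
  by apply: eq_bigr => i _; rewrite tnthS.
have i0 c := finite_measure_integrable_cst P c (A := setT) measurableT.
have j1 : P.-integrable setT (EFin \o (fun y => (2 * x) * u y)).
  by have := integrableZl measurableT (2 * x) iu; apply: eq_integrable.
have k1 : P.-integrable setT (EFin \o (fun y => x ^+ 2 + (2 * x) * u y)).
  by have := integrableD measurableT (i0 (x ^+ 2)) j1; apply: eq_integrable.
have k2 : P.-integrable setT (EFin \o (fun y => x ^+ 2 + (2 * x) * u y + u y ^+ 2)).
  by have := integrableD measurableT k1 iu2; apply: eq_integrable.
have k3 : P.-integrable setT (EFin \o (fun y => x ^+ 2 + (2 * x) * u y + u y ^+ 2 + v *+ n)).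
  by have := integrableD measurableT k2 (i0 (v *+ n)); apply: eq_integrable.
transitivity ((\int[P]_y (x ^+ 2 + (2 * x) * u y + u y ^+ 2 + v *+ n))%:E)%E.
  by rewrite /Rintegral fineK//; exact: integrable_fin_num k3.
rewrite (RintegralD measurableT k2 (i0 (v *+ n))) (RintegralD measurableT k1 iu2).
rewrite (RintegralD measurableT (i0 (x ^+ 2)) j1) RintegralZl// u0 u2 mulr0.
by rewrite !probability_Rintegral_cst mulrS; congr EFin; ring.
Qed.

Lemma tuple_measure_chebyshev (u : T -> R) (c : R) n : measurable_fun setT u ->
  P.-integrable setT (EFin \o u) ->
  P.-integrable setT (EFin \o (fun x => u x ^+ 2)) ->
  \int[P]_x u x = 0 -> 0 < c ->
  (tuple_measure P n [set y | (c <= `|\sum_(i < n) u (tnth y i)|)%R] <=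
   ((\int[P]_x (u x ^+ 2)) *+ n / c ^+ 2)%:E)%E.
Proof.
move=> mu iu iu2 u0 c0.
have mS := @measurable_sum_tnth n u mu.
have mS2 : measurable_fun setT (fun y : n.-tuple T =>
    ((\sum_(i < n) u (tnth y i)) ^+ 2)%:E).
  by apply/measurable_EFinP; apply: measurable_funX.
have c20 : 0 < c ^+ 2 by rewrite exprn_gt0.
have := le_integral_abse (tuple_measure P n) measurableT mS2 c20.
rewrite (eq_integral (fun y => ((0 + \sum_(i < n) u (tnth y i)) ^+ 2)%:E)); last first.
  by move=> y _; rewrite add0r gee0_abs// lee_fin sqr_ge0.
rewrite (tuple_integral_sqr_sum mu iu iu2 u0 erefl n 0) expr0n /= add0r setTI.
move=> h; rewrite EFinM lee_pdivlMr// muleC; apply: le_trans h.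
rewrite lee_pmul2l//.
rewrite le_eqVlt; apply/orP; left; apply/eqP; congr (tuple_measure P n _).
by apply/seteqP; split => y /=;
  rewrite lee_fin normrX ler_pXn2r// nnegrE ?ltW// normr_ge0.
Qed.

(** The bound is uniform in c, so the threshold may later depend on m. The half-line is replaced by
    a spline of width of order sqrt m, and the sum by the simple walk with the same variance. *)
Lemma clt_upper (z : T -> R) : measurable_fun setT z ->
  P.-integrable setT (EFin \o (fun x => `|z x| ^+ 3)) ->
  \int[P]_y z y = 0 -> 0 < \int[P]_y (z y ^+ 2) ->
  forall e, 0 < e -> exists2 dl, 0 < dl & exists N, forall m, (N <= m)%N ->
  forall c, c <= dl * Num.sqrt m%:R ->
  (tuple_measure P m [set y | (\sum_(i < m) z (tnth y i) <= c)%R] <= (2^-1 + e)%:E)%E.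
Proof.
move=> mz iz3 z0 z2 e e0.
pose s := Num.sqrt (\int[P]_y (z y ^+ 2)).
have s0 : 0 < s by rewrite sqrtr_gt0.
have s2 : \int[P]_y (z y ^+ 2) = s ^+ 2 by rewrite sqr_sqrtr// ltW.
pose tau := (\int[P]_y (`|z y| ^+ 3)) + s ^+ 3.
have tau0 : 0 <= tau by rewrite addr_ge0 ?exprn_ge0 ?(ltW s0)// Rintegral_ge0.
(* The window [0, 4w] with w = dl * sqrt m contributes about 4w / (2s) atoms of weight at most
   1/sqrt m, that is 2 dl / s = e/4. *)
pose dl := e * s / 8.
have dl0 : 0 < dl by rewrite divr_gt0// mulr_gt0.
exists dl => //.
(* sqrt m >= B brings the extra atom 1/sqrt m and the Lindeberg error m (4/3) tau / w^3 = (4/3) tau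
   / (dl^3 sqrt m) together below e/2. *)
pose B := 2 / e * (1 + 4 / 3 * tau / dl ^+ 3).
have B0 : 0 <= B by rewrite mulr_ge0 ?divr_ge0 ?addr_ge0 ?mulr_ge0 ?invr_ge0 ?exprn_ge0// ltW.
exists (Num.truncn (B ^+ 2)).+1 => m mN c cd.
have m0 : (0 < m)%N by apply: leq_trans mN.
have rm0 : 0 < Num.sqrt m%:R :> R by rewrite sqrtr_gt0 ltr0n.
have Bm : B <= Num.sqrt m%:R.
  rewrite -(ler_pXn2r (isT : (0 < 2)%N)) ?nnegrE ?(ltW rm0)// sqr_sqrtr//.
  by rewrite ltW// -truncn_lt_nat// sqr_ge0.
set q := Num.sqrt m%:R in cd rm0 Bm.
pose w := dl * q.
have w0 : 0 < w by rewrite mulr_gt0.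
(* f is 1 up to c and 0 from c + 3w on, and c + 3w <= 4w because c <= w. *)
pose f x := spline_step (w^-1 * x + - (c / w)) : R.
have tf : cubic_taylor (4 / 3 * `|w^-1| ^+ 3) f by apply: cubic_taylor_comp; exact: cubic_taylor_spline_step.
have f01 y : 0 <= f y <= 1 by exact: spline_step_itv.
have mp : measurable_fun setT (@posc R).
  by apply: measurable_funX; exact: measurable_funrpos.
have mst : measurable_fun setT (@spline_step R).
  apply: measurable_funD => //; apply: measurable_funM => //.
  have mpc k : measurable_fun setT (fun x : R => posc (x - k)).
    by apply: measurableT_comp => //; exact: measurable_funB.
  by repeat (apply: measurable_funD || apply: measurable_funM) => //; exact: mpc.
have mf : measurable_fun setT f.
  by apply: measurableT_comp => //; apply: measurable_funD => //; exact: measurable_funM.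
have mS := @measurable_sum_tnth m z mz.
have mA : measurable [set y : m.-tuple T | (\sum_(i < m) z (tnth y i) <= c)%R].
  rewrite -[X in measurable X]setTI; apply: measurable_fun_le => //.
apply: (@le_trans _ _ (\int[tuple_measure P m]_y (f (0 + \sum_(i < m) z (tnth y i)))%:E)%E).
  rewrite -(setIT [set _ | _]) -integral_indic//.
  apply: ge0_le_integral => //.
  - exact/measurable_EFinP/measurable_indic.
  - apply/measurable_EFinP; apply: measurableT_comp => //; exact: measurable_funD.
  move=> y _; rewrite lee_fin indicE.
  case: (boolP (y \in _)) => yA; last by case/andP: (f01 (0 + \sum_(i < m) z (tnth y i))).
  move: yA; rewrite inE /= add0r /f => yc; rewrite spline_step_le0// mulrC -mulrBl.
  by rewrite pmulr_lle0 ?invr_gt0// subr_le0.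
apply: le_trans (integral_sum_le_iter_walk mz iz3 z0 s2 s0 mf f01 tf m 0) _.
rewrite lee_fin -/tau.
have w40 : 0 <= 4 * w by rewrite mulr_ge0// ltW.
have fL x : 4 * w <= x -> f x = 0.
  move=> wx; rewrite /f spline_step_ge3// mulrC -mulrBl ler_pdivlMr//.
  by move: cd; rewrite -/w; lra.
apply: (@le_trans _ _ (2^-1 + (4 * w / (2 * s) + 1) / Num.sqrt m.+1%:R + 4 / 3 * `|w^-1| ^+ 3 * tau *+ m)).
  by rewrite lerD2r; apply: iter_walk_le.
rewrite -addrA lerD2l.
have qm : q ^+ 2 = m%:R by rewrite sqr_sqrtr.
have qq : q <= Num.sqrt m.+1%:R by rewrite ler_wsqrtr// ler_nat.
have h1 : (4 * w / (2 * s) + 1) / Num.sqrt m.+1%:R <= (4 * w / (2 * s) + 1) / q.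
  have l0 : 0 <= 4 * w / (2 * s) + 1 by rewrite addr_ge0// divr_ge0// mulr_ge0// ltW.
  rewrite ler_wpM2l//.
  by rewrite lef_pV2 ?posrE// (lt_le_trans rm0 qq).
apply: (le_trans (lerD h1 (lexx _))).
rewrite ger0_norm ?invr_ge0 ?(ltW w0)// -[_ *+ m]mulr_natl -qm.
have -> : (4 * w / (2 * s) + 1) / q + q ^+ 2 * (4 / 3 * w^-1 ^+ 3 * tau) =
   e / 4 + (1 + 4 / 3 * tau / dl ^+ 3) / q.
  rewrite /w /dl; field; rewrite !gt_eqF//.
have : (1 + 4 / 3 * tau / dl ^+ 3) / q <= e / 2.
  have e20 : 0 < e / 2 by rewrite divr_gt0.
  rewrite ler_pdivrMr// -ler_pdivrMl//.
  by apply: le_trans Bm; rewrite /B invf_div.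
by lra.
Qed.

End sums_of_iid.

(** * Means of independent variables *)

(** The lower bound is ln(1 + u) <= u applied to the reciprocal of 1 + y. The factor 2 bounds 1/(1 +
    y) on |y| <= 1/2. *)
Lemma ln1D_quadratic (R : realType) (y : R) : `|y| <= 2^-1 ->
  `|ln (1 + y) - y| <= 2 * y ^+ 2.
Proof.
move=> hy; have /andP[y1 y2] : - 2^-1 <= y <= 2^-1 by rewrite -ler_norml.
have p1 : 0 < 1 + y by lra.
have up : ln (1 + y) <= y by apply: le_ln1Dx; lra.
have lo : y / (1 + y) <= ln (1 + y).
  have : ln (1 + - (y / (1 + y))) <= - (y / (1 + y)).
    by apply: le_ln1Dx; rewrite ltrN2 ltr_pdivrMr//; lra.
  have -> : 1 + - (y / (1 + y)) = (1 + y)^-1 by field; rewrite gt_eqF.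
  by rewrite lnV ?posrE//; lra.
have e : y - y / (1 + y) = y ^+ 2 / (1 + y) by field; rewrite gt_eqF.
have : y ^+ 2 / (1 + y) <= 2 * y ^+ 2.
  rewrite ler_pdivrMr// mulrAC ler_peMl ?sqr_ge0//; lra.
have := sqr_ge0 y.
by rewrite ler_norml; lra.
Qed.

Section delta_method.
Context {R : realType} d (T : measurableType d) (P : probability T R).

Definition mean m (x : T -> R) (y : m.-tuple T) : R :=
  (\sum_(i < m) x (tnth y i)) / m%:R.

(** The comparison a log X <= r + b log Y, written multiplicatively so that it keeps its meaning
    when a mean is 0. *)
Definition mean_le_event m (a b r : R) (x1 x2 : T -> R) : set (m.-tuple T) :=
  [set y | mean x1 y `^ a <= expR r * mean x2 y `^ b].

Record unit_mean (x : T -> R) := {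
  unit_mean_measurable : measurable_fun setT x;
  unit_mean_ge0 : forall y, 0 <= x y;
  unit_mean_integrable : P.-integrable setT (EFin \o (fun y => `|x y| ^+ 3));
  unit_meanE : \int[P]_y x y = 1 }.

Lemma measurable_mean m (x : T -> R) : measurable_fun setT x ->
  measurable_fun setT (@mean m x).
Proof. by move=> mx; apply: measurable_funM => //; exact: measurable_sum_tnth. Qed.

Lemma measurable_mean_le_event m a b r (x1 x2 : T -> R) :
  measurable_fun setT x1 -> measurable_fun setT x2 ->
  measurable (@mean_le_event m a b r x1 x2).
Proof.
move=> m1 m2; rewrite -[X in measurable X]setTI; apply: measurable_fun_le => //.
  exact: (measurableT_comp (measurable_powR a) (measurable_mean m1)).
apply: measurable_funM => //.
exact: (measurableT_comp (measurable_powR b) (measurable_mean m2)).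
Qed.

Lemma unit_mean_centered (x : T -> R) : unit_mean x ->
  [/\ measurable_fun setT (fun y => x y - 1),
   P.-integrable setT (EFin \o (fun y => x y - 1)),
   P.-integrable setT (EFin \o (fun y => (x y - 1) ^+ 2)),
   P.-integrable setT (EFin \o (fun y => `|x y - 1| ^+ 3)) &
   \int[P]_y (x y - 1) = 0].
Proof.
move=> [mx x0 ix x1].
have i1 := integrable_pow_le mx (isT : 1 <= 3)%N ix.
have ic := finite_measure_integrable_cst P 1 (A := setT) measurableT.
have mx1 : measurable_fun setT (fun y => x y - 1) by exact: measurable_funB.
have i3 : P.-integrable setT (EFin \o (fun y => `|x y - 1| ^+ 3)).
  have iD : P.-integrable setT (EFin \o (fun y => 1 + `|x y| ^+ 3)).
    by have := integrableD measurableT ic ix; apply: eq_integrable.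
  apply: le_integrable iD => //.
    by apply/measurable_EFinP; apply: measurable_funX; exact: measurableT_comp.
  move=> y _ /=; rewrite lee_fin [leLHS]ger0_norm ?exprn_ge0//.
  rewrite [leRHS]ger0_norm ?addr_ge0 ?exprn_ge0//.
  have [x1'|x1'] := leP (x y) 1.
    rewrite ler_wpDr ?exprn_ge0// exprn_ile1// ler_norml.
    by have := x0 y; lra.
  rewrite ler_wpDl// lerXn2r ?nnegrE// !ger0_norm//; lra.
split => //.
- by have := integrable_pow_le mx1 (isT : 1 <= 3)%N i3; apply: eq_integrable.
- exact: integrable_pow_le mx1 (isT : 2 <= 3)%N i3.
- have i1' : P.-integrable setT (EFin \o x) by have := i1; apply: eq_integrable.
  rewrite (RintegralB measurableT i1' ic).
  by rewrite x1 probability_Rintegral_cst subrr.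
Qed.

Lemma mean_concentration (x1 x2 : T -> R) : unit_mean x1 -> unit_mean x2 ->
  exists2 V, 0 <= V & forall m h, (0 < m)%N -> 0 < h ->
  (tuple_measure P m ([set y | (h <= `|mean x1 y - 1|)%R] `|` [set y | (h <= `|mean x2 y - 1|)%R]) <=
  (V / (m%:R * h ^+ 2))%:E)%E.
Proof.
move=> u1 u2.
have [m1 i1 j1 _ z1] := unit_mean_centered u1.
have [m2 i2 j2 _ z2] := unit_mean_centered u2.
exists (\int[P]_y ((x1 y - 1) ^+ 2) + \int[P]_y ((x2 y - 1) ^+ 2)).
  by rewrite addr_ge0// Rintegral_ge0// => y _; exact: sqr_ge0.
move=> m h m0 h0.
have mE x y : mean x y - 1 = (\sum_(i < m) (x (tnth y i) - 1)) / m%:R.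
  rewrite sumrB sumr_const card_ord mulrBl -[1 *+ m]/(m%:R) divff//.
  by rewrite pnatr_eq0 -lt0n.
have sE (x : T -> R) : measurable_fun setT x -> [set y | h <= `|mean x y - 1|] = [set y : m.-tuple T | h * m%:R <= `|\sum_(i < m) (x (tnth y i) - 1)|].
  move=> _; apply/seteqP; split => y /=; rewrite mE normrM normfV.
    by rewrite (ger0_norm (ler0n _ m)) ler_pdivlMr// ltr0n.
  by rewrite (ger0_norm (ler0n _ m)) ler_pdivlMr// ltr0n.
have mS (x : T -> R) : measurable_fun setT x -> measurable [set y : m.-tuple T | h * m%:R <= `|\sum_(i < m) x (tnth y i)|].
  move=> mx; rewrite -[X in measurable X]setTI; apply: measurable_fun_le => //.
  by apply: measurableT_comp => //; exact: measurable_sum_tnth.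
rewrite (sE _ (unit_mean_measurable u1)) (sE _ (unit_mean_measurable u2)).
apply: le_trans (measureU2 _ _ _) _; [exact: (mS (fun y => x1 y - 1))|exact: (mS (fun y => x2 y - 1))|].
have hm0 : 0 < h * m%:R by rewrite mulr_gt0// ltr0n.
have := leeD (tuple_measure_chebyshev m m1 i1 j1 z1 hm0) (tuple_measure_chebyshev m m2 i2 j2 z2 hm0).
move=> /le_trans; apply; rewrite -EFinD lee_fin le_eqVlt; apply/orP; left; apply/eqP.
set A := \int[P]_x (x1 x - 1) ^+ 2; set B := \int[P]_x (x2 x - 1) ^+ 2.
rewrite -(mulr_natr A m) -(mulr_natr B m).
by field; rewrite gt_eqF//= pnatr_eq0 -lt0n.
Qed.

(** Either some mean is at distance at least h from 1, or both logarithms are linear up to 2 h^2;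
    the requirement h <= 1/2 is that of the quadratic bound for the logarithm. *)
Lemma mean_le_event_sub m a b r h (x1 x2 : T -> R) : 0 <= a -> 0 <= b ->
  0 < h -> h <= 2^-1 ->
  @mean_le_event m a b r x1 x2 `<=`
  ([set y | h <= `|mean x1 y - 1|] `|` [set y | h <= `|mean x2 y - 1|]) `|`
  [set y | [/\ `|mean x1 y - 1| <= h, `|mean x2 y - 1| <= h &
     a * (mean x1 y - 1) - b * (mean x2 y - 1) <= r + 2 * (a + b) * h ^+ 2]].
Proof.
move=> a0 b0 h0 h2 y; rewrite /mean_le_event /=.
set X := mean x1 y; set Y := mean x2 y => XY.
have [hX|hX] := leP h `|X - 1|; first by left; left.
have [hY|hY] := leP h `|Y - 1|; first by left; right.
right; split; [exact: ltW|exact: ltW|].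
have lnQ Z : `|Z - 1| < h -> 0 < Z /\ `|ln Z - (Z - 1)| <= 2 * h ^+ 2.
  move=> hZ; have Z2 : `|Z - 1| <= 2^-1 by rewrite (le_trans (ltW hZ)).
  split; first by move: Z2; rewrite ler_norml; lra.
  have := ln1D_quadratic Z2; have -> : 1 + (Z - 1) = Z by ring.
  move=> /le_trans; apply.
  by rewrite ler_pM2l// -[leLHS]real_normK ?num_real// lerXn2r ?nnegrE// ltW.
have [X0 lX] := lnQ _ hX; have [Y0 lY] := lnQ _ hY.
have : a * ln X <= r + b * ln Y.
  have := XY; rewrite -ler_ln ?posrE ?mulr_gt0 ?powR_gt0 ?expR_gt0//.
  by rewrite lnM ?posrE ?powR_gt0 ?expR_gt0// !ln_powR expRK.
move: lX lY; rewrite !ler_norml => /andP[lX _] /andP[_ lY].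
have := ler_wpM2l a0 lX; have := ler_wpM2l b0 lY.
rewrite !mulrBr mulrN.
set D := h ^+ 2; have -> : 2 * (a + b) * D = a * (2 * D) + b * (2 * D) by ring.
by lra.
Qed.

(** The off-critical case: a threshold bounded away below 0 forces a large deviation of one of the
    means. *)
Lemma mean_le_event_small a b (x1 x2 : T -> R) : 0 <= a -> 0 <= b ->
  unit_mean x1 -> unit_mean x2 -> forall e r, 0 < e -> 0 < r ->
  exists N, forall m, (N <= m)%N -> forall s, s <= - r ->
  (tuple_measure P m (mean_le_event a b s x1 x2) <= e%:E)%E.
Proof.
move=> a0 b0 u1 u2 e r e0 r0.
have [V V0 hV] := mean_concentration u1 u2.
(* This gives h <= 1/2 and 2 (a + b) h < r. If both means were within h of 1, the linear part would
   be at least -(a + b) h and at most -r + 2 (a + b) h^2 <= -r + (a + b) h, a contradiction. *)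
pose h := r / (2 * (a + b) + 2 * r).
have d0 : 0 < 2 * (a + b) + 2 * r by lra.
have h0 : 0 < h by rewrite divr_gt0.
have h2 : h <= 2^-1 by rewrite /h ler_pdivrMr//; lra.
exists (Num.truncn (V / (e * h ^+ 2))).+1 => m mN s sr.
have m0 : (0 < m)%N by apply: leq_trans mN.
apply: (@le_trans _ _ (tuple_measure P m ([set y | h <= `|mean x1 y - 1|] `|` [set y | h <= `|mean x2 y - 1|]))).
  have mm (x : T -> R) : unit_mean x -> measurable [set y : m.-tuple T | h <= `|mean x y - 1|].
    move=> ux; rewrite -[X in measurable X]setTI; apply: measurable_fun_le => //.
    apply: measurableT_comp => //; apply: measurable_funB => //.
    exact: measurable_mean (unit_mean_measurable ux).
  apply: le_measure; rewrite ?inE.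
  - by apply: measurable_mean_le_event; apply: unit_mean_measurable.
  - by apply: measurableU; exact: mm.
  move=> y /(mean_le_event_sub a0 b0 h0 h2) [//|[]]/=.
  rewrite !ler_norml => /andP[X1 X2] /andP[Y1 Y2].
  have := ler_wpM2l a0 X1; have := ler_wpM2l b0 Y2.
  have hh : h ^+ 2 <= h * 2^-1 by rewrite expr2 ler_wpM2l// ltW.
  have := ler_wpM2l (addr_ge0 a0 b0) hh.
  have : h * (2 * (a + b) + 2 * r) = r by rewrite /h divfK// gt_eqF.
  have : 0 < r * h by rewrite mulr_gt0.
  set D := h ^+ 2.
  rewrite !mulrDr !mulrDl !mulrN.
  nra.
apply: (le_trans (hV m h m0 h0)); rewrite lee_fin.
have mp : 0 < m%:R :> R by rewrite ltr0n.
have hp : 0 < h ^+ 2 by rewrite exprn_gt0.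
have -> : V / (m%:R * h ^+ 2) = e * (V / (e * h ^+ 2)) / m%:R.
  by field; rewrite !gt_eqF.
rewrite ler_pdivrMr// ler_pM2l//.
by rewrite ltW// -truncn_lt_nat// divr_ge0// mulr_ge0// ltW.
Qed.

Lemma mean_le_event_half a b (x1 x2 : T -> R) : 0 <= a -> 0 <= b ->
  unit_mean x1 -> unit_mean x2 ->
  0 < \int[P]_y ((a * (x1 y - 1) - b * (x2 y - 1)) ^+ 2) ->
  forall e, 0 < e -> exists2 dl, 0 < dl & exists N, forall m, (N <= m)%N ->
  forall s, s * Num.sqrt m%:R <= dl ->
  (tuple_measure P m (mean_le_event a b s x1 x2) <= (2^-1 + e)%:E)%E.
Proof.
move=> a0 b0 u1 u2 v0 e e0.
have [V V0 hV] := mean_concentration u1 u2.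
have [m1 i1 j1 k1 z1] := unit_mean_centered u1.
have [m2 i2 j2 k2 z2] := unit_mean_centered u2.
pose z y := a * (x1 y - 1) - b * (x2 y - 1).
have mz : measurable_fun setT z.
  by apply: measurable_funB; exact: measurable_funM.
have l1 : P.-integrable setT (EFin \o (fun y => a * (x1 y - 1))).
  by have := integrableZl measurableT a i1; apply: eq_integrable.
have l2 : P.-integrable setT (EFin \o (fun y => b * (x2 y - 1))).
  by have := integrableZl measurableT b i2; apply: eq_integrable.
have z0 : \int[P]_y z y = 0.
  by rewrite RintegralB// !RintegralZl// z1 z2 !mulr0 subr0.
have iz3 : P.-integrable setT (EFin \o (fun y => `|z y| ^+ 3)).
  have iD : P.-integrable setT (EFin \o (fun y => 4 * a ^+ 3 * `|x1 y - 1| ^+ 3 + 4 * b ^+ 3 * `|x2 y - 1| ^+ 3)).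
    have := integrableD measurableT (integrableZl measurableT (4 * a ^+ 3) k1) (integrableZl measurableT (4 * b ^+ 3) k2).
    by apply: eq_integrable.
  apply: le_integrable iD => //.
    by apply/measurable_EFinP; apply: measurable_funX; exact: measurableT_comp.
  move=> y _ /=; rewrite lee_fin [leLHS]ger0_norm ?exprn_ge0//.
  rewrite [leRHS]ger0_norm; last by rewrite addr_ge0// !mulr_ge0 ?exprn_ge0.
  have : `|z y| <= a * `|x1 y - 1| + b * `|x2 y - 1|.
    by rewrite (le_trans (ler_normB _ _))// !normrM (ger0_norm a0) (ger0_norm b0).
  set u := a * `|_|; set v := b * `|_| => zuv.
  have uu : 0 <= u by rewrite mulr_ge0.
  have vv : 0 <= v by rewrite mulr_ge0.
  apply: (@le_trans _ _ ((u + v) ^+ 3)).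
    by rewrite lerXn2r// nnegrE// addr_ge0.
  have -> : 4 * a ^+ 3 * `|x1 y - 1| ^+ 3 + 4 * b ^+ 3 * `|x2 y - 1| ^+ 3 = 4 * (u ^+ 3 + v ^+ 3).
    by rewrite /u /v; ring.
  (* This quantity is 4 (u^3 + v^3) - (u + v)^3, whose nonnegativity dominates |z|^3 by integrable
     functions. *)
  have : 0 <= 3 * (u + v) * (u - v) ^+ 2 by apply: mulr_ge0; [rewrite mulr_ge0// addr_ge0|exact: sqr_ge0].
  have -> : 3 * (u + v) * (u - v) ^+ 2 = 4 * (u ^+ 3 + v ^+ 3) - (u + v) ^+ 3 by ring.
  by rewrite subr_ge0.
have e20 : 0 < e / 2 by rewrite divr_gt0.
have [dl dl0 [N hN]] := clt_upper mz iz3 z0 v0 e20.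
exists (dl / 2); first by rewrite divr_gt0.
(* The deviation will be h with h^2 = k / sqrt m. Then the linearization error, multiplied by m, is
   2 (a + b) k sqrt m <= (dl/2) sqrt m, while Chebyshev gives V / (k sqrt m), at most e/2 once sqrt
   m >= B below. The bound k <= 1/4 ensures h <= 1/2. *)
pose k := Num.min (4^-1) (dl / (4 * (a + b) + 1)).
have ab0 : 0 < 4 * (a + b) + 1 by rewrite ltr_wpDl// mulr_ge0// addr_ge0.
have k0 : 0 < k by rewrite lt_min invr_gt0 divr_gt0// ltr0n.
have k4 : k <= 4^-1 by rewrite ge_min lexx.
have kd : 2 * (a + b) * k <= dl / 2.
  have : k <= dl / (4 * (a + b) + 1) by rewrite ge_min lexx orbT.
  by rewrite ler_pdivlMr//; nra.
pose B := 2 * V / (e * k).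
have B0 : 0 <= B by rewrite divr_ge0 ?mulr_ge0// ltW.
exists (maxn N (Num.truncn (B ^+ 2)).+1) => m; rewrite geq_max => /andP[mN mB] s sd.
have m0 : (0 < m)%N by apply: leq_trans mB.
have mp : 0 < m%:R :> R by rewrite ltr0n.
pose q := Num.sqrt m%:R : R.
have q0 : 0 < q by rewrite sqrtr_gt0 ltr0n.
have q2 : q ^+ 2 = m%:R by rewrite sqr_sqrtr.
have qB : B <= q.
  rewrite -(ler_pXn2r (isT : (0 < 2)%N)) ?nnegrE ?(ltW q0)// q2.
  by rewrite ltW// -truncn_lt_nat// sqr_ge0.
have q1 : 1 <= q.
  rewrite -(ler_pXn2r (isT : (0 < 2)%N)) ?nnegrE ?(ltW q0)// q2 expr1n.
  by rewrite ler1n.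
pose h := Num.sqrt (k / q).
have h0 : 0 < h by rewrite sqrtr_gt0 divr_gt0.
have h2 : h ^+ 2 = k / q by rewrite sqr_sqrtr// divr_ge0// ltW.
have h12 : h <= 2^-1.
  rewrite -(ler_pXn2r (isT : (0 < 2)%N)) ?nnegrE ?(ltW h0)// h2.
  rewrite ler_pdivrMr// expr2 -invfM -natrM (le_trans k4)// ler_peMr//.
have mm (x : T -> R) : unit_mean x -> measurable [set y : m.-tuple T | h <= `|mean x y - 1|].
  move=> ux; rewrite -[X in measurable X]setTI; apply: measurable_fun_le => //.
  apply: measurableT_comp => //; apply: measurable_funB => //.
  exact: measurable_mean (unit_mean_measurable ux).
have mA : measurable [set y : m.-tuple T | (\sum_(i < m) z (tnth y i) <= dl * q)].
  rewrite -[X in measurable X]setTI; apply: measurable_fun_le => //.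
  exact: measurable_sum_tnth.
have mG : measurable ([set y : m.-tuple T | h <= `|mean x1 y - 1|] `|` [set y | h <= `|mean x2 y - 1|]).
  by apply: measurableU; exact: mm.
apply: (@le_trans _ _ (tuple_measure P m (([set y | h <= `|mean x1 y - 1|] `|` [set y | h <= `|mean x2 y - 1|]) `|` [set y | (\sum_(i < m) z (tnth y i) <= dl * q)]))).
  apply: le_measure; rewrite ?inE.
  - by apply: measurable_mean_le_event; apply: unit_mean_measurable.
  - exact: measurableU.
  move=> y /(mean_le_event_sub a0 b0 h0 h12) [|[_ _]]/=; first by left.
  move=> hy; right => /=.
  have mE x : \sum_(i < m) (x (tnth y i) - 1) = m%:R * (mean x y - 1).
    rewrite sumrB sumr_const card_ord mulrBr mulr1 /mean mulrC divfK//.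
    by rewrite gt_eqF.
  rewrite /z sumrB -!mulr_sumr !mE.
  have -> : a * (m%:R * (mean x1 y - 1)) - b * (m%:R * (mean x2 y - 1)) =
    q * (q * (a * (mean x1 y - 1) - b * (mean x2 y - 1))) by rewrite -q2; ring.
  rewrite mulrC ler_pM2r//.
  apply: le_trans (ler_wpM2l (ltW q0) hy) _.
  rewrite h2 mulrDr.
  have -> : q * (2 * (a + b) * (k / q)) = 2 * (a + b) * k by field; rewrite gt_eqF.
  by move: sd; rewrite -/q; lra.
apply: le_trans (measureU2 _ _ _) _ => //.
have -> : 2^-1 + e = e / 2 + (2^-1 + e / 2) by field.
rewrite EFinD; apply: leeD; last exact: hN.
apply: (le_trans (hV m h m0 h0)); rewrite lee_fin h2 -q2.
have -> : q ^+ 2 * (k / q) = k * q by field; rewrite gt_eqF.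
rewrite ler_pdivrMr ?mulr_gt0// mulrA -ler_pdivrMl ?mulr_gt0//.
by rewrite (le_trans _ qB)// /B le_eqVlt; apply/orP; left; apply/eqP; field; rewrite !gt_eqF.
Qed.

End delta_method.

(** * Scaling of Lebesgue measure and the Gamma function *)

Section lebesgue_scaling.
Context {R : realType}.
Local Notation lam := (@lebesgue_measure R).

(** Lebesgue measure is determined by its values on half-open intervals, and c times its image under
    multiplication by c has the same values. *)
Lemma ge0_integral_lebesgue_mul (c : R) (F : measurableTypeR R -> \bar R) : 0 < c ->
  measurable_fun setT F -> (forall x, 0 <= F x)%E ->
  (\int[lam]_x F (c * x)%R = c^-1%:E * \int[lam]_x F x)%E.
Proof.
move=> c0 mF F0.
have mf : measurable_fun setT (fun x : measurableTypeR R => c * x : measurableTypeR R).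
  exact: measurable_funM.
pose push := measure_function_pushforward__canonical__measure_function_Measure lam mf.
pose mu := mscale (NngNum (ltW c0)) push.
have lammu : forall A, measurable A -> lam A = mu A.
  apply: lebesgue_measure_unique => //= _ [[a b]] _ <-.
  rewrite /mu /= /mscale /= /pushforward.
  have -> : (fun x : measurableTypeR R => c * x : measurableTypeR R) @^-1` `]a, b] = `]a / c, b / c]%classic.
    apply/seteqP; split => x /=; rewrite !in_itv/= ltr_pdivrMr// ler_pdivlMr// mulrC//.
  rewrite !lebesgue_measure_itv/= !lte_fin ltr_pM2r ?invr_gt0//; case: ifPn => _.
    by rewrite -!EFinB -EFinM -mulrBl mulrC divfK// gt_eqF.
  by rewrite mule0.
have -> : (\int[lam]_x F (c * x)%R = \int[push]_x F x)%E.
  by rewrite (ge0_integral_pushforward mf).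
have -> : (\int[lam]_x F x = \int[mu]_x F x)%E.
  by apply: eq_measure_integral => A mA _; exact: lammu.
rewrite (ge0_integral_mscale push measurableT (NngNum (ltW c0)) mF)//=.
by rewrite muleA -EFinM mulVf ?mul1e// gt_eqF.
Qed.

Lemma measurable_scalev n (c : R) : measurable_fun setT (@scalev R n c).
Proof.
apply/measurable_fun_tnthP => i; rewrite (_ : _ \o _ = fun x => c * tnth x i).
  by apply: measurable_funM => //; exact: measurable_tnth.
by apply/funext => x /=; rewrite tnth_mktuple.
Qed.

Lemma ge0_integral_vol_scalev n (c : R) (F : Rvec R n -> \bar R) : 0 < c ->
  measurable_fun setT F -> (forall x, 0 <= F x)%E ->
  (\int[vol n]_x F (scalev c x) = ((c ^+ n)^-1)%:E * \int[vol n]_x F x)%E.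
Proof.
move=> c0 mF F0; rewrite -exprVn.
rewrite -(ge0_integral_tuple_measure_map (f := fun x : measurableTypeR R => c * x))//.
- by apply: eq_integral => x _; congr F; apply: eq_from_tnth => i; rewrite [RHS]tnth_map [LHS]tnth_mktuple.
- exact: measurable_funM.
- by rewrite invr_ge0 ltW.
- by move=> G mG G0; exact: ge0_integral_lebesgue_mul.
Qed.

Lemma ge0_integral_mxvol_scalemx m n (c : R) (F : Rmat R m n -> \bar R) : 0 < c ->
  measurable_fun setT F -> (forall x, 0 <= F x)%E ->
  (\int[mxvol m n]_x F (Defs.scalemx c x) = ((c ^+ (m * n))^-1)%:E * \int[mxvol m n]_x F x)%E.
Proof.
move=> c0 mF F0; rewrite mulnC exprM -exprVn.
rewrite -(ge0_integral_tuple_measure_map (f := @scalev R n c))//.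
- by apply: eq_integral => x _; congr F; apply: eq_from_tnth => i; rewrite [RHS]tnth_map [LHS]tnth_mktuple.
- exact: measurable_scalev.
- by rewrite invr_ge0 exprn_ge0// ltW.
- by move=> G mG G0; exact: ge0_integral_vol_scalev.
Qed.

End lebesgue_scaling.

(** * The Gamma function and crude Stirling bounds *)

Section gamma_function.
Context {R : realType}.
Local Notation lam := (@lebesgue_measure R).

Lemma integral_expRN (k a : R) : 0 < k ->
  (\int[lam]_(u in `[a, +oo[) (expR (- (k * u)))%:E = (expR (- (k * a)) / k)%:E)%E.
Proof.
move=> k0.
have D (u : R) : is_derive u 1 (fun u : R => - (expR (- (k * u)) / k)) (expR (- (k * u))).
  have D1 : is_derive u 1 (fun u : R => - k * u) (- k).
    have := is_deriveM (is_derive_cst (- k : R) u 1) (is_derive_id u 1).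
    by rewrite scaler0 addr0 /GRing.scale/= mulr1.
  have := is_deriveZ (- k^-1) (is_derive1_comp (is_derive_expR (- k * u)) D1).
  have -> : - k^-1 *: (expR (- k * u) * - k) = expR (- (k * u)).
    by rewrite /GRing.scale/= !mulNr; field; rewrite gt_eqF.
  congr is_derive; apply/funext => v /=.
  by rewrite /GRing.scale/= !mulNr mulrC.
have cE : continuous (fun u : R => expR (- (k * u))).
  move=> u; apply: continuous_comp; last exact: continuous_expR.
  by apply: continuousN; apply: continuousM => //; exact: cst_continuous.
rewrite (@ge0_continuous_FTC2y _ _ (fun u => - (expR (- (k * u)) / k)) _ 0)//.
- by rewrite EFinN oppeK add0e.
- by apply: continuous_subspaceT => u; exact: cE.
- rewrite -oppr0 -(mul0r k^-1); apply: cvgN; apply: cvgMl.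
  rewrite (_ : (fun x => _) = (fun z => expR (- z)) \o (fun z => k * z)); last by [].
  apply: (@cvg_comp _ _ _ _ _ _ (pinfty_nbhs R)); last exact: cvgr_expR.
  exact: gt0_cvgMry.
- by apply: cvgN; apply: cvgMl; apply/cvg_at_right_filter; exact: cE.
- by move=> u _; rewrite derive1E; have /@derive_val := D u.
Qed.

(* ln t <= t - 1 at t = u (1 - k) / x *)
Lemma powR_expRN_le (x u k : R) : 0 < x -> 0 < u -> 0 < k < 1 ->
  u `^ x * expR (- u) <= (x / (1 - k)) `^ x * expR (- x) * expR (- (k * u)).
Proof.
move=> x0 u0 /andP[k0 k1].
have k1' : 0 < 1 - k by lra.
have t0 : 0 < u * (1 - k) / x by rewrite divr_gt0// mulr_gt0.
rewrite /powR !gt_eqF ?divr_gt0// -!expRD ler_expR.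
have : ln (1 + (u * (1 - k) / x - 1)) <= u * (1 - k) / x - 1 by apply: le_ln1Dx; lra.
rewrite addrC subrK lnM ?posrE ?mulr_gt0 ?invr_gt0// lnM ?posrE// lnV ?posrE//.
rewrite lnM ?posrE ?invr_gt0// lnV ?posrE// => h.
have := ler_wpM2l (ltW x0) h.
have -> : x * (u * (1 - k) / x - 1) = u * (1 - k) - x by field; rewrite gt_eqF.
rewrite !mulrDr !mulrN; lra.
Qed.

Lemma measurable_gamma_integrand (x : R) (D : set R) :
  measurable_fun D (fun u : R => u `^ x * expR (- u)).
Proof.
apply: measurable_funTS; apply: measurable_funM; first exact: measurable_powR.
by apply: measurableT_comp => //; exact: measurable_expR.
Qed.

(** The rate k stays free because k = 1/2 yields finiteness of the Gamma integral and k = 1/x the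
    upper Stirling bound. *)
Lemma gamma_integral_le (x k : R) : 0 < x -> 0 < k < 1 ->
  (\int[lam]_(u in `]0%R, +oo[) (u `^ x * expR (- u))%:E <=
  ((x / (1 - k)) `^ x * expR (- x) / k)%:E)%E.
Proof.
move=> x0 k01; have /andP[k0 k1] := k01.
pose C := (x / (1 - k)) `^ x * expR (- x).
have C0 : 0 <= C by rewrite mulr_ge0 ?powR_ge0 ?expR_ge0.
have mk : measurable_fun setT (fun u : R => (expR (- (k * u)))%:E).
  apply/measurable_EFinP; apply: measurableT_comp; first exact: measurable_expR.
  by apply: measurableT_comp => //; exact: measurable_funM.
apply: (@le_trans _ _ (\int[lam]_(u in `]0%R, +oo[) (C%:E * (expR (- (k * u)))%:E))%E).
  apply: ge0_le_integral => //.
  - by move=> u _; rewrite lee_fin mulr_ge0 ?powR_ge0 ?expR_ge0.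
  - by apply/measurable_EFinP; exact: measurable_gamma_integrand.
  - by apply: measurable_funTS; exact: measurable_funeM.
  - move=> u /=; rewrite in_itv/= andbT => u0; rewrite -EFinM lee_fin.
    exact: powR_expRN_le.
rewrite ge0_integralZl_EFin//; last exact: measurable_funTS.
rewrite integral_itv_obnd_cbnd; last exact: measurable_funTS.
by rewrite integral_expRN// mulr0 oppr0 expR0 -EFinM lee_fin div1r.
Qed.

(** [Gamma] is a real-valued integral, read off by [fine]; the point is that the extended integral
    is finite. *)
Lemma gamma_integralE (x : R) : 0 <= x ->
  (\int[lam]_(u in `]0%R, +oo[) (u `^ x * expR (- u))%:E = (Gamma (x + 1))%:E)%E.
Proof.
move=> x0; rewrite /Gamma /Rintegral addrK fineK// ge0_fin_numE; last first.
  by apply: integral_ge0 => u _; rewrite lee_fin mulr_ge0 ?powR_ge0 ?expR_ge0.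
move: x0; rewrite le_eqVlt => /predU1P[<-|x0].
  under eq_integral do rewrite powRr0 mul1r -[X in expR (- X)]mul1r.
  rewrite integral_itv_obnd_cbnd; last first.
    apply: measurable_funTS; apply/measurable_EFinP; apply: measurableT_comp; first exact: measurable_expR.
    by apply: measurableT_comp => //; exact: measurable_funM.
  by rewrite integral_expRN// ltry.
apply: le_lt_trans (gamma_integral_le (k := 2^-1) x0 _) _; first lra.
exact: ltry.
Qed.

Lemma Gamma1 : Gamma 1 = 1 :> R.
Proof.
have := gamma_integralE (lexx 0); rewrite add0r.
under eq_integral do rewrite powRr0 mul1r -[X in expR (- X)]mul1r.
rewrite integral_itv_obnd_cbnd; last first.
  apply: measurable_funTS; apply/measurable_EFinP; apply: measurableT_comp; first exact: measurable_expR.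
  by apply: measurableT_comp => //; exact: measurable_funM.
by rewrite integral_expRN// mulr0 oppr0 expR0 divr1 => -[].
Qed.

(** On the unit interval from x to x + 1 the integrand is at least x^x exp(-x - 1). *)
Lemma Gamma_lower (x : R) : 0 <= x -> x `^ x * expR (- x - 1) <= Gamma (x + 1).
Proof.
move=> x0; rewrite -lee_fin -gamma_integralE//.
have c0 : 0 <= x `^ x * expR (- x - 1) by rewrite mulr_ge0 ?powR_ge0 ?expR_ge0.
have sub : `]x, x + 1] `<=` (`]0, +oo[ : set R).
  by move=> u /=; rewrite !in_itv/= andbT => /andP[xu _]; exact: le_lt_trans x0 xu.
apply: (@le_trans _ _ (\int[lam]_(u in `]x, (x + 1)%R]) (x `^ x * expR (- x - 1))%:E)%E).
  rewrite integral_cst//.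
  rewrite [X in (_ * X)%E](_ : _ = 1%E) ?mule1//.
  have := @lebesgue_measure_itv R `]x, (x + 1)%R]; rewrite /= lte_fin ltrDl ltr01 -EFinB addrAC subrr add0r.
  exact.
apply: (@le_trans _ _ (\int[lam]_(u in `]x, (x + 1)%R]) (u `^ x * expR (- u))%:E)%E).
  apply: ge0_le_integral => //.
  - by apply/measurable_EFinP; exact: measurable_gamma_integrand.
  - move=> u /=; rewrite in_itv/= => /andP[xu ux]; rewrite lee_fin.
    apply: ler_pM; rewrite ?powR_ge0 ?expR_ge0//.
      by apply: ge0_ler_powR; rewrite ?nnegrE//; lra.
    by rewrite ler_expR; lra.
apply: ge0_subset_integral => //.
  by apply/measurable_EFinP; exact: measurable_gamma_integrand.
by move=> u _; rewrite lee_fin mulr_ge0 ?powR_ge0 ?expR_ge0.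
Qed.

Lemma Gamma_gt0 (x : R) : 0 <= x -> 0 < Gamma (x + 1).
Proof.
move=> x0; have [->|xn0] := eqVneq x 0; first by rewrite add0r Gamma1.
apply: lt_le_trans (Gamma_lower x0); rewrite mulr_gt0 ?expR_gt0// powR_gt0//.
by rewrite lt_neqAle eq_sym xn0.
Qed.

(** An error of order log x suffices: the radius is an mn-th root, so the error reaches the
    logarithm of the radius divided by mn and is still negligible after multiplication by sqrt m.
    The upper bound is [gamma_integral_le] at k = 1/x. *)
Lemma ln_Gamma_bound (x : R) : 2 <= x ->
  -1 <= ln (Gamma (x + 1)) - (x * ln x - x) <= 2 + ln x.
Proof.
move=> x2; have x0 : 0 < x by lra.
have G0 := Gamma_gt0 (ltW x0).
apply/andP; split.
  have := Gamma_lower (ltW x0); rewrite -ler_ln ?posrE ?mulr_gt0 ?powR_gt0 ?expR_gt0//.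
  by rewrite lnM ?posrE ?powR_gt0 ?expR_gt0// ln_powR expRK; lra.
have xV : 0 < x^-1 < 1 by rewrite invr_gt0 x0 invf_lt1//; lra.
have := gamma_integral_le x0 xV; rewrite gamma_integralE ?(ltW x0)// lee_fin.
have /andP[v0 v1] := xV.
rewrite invrK -ler_ln ?posrE ?mulr_gt0 ?powR_gt0 ?expR_gt0 ?divr_gt0//; last lra.
rewrite lnM ?posrE ?mulr_gt0 ?powR_gt0 ?expR_gt0 ?divr_gt0//; last lra.
rewrite lnM ?posrE ?powR_gt0 ?expR_gt0 ?divr_gt0//; last lra.
rewrite ln_powR expRK ln_div ?posrE//; last lra.
(* This controls the factor (1 - 1/x)^(-x): the logarithm of that factor is at most 1 / (1 - 1/x) <=
   2. *)
have : ln (1 - x^-1)^-1 <= x^-1 / (1 - x^-1).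
  rewrite [X in ln X](_ : _ = 1 + x^-1 / (1 - x^-1)); last first.
    have x10 : x - 1 != 0 by rewrite gt_eqF//; lra.
    by field; rewrite x10 gt_eqF.
  apply: le_ln1Dx; rewrite (@lt_le_trans _ _ 0) ?ltrN10//.
  by rewrite divr_ge0//; lra.
rewrite lnV ?posrE; last lra.
have : x * (x^-1 / (1 - x^-1)) <= 2.
  rewrite mulrA divff ?gt_eqF// div1r -[2]invrK lef_pV2 ?posrE//; last lra.
  have : x^-1 <= 2^-1 by rewrite lef_pV2 ?posrE//.
  by lra.
move=> h1 h2; have := ler_wpM2l (ltW x0) h2.
by rewrite mulrN mulrBr; lra.
Qed.

End gamma_function.

Section power_integral.
Context {R : realType}.
Local Notation lam := (@lebesgue_measure R).

Lemma continuous_norm_powR (r : R) : 0 < r -> continuous (fun x : R => `|x| `^ r).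
Proof.
move=> r0 x; have [->|x0] := eqVneq x 0.
  apply/cvgrPdist_le => e e0.
  have q0 : 0 < e `^ r^-1 by rewrite powR_gt0.
  near=> y; rewrite normr0 powR0 ?gt_eqF// sub0r normrN ger0_norm ?powR_ge0//.
  have -> : e = (e `^ r^-1) `^ r by rewrite -powRrM mulVf ?powRr1 ?gt_eqF// ltW.
  apply: ge0_ler_powR; [exact: ltW|by rewrite nnegrE|by rewrite nnegrE powR_ge0|].
  apply: ltW; near: y; exists (e `^ r^-1) => //= z.
  by rewrite /ball_/= sub0r normrN.
apply: (@continuous_comp _ _ _ (fun y : R => `|y|) (fun y : R => y `^ r)).
  exact: norm_continuous.
have := @derivable_powR R 1 r `|x|; rewrite in_itv/= normr_gt0 x0 => /(_ isT).
by move/derivable1_diffP/differentiable_continuous.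
Unshelve. all: by end_near. Qed.

Lemma integral_powR (c : R) : 0 < c ->
  (\int[lam]_(u in `[0%R, 1%R]) (u `^ c)%:E = (c + 1)^-1%:E)%E.
Proof.
move=> c0; have c10 : 0 < c + 1 by lra.
have E (r : R) : {in `[0, 1]%classic, (fun x : R => `|x| `^ r) =1 (fun x : R => x `^ r)}.
  by move=> x; rewrite inE/= in_itv/= => /andP[x0 _]; rewrite ger0_norm.
have cW (r : R) : 0 < r -> {within `[0, 1], continuous (fun x : R => x `^ r)}.
  move=> r0; apply: (subspace_eq_continuous (E r)).
  exact/continuous_subspaceT/continuous_norm_powR.
rewrite (@continuous_FTC2 _ _ (fun x => (c + 1)^-1 * x `^ (c + 1))) //.
- by rewrite powR1 powR0 ?gt_eqF// mulr0 mulr1 sube0.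
- exact: cW.
- have /continuous_within_itvP[//|_ h0 h1] := cW _ c10; split.
  + move=> x; rewrite in_itv/= => /andP[x0 _]; apply: derivableM => //.
    by apply: derivable_powR; rewrite in_itv/= x0.
  + by apply: cvgMr.
  + by apply: cvgMr.
- move=> x; rewrite in_itv/= => /andP[x0 _].
  rewrite derive1Ml; last by apply: derivable_powR; rewrite in_itv/= x0.
  rewrite powR_derive1 ?in_itv/= ?x0// addrK mulrA mulVf ?mul1r// gt_eqF//.
Qed.

End power_integral.

(** * Integration over the sublevel sets of a homogeneous function *)

Section layer_cake.
Context {R : realType} d (T : measurableType d).
Variables (mu : {sigma_finite_measure set T -> \bar R}).
Local Notation lam := (@lebesgue_measure R).

(** Tonelli on the set N x ^ r <= s: the slice at s is the ball of radius s^(1/r), on which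
    homogeneity produces s^(D/r). The choice k = exp(-s) makes the inner integral exp(-N^r); the
    indicator of s <= 1 makes it the positive part of 1 - N^r. *)
Lemma integral_layer_cake (N : T -> R) (phi : T -> \bar R) (D r : R) (k : R -> R) :
  measurable_fun setT N -> (forall x, 0 <= N x) ->
  measurable_fun setT phi -> (forall x, 0 <= phi x)%E -> 0 < r ->
  measurable_fun setT k -> (forall s, 0 <= k s) ->
  (forall s : R, (0 < s)%R -> \int[mu]_(x in [set x | (N x <= s)%R]) phi x =
     (s `^ D)%:E * \int[mu]_(x in [set x | (N x <= 1)%R]) phi x)%E ->
  (\int[mu]_x (phi x * \int[lam]_(s in `]0%R, +oo[) (k s * \1_[set u | (N x `^ r <= u)%R] s)%:E) =
   (\int[lam]_(s in `]0%R, +oo[) (s `^ (D / r) * k s)%:E) *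
   \int[mu]_(x in [set x | (N x <= 1)%R]) phi x)%E.
Proof.
move=> mN N0 mphi phi0 r0 mk k0 H.
set I := (\int[mu]_(x in [set x | (N x <= 1)%R]) phi x)%E.
have I0 : (0 <= I)%E by apply: integral_ge0 => x _.
pose A : set (T * measurableTypeR R) := [set z | N z.1 `^ r <= z.2].
pose B : set (T * measurableTypeR R) := [set z | 0 < z.2].
have mA : measurable A.
  rewrite -[X in measurable X]setTI; apply: measurable_fun_le => //.
  apply: (measurableT_comp (measurable_powR r)); exact: measurableT_comp.
have mB : measurable B.
  rewrite (_ : B = snd @^-1` `]0, +oo[%classic); last first.
    by apply/seteqP; split => z /=; rewrite in_itv/= andbT.
  by rewrite -[X in measurable X]setTI; exact: measurable_snd.
pose f (z : T * measurableTypeR R) : \bar R := (phi z.1 * (k z.2 * \1_A z * \1_B z)%:E)%E.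
have f0 z : (0 <= f z)%E by rewrite mule_ge0// lee_fin !mulr_ge0.
have mf : measurable_fun setT f.
  apply: emeasurable_funM; first exact: measurableT_comp.
  apply/measurable_EFinP; apply: measurable_funM; last exact: measurable_indic.
  apply: measurable_funM; last exact: measurable_indic.
  exact: measurableT_comp.
have mlev s : measurable [set x | N x <= s].
  by rewrite -[X in measurable X]setTI; apply: measurable_fun_le.
transitivity (\int[mu]_x \int[lam]_s f (x, s))%E.
  apply: eq_integral => x _; rewrite integral_mkcond -ge0_integralZl//; first last.
  - by move=> s _; rewrite erestrict_ge0// => u _; rewrite lee_fin mulr_ge0.
  - apply/(measurable_restrictT _ _).1 => //; apply/measurable_funTS/measurable_EFinP.
    apply: measurable_funM => //; apply: measurable_indic.
    by rewrite -[X in measurable X]setTI; apply: measurable_fun_le.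
  apply: eq_integral => s _; rewrite /f /= patchE; case: ifPn.
    rewrite inE/= in_itv/= andbT => s0.
    have B1 : B (x, s) by [].
    by rewrite [\1_B _]indicE (mem_set B1) mulr1.
  rewrite notin_setE/= in_itv/= andbT => s0.
  have B0 : ~ B (x, s) by [].
  by rewrite [\1_B _]indicE (memNset B0) mulr0 mule0.
rewrite (fubini_tonelli f mf f0) [RHS]muleC.
rewrite -ge0_integralZl//; first last.
- by move=> s _; rewrite lee_fin mulr_ge0// powR_ge0.
- by apply/measurable_funTS/measurable_EFinP/measurable_funM => //; exact: measurable_powR.
rewrite [RHS]integral_mkcond; apply: eq_integral => s _.
rewrite patchE; case: ifPn; last first.
  rewrite notin_setE/= in_itv/= andbT => s0.
  apply: integral0_eq => x _; rewrite /f /=.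
  have B0 : ~ B (x, s) by [].
  by rewrite [\1_B _]indicE (memNset B0) mulr0 mule0.
rewrite inE/= in_itv/= andbT => s0.
have sr : 0 < s `^ r^-1 by rewrite powR_gt0.
rewrite (eq_integral (fun x => (k s)%:E * (phi \_ [set x | (N x <= s `^ r^-1)%R]) x)%E); last first.
  move=> x _; rewrite /f /= patchE.
  have -> : \1_B (x, s : measurableTypeR R) = 1 :> R by rewrite indicE mem_set.
  have sE : (N x `^ r <= s) = (N x <= s `^ r^-1).
    have e : s = (s `^ r^-1) `^ r by rewrite -powRrM mulVf ?powRr1 ?gt_eqF// ltW.
    apply/idP/idP => h.
      have := ge0_ler_powR (r := r^-1); rewrite invr_ge0 ltW// => /(_ isT _ _ _ _ h).
      by rewrite !nnegrE powR_ge0 ltW// -powRrM divff ?gt_eqF// powRr1//; apply.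
    by rewrite e; apply: ge0_ler_powR; rewrite ?nnegrE// ltW.
  case: ifPn; rewrite ?inE ?notin_setE/= -sE => h.
    by rewrite indicE mem_set//= !mulr1 muleC.
  by rewrite indicE memNset//= !mulr0 mul0r !mule0.
rewrite ge0_integralZl//; first last.
- by rewrite lee_fin.
- by move=> x _; rewrite erestrict_ge0.
- by apply/(measurable_restrictT _ _).1 => //; exact: measurable_funTS.
rewrite -integral_mkcond H// -powRrM [r^-1 * D]mulrC -/I muleA -EFinM muleC.
by rewrite [(k s * _)%R]mulrC.
Qed.

End layer_cake.

Lemma one_powR (R : realType) (r : R) : 1 `^ r = 1.
Proof. by rewrite powR1. Qed.

Section homogeneous.
Context {R : realType} d (T : measurableType d).
Variables (mu : {sigma_finite_measure set T -> \bar R}).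
Local Notation lam := (@lebesgue_measure R).
Variable N : T -> R.
Hypotheses (mN : measurable_fun setT N) (N0 : forall x, 0 <= N x).
Implicit Types (phi : T -> \bar R) (D : R).

Let mlev (s : R) : measurable [set x | N x <= s].
Proof. by rewrite -[X in measurable X]setTI; apply: measurable_fun_le. Qed.

(** The degree D combines the dilation of the measure with that of phi: it is n for a constant phi
    on R^n, and n + e when phi has degree e. *)
Definition homogeneous_integral D phi := forall s : R, 0 < s ->
  (\int[mu]_(x in [set x | (N x <= s)%R]) phi x =
   (s `^ D)%:E * \int[mu]_(x in [set x | (N x <= 1)%R]) phi x)%E.

Lemma homogeneous_integral_scaling (S : R -> T -> T) (n : nat) (e : R) phi :
  measurable_fun setT phi -> (forall x, 0 <= phi x)%E ->
  (forall s, 0 < s -> forall F : T -> \bar R, measurable_fun setT F ->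
    (forall x, 0 <= F x)%E -> (\int[mu]_x F (S s x) = ((s ^+ n)^-1)%:E * \int[mu]_x F x)%E) ->
  (forall s x, 0 < s -> N (S s x) = s * N x) ->
  (forall s x, 0 < s -> phi (S s x) = ((s `^ e)%:E * phi x)%E) ->
  homogeneous_integral (n%:R + e) phi.
Proof.
move=> mphi phi0 HS HN Hphi s s0.
have mres u : measurable_fun setT (phi \_ [set x | (N x <= u)%R]).
  by apply/(measurable_restrictT _ _).1 => //; exact: measurable_funTS.
have res0 u x : (0 <= (phi \_ [set x | (N x <= u)%R]) x)%E by rewrite erestrict_ge0.
rewrite [LHS]integral_mkcond [in RHS]integral_mkcond.
have -> : (\int[mu]_x (phi \_ [set x | (N x <= s)%R]) x =
    (s ^+ n)%:E * \int[mu]_x (phi \_ [set x | (N x <= s)%R]) (S s x))%E.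
  rewrite HS// muleA -EFinM divff ?mul1e// expf_neq0// gt_eqF//.
have -> : (\int[mu]_x (phi \_ [set x | (N x <= s)%R]) (S s x) =
    \int[mu]_x ((s `^ e)%:E * (phi \_ [set x | (N x <= 1)%R]) x))%E.
  apply: eq_integral => x _; rewrite !patchE.
  have -> : (S s x \in [set x0 | N x0 <= s]) = (x \in [set x0 | N x0 <= 1]).
    by apply/idP/idP; rewrite !inE /= HN// ?ger_pMr// ?(ltW s0).
  by case: ifP => _; [exact: Hphi|rewrite mule0].
rewrite ge0_integralZl//; last by rewrite lee_fin powR_ge0.
rewrite muleA -EFinM; congr (_%:E * _)%E.
rewrite powRD; last by rewrite (gt_eqF s0) implybT.
by rewrite powR_mulrn// ltW.
Qed.

Definition radial_weight (p : \bar R) (t : R) : R :=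
  if p is r%:E then expR (- (t `^ r)) else (t <= 1)%R%:R.

(* Integrate over the layers {N <= s}, each of which homogeneity reduces to the
   unit ball; the remaining integral over s is Gamma (D / p + 1). *)
Lemma integral_radial_weight D phi (p : \bar R) : (0 < p)%E -> 0 <= D ->
  measurable_fun setT phi -> (forall x, 0 <= phi x)%E -> homogeneous_integral D phi ->
  (\int[mu]_x (phi x * (radial_weight p (N x))%:E) =
  (Gamma (Defs.divp D p + 1))%:E * \int[mu]_(x in [set x | (N x <= 1)%R]) phi x)%E.
Proof.
move=> p0 D0 mphi phi0 H; case: p p0 => [r r0| _|//]; last first.
  rewrite /= add0r Gamma1 mul1e [RHS]integral_mkcond; apply: eq_integral => x _.
  rewrite patchE; case: ifPn; rewrite ?inE ?notin_setE /=; first by move=> ->; rewrite mule1.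
  by move=> /negP/negbTE ->; rewrite mule0.
rewrite lte_fin in r0; rewrite /= -gamma_integralE; last by rewrite divr_ge0// ltW.
have mk : measurable_fun setT (fun s : R => expR (- s)).
  by apply: measurableT_comp => //; exact: measurable_expR.
rewrite -(integral_layer_cake mN N0 mphi phi0 r0 mk)//.
apply: eq_integral => x _; congr (_ * _)%E.
have a0 : 0 <= N x `^ r by exact: powR_ge0.
set a := N x `^ r in a0 *.
have ma : measurable [set u | a <= u].
  by rewrite -[X in measurable X]setTI; apply: measurable_fun_le.
rewrite integral_itv_obnd_cbnd; last first.
  by apply/measurable_funTS/measurable_EFinP/measurable_funM => //; exact: measurable_indic.
transitivity (\int[lam]_(s in `[a, +oo[) (expR (- (1 * s)))%:E)%E.
  by rewrite integral_expRN// mul1r divr1.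
rewrite integral_mkcond [RHS]integral_mkcond; apply: eq_integral => s _.
rewrite !patchE; case: ifPn; case: ifPn; rewrite ?inE ?notin_setE /= !in_itv/= !andbT.
- by move=> s0 sa; rewrite indicE mem_set//= mul1r mulr1.
- by move=> s0 sa; exfalso; apply: s0; exact: le_trans sa.
- by move=> s0 sa; rewrite indicE memNset//= mulr0.
- by [].
Qed.

(** Under a homogeneous measure of degree D on the ball, N has density proportional to s^(D-1), so
    its r-th moment is D / (D + r). The layer-cake formula with the indicator of s <= 1 gives the
    mean of 1 - N^r. *)
Lemma integral_ball_powR D r phi (i : R) : 0 < D -> 0 < r ->
  measurable_fun setT phi -> (forall x, 0 <= phi x)%E -> homogeneous_integral D phi ->
  (\int[mu]_(x in [set x | (N x <= 1)%R]) phi x = i%:E)%E ->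
  (\int[mu]_(x in [set x | (N x <= 1)%R]) (phi x * (N x `^ r)%:E) = (i * (D / (D + r)))%:E)%E.
Proof.
move=> D0 r0 mphi phi0 H I.
have ml1 : measurable [set s : R | s <= 1].
  by rewrite -[X in measurable X]setTI; apply: measurable_fun_le.
have mk : measurable_fun setT (\1_[set s : R | s <= 1] : R -> R) by exact: measurable_indic.
have k0 s : 0 <= \1_[set s : R | s <= 1] s :> R by [].
have := integral_layer_cake mN N0 mphi phi0 r0 mk k0 H.
rewrite I.
have -> : (\int[lam]_(s in `]0%R, +oo[) (s `^ (D / r) * \1_[set s | (s <= 1)%R] s)%:E = (D / r + 1)^-1%:E)%E.
  rewrite integral_itv_obnd_cbnd; last first.
    by apply/measurable_funTS/measurable_EFinP/measurable_funM => //; exact: measurable_powR.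
  rewrite -integral_powR ?divr_gt0// integral_mkcond [RHS]integral_mkcond.
  apply: eq_integral => s _; rewrite !patchE; case: ifPn; case: ifPn; rewrite ?inE ?notin_setE /= !in_itv/= ?andbT.
  - by move=> /andP[s0 s1] _; rewrite indicE mem_set//= mulr1.
  - by move=> s1 s0; rewrite indicE memNset ?mulr0//= => s1'; apply: s1; rewrite s0.
  - by move=> /andP[s0 s1]; rewrite s0.
  - by [].
rewrite -EFinM.
have -> : (\int[mu]_x (phi x * \int[lam]_(s in `]0%R, +oo[) (\1_[set s | (s <= 1)%R] s * \1_[set u | (N x `^ r <= u)%R] s)%:E) =
   \int[mu]_(x in [set x | (N x <= 1)%R]) (phi x * (1 - N x `^ r)%:E))%E.
  rewrite [RHS]integral_mkcond; apply: eq_integral => x _.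
  have a0 : 0 <= N x `^ r by exact: powR_ge0.
  have aE : (N x `^ r <= 1) = (N x <= 1).
    apply/idP/idP => h.
      rewrite leNgt; apply/negP => h1; move: h; apply/negP; rewrite -ltNge.
      rewrite -[ltLHS](one_powR r) gt0_ltr_powR// ?nnegrE//.
    by rewrite -[leRHS](one_powR r); apply: ge0_ler_powR; rewrite ?nnegrE ?(ltW r0).
  set a := N x `^ r in a0 aE *.
  have ma : measurable [set u | a <= u].
    by rewrite -[X in measurable X]setTI; apply: measurable_fun_le.
  rewrite integral_itv_obnd_cbnd; last first.
    by apply/measurable_funTS/measurable_EFinP/measurable_funM => //; exact: measurable_indic.
  rewrite patchE; case: ifPn; rewrite ?inE ?notin_setE /= => Nx.
    congr (_ * _)%E.
    have -> : ((1 - a)%:E = \int[lam]_(s in `[a, 1%R]) (cst 1 s))%E.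
      rewrite integral_cst// mul1e; have := @lebesgue_measure_itv R `[a, 1]; rewrite /= lte_fin => ->.
      case: ltP => // a1; congr EFin; apply/eqP; rewrite subr_eq0 eq_le a1.
      by rewrite aE Nx.
    rewrite integral_mkcond [RHS]integral_mkcond; apply: eq_integral => s _.
    rewrite !patchE; case: ifPn; case: ifPn; rewrite ?inE ?notin_setE /= !in_itv/= ?andbT.
    + by move=> /andP[s0 s1] _; rewrite !indicE !mem_set//= mulr1.
    + move=> s1 s0; rewrite !indicE; have [s1'|s1'] := leP s 1.
        rewrite (_ : s \in [set u | a <= u] = false) ?mulr0// memNset//= => sa.
        by apply: s1; rewrite sa s1'.
      by rewrite memNset ?mul0r//= leNgt s1'.
    + by move=> /andP[s0 s1] h; exfalso; apply: h; exact: le_trans s0.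
    + by [].
  rewrite integral0_eq ?mule0// => s _; rewrite !indicE.
  have [s1|s1] := leP s 1; last by rewrite memNset ?mul0r//= leNgt s1.
  rewrite (_ : s \in [set u | a <= u] = false) ?mulr0// memNset//= => sa.
  by apply: Nx; rewrite -aE (le_trans sa).
have mNr : measurable_fun setT (fun x => (N x `^ r)%:E).
  by apply/measurable_EFinP; exact: (measurableT_comp (measurable_powR r)).
(* The two integrals are added up to i instead of being subtracted, since the one sought is not yet
   known to be finite. *)
move=> E1; have : (\int[mu]_(x in [set x | (N x <= 1)%R]) (phi x * (1 - N x `^ r)%:E) +
  \int[mu]_(x in [set x | (N x <= 1)%R]) (phi x * (N x `^ r)%:E) = i%:E)%E.
  have N1 x : N x <= 1 -> 0 <= 1 - N x `^ r.
    by move=> Nx; rewrite subr_ge0 -[leRHS](one_powR r); apply: ge0_ler_powR; rewrite ?nnegrE ?(ltW r0).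
  rewrite -ge0_integralD//; first last.
  - by apply: measurable_funTS; apply: emeasurable_funM.
  - by move=> x Nx; rewrite mule_ge0// lee_fin powR_ge0.
  - apply: measurable_funTS; apply: emeasurable_funM => //; apply/measurable_EFinP.
    by apply: measurable_funB => //; exact/measurable_EFinP.
  - by move=> x Nx; rewrite mule_ge0// lee_fin N1.
  rewrite -I; apply: eq_integral => x; rewrite inE /= => Nx.
  rewrite -ge0_muleDr ?lee_fin ?N1 ?powR_ge0// -EFinD subrK mule1//.
rewrite E1; set J := (\int[mu]_(x in _) _)%E.
case: J => [j| |]//= => -[] e.
have Dr : D + r != 0 by rewrite gt_eqF// addr_gt0.
have -> : j = i - (D / r + 1)^-1 * i by apply/eqP; rewrite eq_sym subr_eq addrC e.
by congr EFin; field; rewrite Dr gt_eqF.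
Qed.

End homogeneous.

(* The layer-cake formula for u^x exp(-u) replaces integration by parts. *)
Lemma Gamma_recurrence (R : realType) (x : R) : 0 < x ->
  Gamma (x + 2) = (x + 1) * Gamma (x + 1).
Proof.
move=> x0.
pose lam := (@lebesgue_measure R).
pose N (u : measurableTypeR R) : R := `|u|.
have mN : measurable_fun setT N by exact: measurableT_comp.
have N0 u : 0 <= N u by exact: normr_ge0.
pose phi (u : measurableTypeR R) : \bar R := (\1_[set v : R | 0 < v] u)%:E.
have phi0 u : (0 <= phi u)%E by rewrite lee_fin.
have mphi : measurable_fun setT phi.
  apply/measurable_EFinP; apply: measurable_indic.
  rewrite (_ : [set _ | _] = `]0, +oo[%classic); first exact: measurable_itv.
  by apply/seteqP; split => z /=; rewrite in_itv/= andbT.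
(* On the positive half-line psi is u^x, of degree 1 + x. Its integral over the unit ball is 1/(1 +
   x), and its integral against exp(-u) is [Gamma (x + 1)]; the radial formula relates the two by
   the factor [Gamma (x + 2)]. *)
pose psi u := (phi u * (N u `^ x)%:E)%E.
have psi0 u : (0 <= psi u)%E by rewrite mule_ge0// lee_fin powR_ge0.
have mpsi : measurable_fun setT psi.
  apply: emeasurable_funM => //; apply/measurable_EFinP.
  exact: (measurableT_comp (measurable_powR x)).
have scal s : 0 < s -> forall F : measurableTypeR R -> \bar R, measurable_fun setT F ->
    (forall u, 0 <= F u)%E -> (\int[lam]_u F (s * u)%R = ((s ^+ 1)^-1)%:E * \int[lam]_u F u)%E.
  by move=> s0 F mF F0; rewrite expr1; exact: ge0_integral_lebesgue_mul.
have Nscal s u : 0 < s -> N (s * u) = s * N u.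
  by move=> s0; rewrite /N normrM gtr0_norm.
have phiscal s u : 0 < s -> phi (s * u) = phi u.
  move=> s0; rewrite /phi !indicE; congr ((nat_of_bool _)%:R)%:E.
  by apply/idP/idP; rewrite !inE /= pmulr_rgt0.
have h1 : homogeneous_integral lam N (1%:R + 0) phi.
  apply: (homogeneous_integral_scaling mN mphi phi0 scal Nscal) => s u s0.
  by rewrite powRr0 mul1e phiscal.
have h2 : homogeneous_integral lam N (1%:R + x) psi.
  apply: (homogeneous_integral_scaling mN mpsi psi0 scal Nscal) => s u s0.
  rewrite /psi phiscal// Nscal// powRM ?(ltW s0)// EFinM.
  by rewrite muleCA.
have I1 : (\int[lam]_(u in [set u | (N u <= 1)%R]) phi u = 1%:E)%E.
  rewrite integral_indic//; last 2 first.
  - by rewrite -[X in measurable X]setTI; apply: measurable_fun_le.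
  - rewrite (_ : [set _ | _] = `]0, +oo[%classic); first exact: measurable_itv.
    by apply/seteqP; split => z /=; rewrite in_itv/= andbT.
  rewrite (_ : _ `&` _ = `]0, 1]%classic); last first.
    apply/seteqP; split => z /=; rewrite in_itv/= /N.
      by move=> [z0]; rewrite gtr0_norm// z0.
    by move=> /andP[z0 z1]; rewrite gtr0_norm.
  have := @lebesgue_measure_itv R `]0, 1]; rewrite /= lte_fin ltr01 sube0; exact.
have p1 : 0 < 1%:R + 0 :> R by rewrite addr0.
have I2 := integral_ball_powR mN N0 p1 x0 mphi phi0 h1 I1.
have D0 : 0 <= 1%:R + x by rewrite addr_ge0// ltW.
have := integral_radial_weight mN N0 (p := 1%:E) (lte01) D0 mpsi psi0 h2.
rewrite I2 /=.
have -> : (\int[lam]_u (psi u * (expR (- (N u `^ 1)))%:E) = (Gamma (x + 1))%:E)%E.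
  rewrite -gamma_integralE ?(ltW x0)// [RHS]integral_mkcond.
  apply: eq_integral => u _; rewrite patchE /psi /phi powRr1//.
  have [u0|u0] := ltP 0 u.
    rewrite indicE !mem_set//= ?in_itv/= ?u0// mul1e -EFinM /N gtr0_norm//.
  by rewrite indicE !memNset//= ?in_itv/= ?andbT ?mul0e//; apply/negP; rewrite -leNgt.
rewrite -EFinM => -[] ->; rewrite divr1 addr0 -addrA.
have -> : 1 + (x + 1) = x + 2 by ring.
have xn : 1 + x != 0 by rewrite gt_eqF// ltr_wpDl.
by rewrite mul1r [RHS]mulrC addrC; field.
Qed.

(** * Probabilities given by a density *)

Section density.
Import HBNNSimple.

(** The formula for nonnegative F is returned together with P, as it is all that later arguments
    know of P. It holds for simple functions and passes to F by monotone convergence. *)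
Lemma exists_density_probability (R : realType) d (T : measurableType d)
    (mu : {sigma_finite_measure set T -> \bar R}) (g : T -> R) :
  measurable_fun setT g -> (forall x, 0 <= g x) -> (\int[mu]_x (g x)%:E = 1)%E ->
  exists P : probability T R, forall F : T -> \bar R, measurable_fun setT F ->
    (forall x, 0 <= F x)%E -> (\int[P]_x F x = \int[mu]_x ((g x)%:E * F x))%E.
Proof.
move=> mg g0 g1.
pose nu (A : set T) := (\int[mu]_(x in A) (g x)%:E)%E.
have nu0 : nu set0 = 0%E by rewrite /nu integral_set0.
have nu_ge0 A : (0 <= nu A)%E by apply: integral_ge0 => x _; rewrite lee_fin.
have nu_sa : semi_sigma_additive nu.
  move=> A mA tA mUA; rewrite /nu; apply: cvg_toP.
    apply: ereal_nondecreasing_is_cvgn => m n mn.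
    apply: lee_sum_nneg_natr => // k _ _; exact: nu_ge0.
  rewrite ge0_integral_bigcup//.
  - by apply/measurable_funTS/measurable_EFinP.
  - by move=> x _; rewrite lee_fin.
pose nuM := HB.pack_for {measure set T -> \bar R} nu (isMeasure.Build _ _ _ nu nu0 nu_ge0 nu_sa).
pose P : probability T R := HB.pack_for (probability T R) (Measure.sort nuM) nuM (Measure_isProbability.Build _ _ _ nuM g1).
exists P => F mF F0.
have mge : measurable_fun setT (fun x => (g x)%:E) by exact/measurable_EFinP.
pose f_ := nnsfun_approx measurableT mF.
have lim_ x : limn (fun n => (f_ n x)%:E) = F x.
  by apply/cvg_lim => //; apply: cvg_nnsfun_approx => // y _; exact: F0.
have mf_ n : measurable_fun setT (fun x => (f_ n x)%:E) by exact/measurable_EFinP/measurable_funP.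
have nd_ x : {homo (fun n => (f_ n x)%:E) : m n / (m <= n)%N >-> (m <= n)%E}.
  by move=> m n mn; rewrite lee_fin; exact/lefP/nd_nnsfun_approx.
transitivity (limn (fun n => \int[P]_x (f_ n x)%:E))%E.
  rewrite -monotone_convergence//.
  - by apply: eq_integral => x _; rewrite lim_.
  - by move=> n x _; rewrite lee_fin.
transitivity (limn (fun n => \int[mu]_x ((g x)%:E * (f_ n x)%:E)))%E; last first.
  rewrite -monotone_convergence//; first last.
  - by move=> x _ m n mn; apply: lee_wpmul2l; [rewrite lee_fin|exact: nd_].
  - by move=> n x _; rewrite mule_ge0// lee_fin.
  - by move=> n; exact: emeasurable_funM.
  apply: eq_integral => x _; rewrite -lim_; apply/cvg_lim => //.
  apply: cvgeZl => //; rewrite lim_.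
  by apply: cvg_nnsfun_approx => // y _; exact: F0.
congr (limn _); apply/funext => n.
transitivity (\sum_(k \in range (f_ n)) (k%:E * \int[mu]_(x in f_ n @^-1` [set k]) (g x)%:E))%E.
  under eq_integral do rewrite fimfunE -fsumEFin//.
  rewrite ge0_integral_fsum//; last 2 first.
  - by move=> y; exact/measurable_EFinP/measurable_funM.
  - by move=> y x _; rewrite nnfun_muleindic_ge0.
  apply: eq_fsbigr => k _.
  by rewrite integralZl_indic_nnsfun// integral_indic// setIT.
rewrite [RHS](eq_integral (fun x => \sum_(k \in range (f_ n)) ((g x)%:E * (k * \1_(f_ n @^-1` [set k]) x)%:E))%E); last first.
  move=> x _; rewrite -ge0_mule_fsumr; last by move=> k; rewrite nnfun_muleindic_ge0.
  by rewrite fsumEFin// -fimfunE.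
rewrite ge0_integral_fsum//; last 2 first.
- by move=> y; apply: emeasurable_funM => //; exact/measurable_EFinP/measurable_funM.
- by move=> k x _; rewrite mule_ge0// ?lee_fin//; exact: nnfun_muleindic_ge0.
apply: eq_fsbigr => k; rewrite inE => -[y _ <-].
rewrite -ge0_integralZl_EFin//; first last.
- exact: measurable_funTS.
- by move=> x _; rewrite lee_fin.
rewrite integral_mkcond; apply: eq_integral => x _; rewrite patchE indicE.
case: ifPn => xA; last by rewrite mulr0 mule0.
by rewrite mulr1 muleC.
Qed.

End density.

(** * The norms and their balls *)

Section lp_norm_theory.
Context {R : realType}.
Implicit Types (p q : \bar R) (n : nat).

Lemma lpnorm_ge0 p n (x : n.-tuple R) : 0 <= lpnorm p x.
Proof.
have h : 0 <= \big[Num.max/0]_(i < n) `|tnth x i| :> R.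
  by elim/big_ind: _ => // a b a0 b0; rewrite le_max a0.
by case: p => [r| |] //=; exact: powR_ge0.
Qed.

Lemma lpnorm_scale p n c (x : Rvec R n) : (0 < p)%E -> 0 <= c ->
  lpnorm p (scalev c x) = c * lpnorm p x.
Proof.
move=> p0 c0.
have h : \big[Num.max/0]_(i < n) `|tnth (scalev c x) i| = c * \big[Num.max/0]_(i < n) `|tnth x i| :> R.
  rewrite (big_morph (fun y : R => c * y) (id1 := 0) (op1 := Num.max)) ?mulr0//.
    by apply: eq_bigr => i _; rewrite tnth_mktuple normrM ger0_norm.
  by move=> a b; rewrite maxr_pMr.
case: p p0 => [r r0| |] //=; rewrite lte_fin in r0.
rewrite (eq_bigr (fun i => c `^ r * `|tnth x i| `^ r)); last first.
  by move=> i _; rewrite tnth_mktuple normrM (ger0_norm c0) powRM.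
rewrite -mulr_sumr powRM ?powR_ge0//; last by apply: sumr_ge0 => i _; exact: powR_ge0.
by rewrite -powRrM divff ?gt_eqF// powRr1.
Qed.

Lemma le_coord_lpnorm p n (x : n.-tuple R) i : (0 < p)%E -> `|tnth x i| <= lpnorm p x.
Proof.
move=> p0; have h : `|tnth x i| <= \big[Num.max/0]_(i < n) `|tnth x i|.
  by rewrite (bigD1 i)//= le_max lexx.
case: p p0 => [r r0| |] //=; rewrite lte_fin in r0.
have -> : `|tnth x i| = (`|tnth x i| `^ r) `^ r^-1.
  by rewrite -powRrM divff ?gt_eqF// powRr1.
apply: ge0_ler_powR; rewrite ?invr_ge0 ?(ltW r0) ?nnegrE ?powR_ge0//.
  by apply: sumr_ge0 => j _; exact: powR_ge0.
rewrite (bigD1 i)//= lerDl; apply: sumr_ge0 => j _; exact: powR_ge0.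
Qed.

Lemma lpnorm_le_coord p n : (0 < p)%E -> exists2 C : R, 0 < C &
  forall (x : n.-tuple R) M, 0 <= M -> (forall i, `|tnth x i| <= M) -> lpnorm p x <= C * M.
Proof.
case: p => [r r0| _|]//=; last first.
  exists 1 => // x M M0 hM; rewrite mul1r.
  by elim/big_ind: _ => // a b aM bM; rewrite ge_max aM.
(* The successor of n keeps the constant positive also for n = 0. *)
rewrite lte_fin in r0; exists (n.+1%:R `^ r^-1); first by rewrite powR_gt0.
move=> x M M0 hM.
have -> : n.+1%:R `^ r^-1 * M = (n.+1%:R * M `^ r) `^ r^-1.
  by rewrite powRM ?powR_ge0// -powRrM divff ?gt_eqF// powRr1.
apply: ge0_ler_powR; rewrite ?invr_ge0 ?(ltW r0) ?nnegrE ?mulr_ge0 ?powR_ge0//.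
  by apply: sumr_ge0 => j _; exact: powR_ge0.
apply: (@le_trans _ _ (\sum_(i < n) M `^ r)).
  by apply: ler_sum => i _; apply: ge0_ler_powR; rewrite ?nnegrE ?(ltW r0).
by rewrite sumr_const card_ord -[leLHS]mulr_natl ler_wpM2r ?powR_ge0// ler_nat.
Qed.

Lemma lpnorm_equiv p q n : (0 < p)%E -> (0 < q)%E -> exists2 C : R, 0 < C &
  forall x : n.-tuple R, lpnorm p x <= C * lpnorm q x.
Proof.
move=> p0 q0; have [C C0 hC] := lpnorm_le_coord n p0; exists C => // x.
by apply: hC; [exact: lpnorm_ge0|move=> i; exact: le_coord_lpnorm].
Qed.

Lemma measurable_bigmaxr d (T : measurableType d) n (f : 'I_n -> T -> R) :
  (forall i, measurable_fun setT (f i)) ->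
  measurable_fun setT (fun x => \big[Num.max/0]_(i < n) f i x).
Proof.
move=> mf.
have h (s : seq 'I_n) : measurable_fun setT (fun x => \big[Num.max/0]_(i <- s) f i x).
  elim: s => [|i s IH].
    by rewrite (_ : (fun _ => _) = cst 0) //; apply/funext => x; rewrite big_nil.
  rewrite (_ : (fun _ => _) = (fun x => Num.max (f i x) (\big[Num.max/0]_(i <- s) f i x))).
    exact: measurable_maxr.
  by apply/funext => x; rewrite big_cons.
exact: h.
Qed.

Lemma measurable_lpnorm_comp p n d (T : measurableType d) (f : 'I_n -> T -> R) :
  (forall i, measurable_fun setT (f i)) ->
  measurable_fun setT (fun x => lpnorm p [tuple f i x | i < n]).
Proof.
move=> mf.
have h : measurable_fun setT (fun x => \big[Num.max/0]_(i < n) `|tnth [tuple f i x | i < n] i|).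
  apply: measurable_bigmaxr => i; under eq_fun do rewrite tnth_mktuple.
  exact: measurableT_comp.
case: p => [r| |]//=.
apply: (measurableT_comp (measurable_powR r^-1)); apply: measurable_sum => i.
under eq_fun do rewrite tnth_mktuple.
apply: (measurableT_comp (measurable_powR r)); exact: measurableT_comp.
Qed.

Lemma measurable_lpnorm p n : measurable_fun setT (fun x : Rvec R n => lpnorm p x).
Proof.
have := @measurable_lpnorm_comp p n _ (Rvec R n) (fun i x => tnth x i) (fun i => measurable_tnth i).
by congr measurable_fun; apply/funext => x; congr lpnorm; apply: eq_from_tnth => i; rewrite tnth_mktuple.
Qed.

Lemma measurable_lpqnorm p q m n : measurable_fun setT (@lpqnorm R p q m n).
Proof.
apply: measurable_lpnorm_comp => i.
apply: (@measurableT_comp _ _ _ _ _ _ (fun x : Rvec R n => lpnorm q x)).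
  exact: measurable_lpnorm.
exact: measurable_tnth.
Qed.

Lemma lpqnorm_ge0 p q m n (x : Rmat R m n) : 0 <= lpqnorm p q x.
Proof. exact: lpnorm_ge0. Qed.

Lemma lpqnorm_scale p q m n c (x : Rmat R m n) : (0 < p)%E -> (0 < q)%E -> 0 <= c ->
  lpqnorm p q (Defs.scalemx c x) = c * lpqnorm p q x.
Proof.
move=> p0 q0 c0; rewrite /lpqnorm -lpnorm_scale//; congr lpnorm.
by apply: eq_from_tnth => i; rewrite !tnth_mktuple lpnorm_scale.
Qed.

(** The factors are indexed by all natural numbers so that removing the first coordinate is the
    shift to i.+1. *)
Lemma tuple_measure_box d (T : measurableType d) (mu : {sigma_finite_measure set T -> \bar R})
    n (A : nat -> set T) : (forall i, measurable (A i)) ->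
  measurable [set x : n.-tuple T | forall i : 'I_n, A i (tnth x i)] /\
  (tuple_measure mu n [set x : n.-tuple T | forall i : 'I_n, A i (tnth x i)] =
   \prod_(i < n) mu (A i))%E.
Proof.
elim: n A => [|n IH] A mA.
  rewrite (_ : [set _ | _] = setT); last by apply/seteqP; split => // x _ [].
  by split => //; rewrite big_ord0 /= diracT.
have [mB vB] := IH (fun i => A i.+1) (fun i => mA i.+1).
set B := [set x | _] in mB vB.
have mS : measurable [set x : n.+1.-tuple T | forall i : 'I_n.+1, A i (tnth x i)].
  rewrite (_ : [set _ | _] = \bigcap_(i in [set: 'I_n.+1]) ((fun x => tnth x i) @^-1` A i)); last first.
    by apply/seteqP; split => x /= h; [move=> i _; exact: h|move=> i; exact: h].
  apply: fin_bigcap_measurable; first exact: finite_finset.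
  by move=> i _; rewrite -[X in measurable X]setTI; exact: measurable_tnth.
split => //.
transitivity (\int[tuple_measure mu n.+1]_x (\1_[set x : n.+1.-tuple T | forall i : 'I_n.+1, A i (tnth x i)] x)%:E)%E.
  by rewrite integral_indic// setIT.
rewrite ge0_integral_tuple_measureS//; last exact/measurable_EFinP/measurable_indic.
transitivity (\int[mu]_x (tuple_measure mu n B * (\1_(A 0%N) x)%:E))%E.
  apply: eq_integral => x _.
  transitivity (\int[tuple_measure mu n]_y ((\1_(A 0%N) x)%:E * (\1_B y)%:E))%E.
    apply: eq_integral => y _; rewrite !indicE -EFinM -natrM mulnb; congr ((nat_of_bool _)%:R)%:E.
    apply/idP/andP; rewrite !inE /=.
      move=> h; split; first by have := h ord0; rewrite tnth0.
      by move=> i; have := h (lift ord0 i); rewrite tnthS.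
    move=> [h0 hS] i; have [->|i0] := eqVneq i ord0; first by rewrite tnth0.
    have [j ->] : exists j, i = lift ord0 j.
      by case: (unliftP ord0 i) i0 => [j ->|->]; [exists j|rewrite eqxx].
    by rewrite tnthS; exact: hS.
  rewrite ge0_integralZl_EFin//; last exact/measurable_EFinP/measurable_indic.
  by rewrite integral_indic// setIT muleC.
rewrite ge0_integralZl//; last exact/measurable_EFinP/measurable_indic.
by rewrite integral_indic// setIT muleC vB big_ord_recl.
Qed.

Lemma vol_box n (a : nat -> R) (e : R) : 0 < e ->
  measurable [set x : Rvec R n | forall i : 'I_n, a i - e < tnth x i <= a i + e] /\
  vol n [set x : Rvec R n | forall i : 'I_n, a i - e < tnth x i <= a i + e] = ((2 * e) ^+ n)%:E.
Proof.
move=> e0.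
have [mB vB] := @tuple_measure_box _ (measurableTypeR R) (@lebesgue_measure R) n (fun i => `]a i - e, a i + e]%classic) (fun i => measurable_itv _).
have -> : [set x : Rvec R n | forall i : 'I_n, a i - e < tnth x i <= a i + e] =
  [set x : Rvec R n | forall i : 'I_n, `]a i - e, a i + e]%classic (tnth x i)].
  by apply/seteqP; split => x /= h i; have := h i; rewrite in_itv.
split => //; rewrite /vol vB.
transitivity (\prod_(i < n) (2 * e)%:E)%E.
  apply: eq_bigr => i _; have := @lebesgue_measure_itv R `]a i - e, a i + e].
  rewrite /= lte_fin ifT; last by lra.
  by move=> ->; congr EFin; ring.
have P k (c : R) : (\prod_(i < k) c%:E = (c ^+ k)%:E)%E.
  by elim: k => [|k IH]; rewrite ?big_ord0// big_ord_recr/= IH -EFinM exprSr.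
exact: P.
Qed.

(** The ball lies in a cube and contains a cube. The outer half-side is 2 rather than 1 because the
    boxes are half-open. *)
Lemma omegaE q n : (0 < q)%E -> (vol n (@lpball R q n) = (omega q n)%:E)%E /\ 0 < omega q n.
Proof.
move=> q0.
have mB : measurable (@lpball R q n).
  by rewrite -[X in measurable X]setTI; apply: measurable_fun_le => //; exact: measurable_lpnorm.
have [m2 v2] := @vol_box n (fun=> 0) 2 (ltr0n _ 2).
have fin : (vol n (@lpball R q n) < +oo)%E.
  apply: (@le_lt_trans _ _ ((2 * 2) ^+ n)%:E); last exact: ltry.
  rewrite -v2; apply: le_measure; rewrite ?inE// => x; rewrite /lpball /= => x1 i.
  by have := le_coord_lpnorm x i q0; rewrite ler_norml => h; lra.
have e : (vol n (@lpball R q n) = (omega q n)%:E)%E.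
  by rewrite /omega fineK// ge0_fin_numE.
split => //; rewrite -lte_fin -e.
have [C C0 hC] := lpnorm_le_coord n q0.
have CV0 : 0 < C^-1 by rewrite invr_gt0.
have [m1 v1] := @vol_box n (fun=> 0) C^-1 CV0.
apply: (@lt_le_trans _ _ ((2 * C^-1) ^+ n)%:E).
  by rewrite lte_fin exprn_gt0// mulr_gt0// invr_gt0.
rewrite -v1; apply: le_measure; rewrite ?inE// => x /= h.
rewrite /lpball /=; apply: (@le_trans _ _ (C * C^-1)); last by rewrite divff ?gt_eqF.
apply: hC; first by rewrite invr_ge0 ltW.
by move=> i; rewrite ler_norml; have := h i; lra.
Qed.

End lp_norm_theory.

(** * The radial law and the cone measure *)

Section radial_probability.
Context {R : realType}.
Implicit Types (p q : \bar R) (n : nat).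

Lemma radial_weight_ge0 p (t : R) : 0 <= radial_weight p t.
Proof. by case: p => [r| |] //=; exact: expR_ge0. Qed.

Lemma measurable_radial_weight p : measurable_fun setT (radial_weight p : R -> R).
Proof.
have h : measurable_fun setT (fun t : R => (t <= 1)%R%:R : R).
  rewrite (_ : (fun _ => _) = \1_[set t : R | t <= 1]).
    apply: measurable_indic; rewrite -[X in measurable X]setTI; exact: measurable_fun_le.
  by apply/funext => t; rewrite indicE; congr (nat_of_bool _)%:R; apply/idP/idP; rewrite inE.
case: p => [r| |]//=.
apply: measurableT_comp; first exact: measurable_expR.
apply: measurableT_comp => //; exact: measurable_powR.
Qed.

(** Independence of the rows thus yields a matrix density that depends on the mixed norm alone:
    exponentials multiply to the exponential of the sum of p-th powers, indicators to the indicator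
    of the maximum. *)
Lemma prod_radial_weight p q m n (x : Rmat R m n) : (0 < p)%E ->
  \prod_(i < m) radial_weight p (lpnorm q (tnth x i)) = radial_weight p (lpqnorm p q x).
Proof.
case: p => [r r0| _|]//=; rewrite /lpqnorm/=.
  rewrite lte_fin in r0; rewrite -expR_sum sumrN; congr (expR (- _)).
  rewrite -powRrM mulVf ?gt_eqF// powRr1; last by apply: sumr_ge0 => i _; exact: powR_ge0.
  by apply: eq_bigr => i _; rewrite tnth_mktuple ger0_norm// lpnorm_ge0.
under [in RHS]eq_bigr => i _ do rewrite tnth_mktuple (ger0_norm (lpnorm_ge0 _ _)).
elim/big_rec2: _ => [|i y z _ ->]; first by rewrite ler01.
by rewrite -natrM mulnb ge_max.
Qed.

Lemma homogeneous_vol q n (e : R) (phi : Rvec R n -> \bar R) : (0 < q)%E ->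
  measurable_fun setT phi -> (forall x, 0 <= phi x)%E ->
  (forall s x, 0 < s -> phi (scalev s x) = ((s `^ e)%:E * phi x)%E) ->
  homogeneous_integral (vol n) (fun x => lpnorm q x) (n%:R + e) phi.
Proof.
move=> q0 mphi phi0 hphi.
apply: (@homogeneous_integral_scaling _ _ _ (vol n) (fun x : Rvec R n => lpnorm q x)
  (@measurable_lpnorm R q n) (fun s => @scalev R n s) n e phi mphi phi0 _ _ hphi) => //.
- by move=> s s0 F mF F0; exact: ge0_integral_vol_scalev.
- by move=> s x s0; rewrite lpnorm_scale// ltW.
Qed.

Lemma homogeneous_mxvol p q m n (phi : Rmat R m n -> \bar R) : (0 < p)%E -> (0 < q)%E ->
  measurable_fun setT phi -> (forall x, 0 <= phi x)%E ->
  (forall s x, 0 < s -> phi (Defs.scalemx s x) = phi x) ->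
  homogeneous_integral (mxvol m n) (fun x => lpqnorm p q x) (m * n)%:R phi.
Proof.
move=> p0 q0 mphi phi0 hphi; rewrite -[(m * n)%:R]addr0.
apply: (@homogeneous_integral_scaling _ _ _ (mxvol m n) (@lpqnorm R p q m n)
  (@measurable_lpqnorm _ p q m n) (fun s => @Defs.scalemx R m n s)) => //.
- by move=> s s0 F mF F0; exact: ge0_integral_mxvol_scalemx.
- by move=> s x s0; rewrite lpqnorm_scale// ltW.
- by move=> s x s0; rewrite powRr0 mul1e hphi.
Qed.

Lemma measurable_lpball q n : measurable (@lpball R q n).
Proof.
by rewrite -[X in measurable X]setTI; apply: measurable_fun_le => //; exact: measurable_lpnorm.
Qed.

Lemma measurable_lpqball p q m n : measurable (@lpqball R p q m n).
Proof.
by rewrite -[X in measurable X]setTI; apply: measurable_fun_le => //; exact: measurable_lpqnorm.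
Qed.

Lemma measurable_radial_density p q n :
  measurable_fun setT (fun x : Rvec R n => radial_weight p (lpnorm q x)).
Proof.
apply: (@measurableT_comp _ _ _ _ _ _ (radial_weight p)).
  exact: measurable_radial_weight.
exact: measurable_lpnorm.
Qed.

(** The integral over R^n of [radial_weight p (lpnorm q x)]. *)
Definition radial_mass p q n : R := Gamma (Defs.divp n%:R p + 1) * omega q n.

Lemma divp_ge0 (c : R) p : (0 < p)%E -> 0 <= c -> 0 <= Defs.divp c p.
Proof. by case: p => [r| |]//=; rewrite lte_fin => r0 c0; rewrite divr_ge0// ltW. Qed.

Lemma radial_mass_gt0 p q n : (0 < p)%E -> (0 < q)%E -> 0 < radial_mass p q n.
Proof.
move=> p0 q0; rewrite mulr_gt0 ?Gamma_gt0 ?divp_ge0//.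
by have [] := omegaE n q0.
Qed.

Definition radial_law p q n (P : probability (Rvec R n) R) :=
  forall F : Rvec R n -> \bar R, measurable_fun setT F -> (forall x, 0 <= F x)%E ->
  (\int[P]_x F x =
   \int[vol n]_x ((radial_weight p (lpnorm q x) / radial_mass p q n)%:E * F x))%E.

Lemma exists_radial_law p q n : (0 < p)%E -> (0 < q)%E -> exists P, @radial_law p q n P.
Proof.
move=> p0 q0; have Z0 := radial_mass_gt0 n p0 q0.
have mw := @measurable_radial_density p q n.
apply: exists_density_probability.
- by apply: measurable_funM.
- by move=> x; rewrite divr_ge0 ?radial_weight_ge0// ltW.
rewrite (eq_integral (fun x : Rvec R n => (radial_mass p q n)^-1%:E * (1 * (radial_weight p (lpnorm q x))%:E))%E); last first.
  by move=> x _; rewrite mul1e -EFinM mulrC.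
rewrite ge0_integralZl_EFin//; first last.
- by rewrite invr_ge0 ltW.
- by apply: emeasurable_funM => //; exact/measurable_EFinP.
- by move=> x _; rewrite mul1e lee_fin radial_weight_ge0.
have h1 : homogeneous_integral (vol n) (fun x => lpnorm q x) (n%:R + 0) (fun=> 1%E).
  by apply: homogeneous_vol => // s x s0; rewrite powRr0 mul1e.
rewrite addr0 in h1.
rewrite (integral_radial_weight (@measurable_lpnorm R q n) (fun x => lpnorm_ge0 q x) p0 _ _ _ h1)//.
rewrite integral_cst ?mul1e; last exact: measurable_lpball.
have [e _] := omegaE n q0; rewrite [X in (_ * (_ * X))%E]e -!EFinM.
by rewrite mulVf// gt_eqF.
Qed.

(** The indicator of a set invariant under dilations has degree mn, so the radial part integrates
    out to a Gamma factor. For p = +oo the density is constant on the ball and C may be any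
    measurable set. *)
Lemma radial_law_event p q m n (P : probability (Rvec R n) R) (C : set (Rmat R m n)) :
  (0 < p)%E -> (0 < q)%E -> radial_law p q P -> measurable C ->
  (p = +oo%E \/ forall s x, 0 < s -> C (Defs.scalemx s x) = C x) ->
  (tuple_measure P m C = (Gamma (Defs.divp (m * n)%:R p + 1) / radial_mass p q n ^+ m)%:E *
     mxvol m n (C `&` lpqball p q))%E.
Proof.
move=> p0 q0 hP mC inv; have Z0 := radial_mass_gt0 n p0 q0.
have mw := @measurable_radial_density p q n.
have m1C : measurable_fun setT (fun x => (\1_C x)%:E : \bar R) by exact/measurable_EFinP/measurable_indic.
transitivity (\int[tuple_measure P m]_x (\1_C x)%:E)%E.
  by rewrite integral_indic// setIT.
have wZ0 (x : Rvec R n) : 0 <= radial_weight p (lpnorm q x) / radial_mass p q n.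
  by rewrite divr_ge0 ?radial_weight_ge0// ltW.
rewrite (ge0_integral_tuple_measure_density (measurable_funM mw (measurable_cst _)) wZ0 hP)//.
rewrite (eq_integral (fun x : Rmat R m n => ((radial_mass p q n)^-1 ^+ m)%:E * ((\1_C x)%:E * (radial_weight p (lpqnorm p q x))%:E))%E); last first.
  move=> x _; rewrite big_split/= prod_radial_weight// prodr_const card_ord.
  by rewrite -!EFinM; congr EFin; ring.
have mwq : measurable_fun setT (fun x : Rmat R m n => (radial_weight p (lpqnorm p q x))%:E).
  apply/measurable_EFinP.
  exact: measurableT_comp (measurable_radial_weight p) (@measurable_lpqnorm _ p q m n).
rewrite ge0_integralZl_EFin//; first last.
- by rewrite exprn_ge0// invr_ge0 ltW.
- exact: emeasurable_funM.
- by move=> x _; rewrite mule_ge0// lee_fin ?radial_weight_ge0.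
rewrite exprVn mulrC EFinM -muleA; congr (_ * _)%E.
have Iball : (\int[mxvol m n]_(x in [set x | (lpqnorm p q x <= 1)%R]) (\1_C x)%:E = mxvol m n (C `&` lpqball p q))%E.
  by rewrite integral_indic//; exact: measurable_lpqball.
rewrite -Iball; case: inv => [pE|inv].
  rewrite pE /= add0r Gamma1 mul1e [RHS]integral_mkcond; apply: eq_integral => x _.
  rewrite patchE; case: ifPn; rewrite ?inE ?notin_setE /=; first by move=> ->; rewrite mule1.
  by move=> /negP/negbTE ->; rewrite mule0.
have hC : homogeneous_integral (mxvol m n) (@lpqnorm R p q m n) (m * n)%:R (fun x => (\1_C x)%:E).
  apply: homogeneous_mxvol => // s x s0; congr EFin; rewrite !indicE; congr (nat_of_bool _)%:R.
  by apply/idP/idP; rewrite !inE inv.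
by rewrite (integral_radial_weight (@measurable_lpqnorm _ p q m n) (fun x => lpqnorm_ge0 p q x) p0 _ _ _ hC).
Qed.

(** [radial_law_event] for the whole space, whose probability is 1, solved for the volume. *)
Lemma mxvol_lpqball p q m n : (0 < p)%E -> (0 < q)%E ->
  (mxvol m n (lpqball p q) = (radial_mass p q n ^+ m / Gamma (Defs.divp (m * n)%:R p + 1))%:E)%E.
Proof.
move=> p0 q0; have [P hP] := exists_radial_law n p0 q0.
have G0 : 0 < Gamma (Defs.divp (m * n)%:R p + 1) by rewrite Gamma_gt0// divp_ge0.
have Z0 := radial_mass_gt0 n p0 q0.
have Zm : 0 < radial_mass p q n ^+ m by rewrite exprn_gt0.
have := radial_law_event (m := m) p0 q0 hP measurableT (or_intror (fun _ _ _ => erefl)).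
rewrite setTI tuple_measure_setT; last exact: probability_setT.
set v := mxvol _ _ _ => e.
have {1}-> : v = ((radial_mass p q n ^+ m / Gamma (Defs.divp (m * n)%:R p + 1))%:E *
    ((Gamma (Defs.divp (m * n)%:R p + 1) / radial_mass p q n ^+ m)%:E * v))%E.
  rewrite muleA -EFinM [X in X%:E](_ : _ = 1) ?mul1e//.
  by field; rewrite !gt_eqF.
by rewrite -e mule1.
Qed.

Lemma mxvol_le_scale m n (C D : set (Rmat R m n)) (c : R) : 0 < c ->
  measurable C -> measurable D -> (forall x, C (Defs.scalemx c x) = D x) ->
  mxvol m n C = ((c ^+ (m * n))%:E * mxvol m n D)%E.
Proof.
move=> c0 mC mD CD; have m1 (A : set (Rmat R m n)) : measurable A -> measurable_fun setT (fun x => (\1_A x)%:E : \bar R).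
  by move=> mA; apply/measurable_EFinP/measurable_indic.
have IE (A : set (Rmat R m n)) : measurable A -> mxvol m n A = (\int[mxvol m n]_x (\1_A x)%:E)%E.
  by move=> mA; rewrite integral_indic// setIT.
rewrite IE// IE//.
have C0 (x : Rmat R m n) : (0 <= (\1_C x)%:E :> \bar R)%E by rewrite lee_fin.
have := ge0_integral_mxvol_scalemx c0 (m1 _ mC) C0.
rewrite (eq_integral (fun x : Rmat R m n => (\1_D x)%:E)); last first.
  move=> x _; rewrite !indicE; congr ((nat_of_bool _)%:R)%:E.
  by apply/idP/idP; rewrite !inE CD.
by move=> ->; rewrite muleA -EFinM divff ?mul1e// expf_neq0// gt_eqF.
Qed.

Lemma mxvol_lpqball_scale p q m n (c : R) : (0 < p)%E -> (0 < q)%E -> 0 < c ->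
  mxvol m n [set x | lpqnorm p q x <= c] = ((c ^+ (m * n))%:E * mxvol m n (lpqball p q))%E.
Proof.
move=> p0 q0 c0; apply: mxvol_le_scale => //.
- by rewrite -[X in measurable X]setTI; apply: measurable_fun_le => //; exact: measurable_lpqnorm.
- exact: measurable_lpqball.
by move=> x; rewrite /= lpqnorm_scale ?(ltW c0)// /lpqball/= -[X in _ <= X]mulr1 ler_pM2l.
Qed.

Lemma scalemx_lpqball p q m n (c : R) : (0 < p)%E -> (0 < q)%E -> 0 < c ->
  Defs.scalemx c @` lpqball p q = [set x : Rmat R m n | lpqnorm p q x <= c].
Proof.
move=> p0 q0 c0; apply/seteqP; split => x /=.
  move=> [y]; rewrite /lpqball/= => y1 <-.
  by rewrite lpqnorm_scale ?(ltW c0)// -[X in _ <= X]mulr1 ler_pM2l.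
move=> xc; exists (Defs.scalemx c^-1 x).
  by rewrite /lpqball/= lpqnorm_scale ?invr_ge0 ?(ltW c0)// mulrC ler_pdivrMr// mul1r.
apply: eq_from_tnth => i; apply: eq_from_tnth => j; rewrite !tnth_mktuple.
by rewrite mulrA divff ?mul1r// gt_eqF.
Qed.

Definition lpq_vol p q m n : R := fine (mxvol m n (lpqball p q)).

Lemma lpq_volE p q m n : (0 < p)%E -> (0 < q)%E ->
  lpq_vol p q m n = radial_mass p q n ^+ m / Gamma (Defs.divp (m * n)%:R p + 1).
Proof. by move=> p0 q0; rewrite /lpq_vol mxvol_lpqball. Qed.

Lemma lpq_vol_gt0 p q m n : (0 < p)%E -> (0 < q)%E -> 0 < lpq_vol p q m n.
Proof.
move=> p0 q0; rewrite lpq_volE// divr_gt0 ?exprn_gt0 ?radial_mass_gt0//.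
by rewrite Gamma_gt0// divp_ge0.
Qed.

Lemma lpq_radius_gt0 p q m n : (0 < p)%E -> (0 < q)%E -> 0 < lpq_radius p q m n.
Proof. by move=> p0 q0; rewrite powR_gt0//; exact: lpq_vol_gt0. Qed.

(** A dilation by the first radius turns the first body into the unit ball. Its Jacobian is the
    inverse of that ball's volume, as the radius is the mn-th root of the volume with mn > 0. *)
Lemma volVE (p1 q1 p2 q2 : \bar R) m n (t : R) : (0 < p1)%E -> (0 < q1)%E ->
  (0 < p2)%E -> (0 < q2)%E -> (0 < m)%N -> (0 < n)%N -> 0 < t ->
  volV p1 q1 p2 q2 m n t = ((lpq_vol p1 q1 m n)^-1%:E *
   mxvol m n (lpqball p1 q1 `&` [set x | (lpqnorm p2 q2 x <=
      t * lpq_radius p1 q1 m n / lpq_radius p2 q2 m n)%R]))%E.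
Proof.
move=> p10 q10 p20 q20 m0 n0 t0.
have r1 := lpq_radius_gt0 m n p10 q10; have r2 := lpq_radius_gt0 m n p20 q20.
have c1 : 0 < (lpq_radius p1 q1 m n)^-1 by rewrite invr_gt0.
have c2 : 0 < t * (lpq_radius p2 q2 m n)^-1 by rewrite mulr_gt0// invr_gt0.
rewrite /volV !scalemx_lpqball//.
have mle p q c : measurable [set x : Rmat R m n | lpqnorm p q x <= c].
  by rewrite -[X in measurable X]setTI; apply: measurable_fun_le => //; exact: measurable_lpqnorm.
rewrite (mxvol_le_scale (c := (lpq_radius p1 q1 m n)^-1) (D := lpqball p1 q1 `&` [set x | lpqnorm p2 q2 x <=
      t * lpq_radius p1 q1 m n / lpq_radius p2 q2 m n]))//.
- congr (_%:E * _)%E; rewrite exprVn /lpq_radius -powR_mulrn ?powR_ge0// -powRrM.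
  rewrite mulVf ?powRr1//; first exact/ltW/lpq_vol_gt0.
  by rewrite pnatr_eq0 -lt0n muln_gt0 m0 n0.
- exact: measurableI.
- by apply: measurableI => //; exact: measurable_lpqball.
move=> x /=; rewrite /lpqball /= !lpqnorm_scale ?(ltW c1)//.
congr (is_true _ /\ is_true _).
  by rewrite -[X in _ <= X]mulr1 ler_pM2l.
by rewrite ler_pdivrMl// mulrA [_ * t]mulrC.
Qed.

(** The ball integral k is left unevaluated here and is matched with the cone measure in
    [cone_moment]; only its finiteness and positivity are settled, by comparing the two norms. *)
Lemma radial_law_moment p q q' n (P : probability (Rvec R n) R) (e : R) :
  (0 < p)%E -> (0 < q)%E -> (0 < q')%E -> (0 < n)%N -> 0 < e -> radial_law p q P ->
  exists k : R, [/\ (\int[vol n]_(x in @lpball R q n) (lpnorm q' x `^ e)%:E = k%:E)%E, 0 < k &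
   (\int[P]_x (lpnorm q' x `^ e)%:E =
   (Gamma (Defs.divp (n%:R + e) p + 1) / radial_mass p q n * k)%:E)%E].
Proof.
move=> p0 q0 q'0 n0 e0 hP; have Z0 := radial_mass_gt0 n p0 q0.
have mphi : measurable_fun setT (fun x : Rvec R n => (lpnorm q' x `^ e)%:E).
  apply/measurable_EFinP; apply: (@measurableT_comp _ _ _ _ _ _ (fun y => y `^ e)).
    exact: measurable_powR.
  exact: measurable_lpnorm.
have phi0 (x : Rvec R n) : (0 <= (lpnorm q' x `^ e)%:E)%E by rewrite lee_fin powR_ge0.
have h : homogeneous_integral (vol n) (fun x : Rvec R n => lpnorm q x) (n%:R + e) (fun x => (lpnorm q' x `^ e)%:E).
  apply: homogeneous_vol => // s x s0.
  by rewrite lpnorm_scale ?(ltW s0)// powRM ?(ltW s0) ?lpnorm_ge0// EFinM.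
have [vE v0] := omegaE n q0.
have mB := @measurable_lpball q n.
have kfin : (\int[vol n]_(x in @lpball R q n) (lpnorm q' x `^ e)%:E < +oo)%E.
  have [C C0 hC] := lpnorm_equiv n q'0 q0.
  apply: (@le_lt_trans _ _ (\int[vol n]_(x in @lpball R q n) ((C `^ e)%:E))%E).
    apply: ge0_le_integral => //.
    - exact: measurable_funTS.
    - move=> x; rewrite /lpball/= => x1; rewrite lee_fin; apply: ge0_ler_powR; rewrite ?nnegrE ?lpnorm_ge0 ?(ltW C0) ?(ltW e0)//.
      by rewrite (le_trans (hC x))// ger_pMr.
  by rewrite integral_cst// [X in (_ * X)%E]vE -EFinM ltry.
exists (fine (\int[vol n]_(x in @lpball R q n) (lpnorm q' x `^ e)%:E)).
have kE : (\int[vol n]_(x in @lpball R q n) (lpnorm q' x `^ e)%:E = (fine (\int[vol n]_(x in @lpball R q n) (lpnorm q' x `^ e)%:E))%:E)%E.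
  by rewrite fineK// ge0_fin_numE//; exact: integral_ge0.
split => //; first last.
- rewrite hP// (eq_integral (fun x : Rvec R n => (radial_mass p q n)^-1%:E * ((lpnorm q' x `^ e)%:E * (radial_weight p (lpnorm q x))%:E))%E); last first.
    by move=> x _; rewrite -!EFinM; congr EFin; ring.
  have mw := @measurable_radial_density p q n.
  rewrite ge0_integralZl_EFin//; first last.
  + by rewrite invr_ge0 ltW.
  + by apply: emeasurable_funM => //; exact/measurable_EFinP.
  + by move=> x _; rewrite mule_ge0// lee_fin radial_weight_ge0.
  rewrite (integral_radial_weight (@measurable_lpnorm _ q n) (fun x => lpnorm_ge0 q x) p0 _ _ _ h)//; last first.
    by rewrite addr_ge0// ltW.
  rewrite [X in (_ * (_ * X))%E]kE -!EFinM; congr EFin; ring.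
have h1 : homogeneous_integral (vol n) (fun x : Rvec R n => lpnorm q x) n%:R (fun=> 1%E).
  by rewrite -[n%:R]addr0; apply: homogeneous_vol => // s x s0; rewrite powRr0 mul1e.
have I1 : (\int[vol n]_(x in [set x : Rvec R n | (lpnorm q x <= 1)%R]) 1 = (omega q n)%:E)%E.
  by rewrite integral_cst// mul1e.
have np : 0 < n%:R :> R by rewrite ltr0n.
(* Positivity of k: the norm q' is at least 1/C times the norm q, whose e-th moment over the ball is
   explicit. *)
have := integral_ball_powR (@measurable_lpnorm R q n) (fun x => lpnorm_ge0 q x) np e0 (measurable_cst _) (fun=> lee01) h1 I1.
have [C C0 hC] := lpnorm_equiv n q0 q'0.
move=> I2; rewrite -lte_fin -kE.
apply: (@lt_le_trans _ _ ((C^-1 `^ e)%:E * (omega q n * (n%:R / (n%:R + e)))%:E)%E).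
  by rewrite -EFinM lte_fin !mulr_gt0// ?powR_gt0 ?invr_gt0// addr_gt0.
have mN : measurable_fun setT (fun x : Rvec R n => (lpnorm q x `^ e)%:E).
  apply/measurable_EFinP; apply: (@measurableT_comp _ _ _ _ _ _ (fun y => y `^ e)).
    exact: measurable_powR.
  exact: measurable_lpnorm.
rewrite -I2 -ge0_integralZl_EFin//; first last.
- by rewrite powR_ge0.
- by apply: measurable_funTS; under eq_fun do rewrite mul1e.
- by move=> x _; rewrite mul1e lee_fin powR_ge0.
apply: ge0_le_integral => //.
- by move=> x _; rewrite mul1e -EFinM lee_fin mulr_ge0 ?powR_ge0.
- by apply: measurable_funTS; under eq_fun do rewrite mul1e; exact: measurable_funeM.
- exact: measurable_funTS.
- move=> x _; rewrite mul1e -EFinM lee_fin -powRM ?invr_ge0 ?lpnorm_ge0 ?(ltW C0)//.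
  apply: ge0_ler_powR; rewrite ?nnegrE ?mulr_ge0 ?invr_ge0 ?lpnorm_ge0 ?(ltW C0) ?(ltW e0)//.
  by rewrite ler_pdivrMl.
Qed.

End radial_probability.

(** * The cone measure as the law of a normalized uniform point *)

Section cone_measure_theory.
Context {R : realType}.
Implicit Types (p q : \bar R) (n : nat).

Definition vec0 n : Rvec R n := [tuple 0 | i < n].

Lemma lpnorm_eq0 q n (x : Rvec R n) : (0 < q)%E -> lpnorm q x = 0 -> x = vec0 n.
Proof.
move=> q0 Nx; apply: eq_from_tnth => i; rewrite tnth_mktuple; apply/eqP.
by rewrite -normr_le0 -Nx le_coord_lpnorm.
Qed.

Lemma lpnorm0 q n : (0 < q)%E -> lpnorm q (vec0 n) = 0.
Proof.
move=> q0; have -> : vec0 n = scalev 0 (vec0 n).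
  by apply: eq_from_tnth => i; rewrite !tnth_mktuple mul0r.
by rewrite lpnorm_scale// mul0r.
Qed.

Lemma vol_vec0 n : (0 < n)%N -> measurable [set vec0 n] /\ vol n [set vec0 n] = 0%E.
Proof.
move=> n0.
have [mB vB] := @tuple_measure_box _ _ (measurableTypeR R) (@lebesgue_measure R) n (fun=> [set 0]) (fun _ => measurable_set1 0).
have -> : [set vec0 n] = [set x : Rvec R n | forall i : 'I_n, [set 0] (tnth x i)].
  apply/seteqP; split => x /= => [-> i|h]; first by rewrite tnth_mktuple.
  by apply: eq_from_tnth => i; rewrite h tnth_mktuple.
split => //; rewrite /vol vB; case: n n0 {mB vB} => // n _.
rewrite big_ord_recl; have := @lebesgue_measure_set1 R 0 => /= ->; exact: mul0e.
Qed.

(** Cones and preimages under normalization agree away from the origin, which is a null set when n >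
    0. *)
Lemma vol_mod0 n (X Y : set (Rvec R n)) : (0 < n)%N -> measurable X ->
  X `<=` Y -> Y `<=` X `|` [set vec0 n] -> vol n Y = vol n X.
Proof.
move=> n0 mX XY YX; have [m0 v0] := vol_vec0 n0.
have [Y0|Y0] := pselect (Y (vec0 n)); last first.
  congr (vol n _); apply/seteqP; split => // y Yy.
  by have [//|/= e] := YX _ Yy; exfalso; apply: Y0; rewrite -e.
have -> : Y = X `|` [set vec0 n] by apply/seteqP; split => // y [/XY//|/= ->].
apply/eqP; rewrite eq_le; apply/andP; split.
  apply: le_trans (measureU2 _ mX m0) _; by rewrite [X in (_ + X)%E]v0 adde0.
by apply: le_measure; rewrite ?inE//; exact: measurableU.
Qed.

(** The inverse of 0 is 0, so the origin is sent to itself and the map is total. *)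
Definition normalize q n (x : Rvec R n) : Rvec R n := scalev (lpnorm q x)^-1 x.

Lemma measurable_normalize q n : measurable_fun setT (@normalize q n).
Proof.
apply/measurable_fun_tnthP => i; rewrite (_ : _ \o _ = fun x => (lpnorm q x)^-1 * tnth x i).
  apply: measurable_funM; last exact: measurable_tnth.
  rewrite (_ : (fun _ => _) = (fun x => lpnorm q x `^ (-1))).
    apply: (@measurableT_comp _ _ _ _ _ _ (fun y => y `^ (-1))).
      exact: measurable_powR.
    exact: measurable_lpnorm.
  by apply/funext => x; rewrite powR_inv1// lpnorm_ge0.
by apply/funext => x /=; rewrite tnth_mktuple.
Qed.

Lemma lpnorm_normalize q n (x : Rvec R n) : (0 < q)%E -> lpnorm q x != 0 ->
  lpnorm q (normalize q x) = 1.
Proof. by move=> q0 x0; rewrite lpnorm_scale ?invr_ge0 ?lpnorm_ge0// mulVf. Qed.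

Lemma scalev_normalize q n (x : Rvec R n) : lpnorm q x != 0 ->
  scalev (lpnorm q x) (normalize q x) = x.
Proof.
move=> x0; apply: eq_from_tnth => i; rewrite !tnth_mktuple.
by rewrite mulrA divff// mul1r.
Qed.

(** A nonzero point lies in the cone over A exactly when it is in the ball and its direction is in
    A, so the two sets differ at most by the origin. *)
Lemma vol_cone q n (A : set (Rvec R n)) : (0 < n)%N -> (0 < q)%E -> measurable A ->
  vol n (cone (A `&` lpsphere q)) = vol n (lpball q `&` @normalize q n @^-1` A).
Proof.
move=> n0 q0 mA; pose X := (lpball q `&` @normalize q n @^-1` A) `\` [set vec0 n].
have [m0 v0] := vol_vec0 n0.
have mX : measurable X.
  apply: measurableD => //; apply: measurableI; first exact: measurable_lpball.
  by rewrite -[X in measurable X]setTI; exact: measurable_normalize.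
have N0 x : x <> vec0 n -> lpnorm q x != 0.
  by move=> x0; apply/eqP => /(lpnorm_eq0 q0).
transitivity (vol n X); last first.
  apply/esym/vol_mod0 => //; first by move=> x [].
  by move=> x hx; have [->|x0] := pselect (x = vec0 n); [right|left].
apply: vol_mod0 => //.
  move=> x [[x1 Ax] /= x0]; exists (lpnorm q x), (normalize q x); split.
  - by rewrite lpnorm_ge0.
  - by split => //; rewrite /lpsphere/= lpnorm_normalize// N0.
  - by rewrite scalev_normalize// N0.
move=> x [s [b [/andP[s0 s1] [Ab Sb] ->]]].
have [->|s0'] := eqVneq s 0.
  by right; apply: eq_from_tnth => i; rewrite !tnth_mktuple mul0r.
have Nx : lpnorm q (scalev s b) = s by rewrite lpnorm_scale// (Sb : lpnorm q b = 1) mulr1.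
left; split.
  split; first by rewrite /lpball/= Nx.
  rewrite /normalize /= Nx (_ : scalev _ _ = b)//.
  by apply: eq_from_tnth => i; rewrite !tnth_mktuple mulrA mulVf// mul1r.
by move=> /= e; move: Nx; rewrite e lpnorm0// => /eqP; rewrite eq_sym (negbTE s0').
Qed.

(** The hypothesis speaks of subsets of the sphere only. The sphere has mass 1, so its complement is
    null and the formula extends to all measurable A. *)
Lemma cone_distributedE q n d (T : measurableType d) (P : probability T R)
    (Theta : {RV P >-> Rvec R n}) (A : set (Rvec R n)) :
  (0 < n)%N -> (0 < q)%E -> cone_distributed q Theta -> measurable A ->
  distribution P Theta A = (vol n (lpball q `&` @normalize q n @^-1` A) * ((omega q n)^-1)%:E)%E.
Proof.
move=> n0 q0 hT mA; have [vE v0] := omegaE n q0.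
have mS : measurable (@lpsphere R q n).
  rewrite (_ : lpsphere q = lpball q `&` [set x : Rvec R n | 1 <= lpnorm q x]).
    apply: measurableI; first exact: measurable_lpball.
    rewrite -[X in measurable X]setTI; apply: measurable_fun_le => //; exact: measurable_lpnorm.
  apply/seteqP; split => x; rewrite /lpsphere /lpball /=; first by move=> ->; rewrite lexx.
  by move=> [h1 h2]; apply/eqP; rewrite eq_le h1.
have dS : distribution P Theta (lpsphere q) = 1%E.
  rewrite hT// /cone_measure -[lpsphere q]setTI vol_cone// preimage_setT setIT.
  by rewrite [X in (X / _)%E]vE inver gt_eqF// -EFinM divff// gt_eqF.
have dSc : distribution P Theta (~` lpsphere q) = 0%E.
  have := probability_setC (distribution P Theta) mS; move=> ->.
  by rewrite [X in (_ - X)%E]dS subee.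
transitivity (distribution P Theta (A `&` lpsphere q)).
  have {1}-> : A = (A `&` lpsphere q) `|` (A `&` ~` lpsphere q).
    by rewrite -setIUr setUv setIT.
  rewrite measureU; first last.
  - by rewrite setIACA setICr setI0.
  - by apply: measurableI => //; exact: measurableC.
  - exact: measurableI.
  rewrite [X in (_ + X)%E](_ : _ = 0%E) ?adde0//.
  apply/eqP; rewrite -measure_le0 -dSc; apply: le_measure; rewrite ?inE//.
  - by apply: measurableI => //; exact: measurableC.
  - exact: measurableC.
rewrite hT//; last exact: measurableI.
by rewrite /cone_measure vol_cone// inver gt_eqF.
Qed.

(** For a uniform point x of the ball, the direction has the law of Theta, and |x|_q'^e is |x|_q^e
    times a function of the direction. The latter has degree 0, so [integral_ball_powR] splits off
    the factor n / (n + e). *)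
Lemma cone_moment q q' n (e : R) d (T : measurableType d) (P : probability T R)
    (Theta : {RV P >-> Rvec R n}) :
  (0 < n)%N -> (0 < q)%E -> (0 < q')%E -> 0 < e -> cone_distributed q Theta ->
  (\int[vol n]_(x in @lpball R q n) (lpnorm q' x `^ e)%:E =
   (omega q n * fine ('E_P[fun w => (lpnorm q' (Theta w) `^ e)%R]) * (n%:R / (n%:R + e)))%:E)%E.
Proof.
move=> n0 q0 q'0 e0 hT.
have [vE v0] := omegaE n q0.
have mB := @measurable_lpball R q n.
pose l (x : Rvec R n) : \bar R := (lpnorm q' x `^ e)%:E.
have ml : measurable_fun setT l.
  apply/measurable_EFinP; apply: (@measurableT_comp _ _ _ _ _ _ (fun y => y `^ e)).
    exact: measurable_powR.
  exact: measurable_lpnorm.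
have l0 x : (0 <= l x)%E by rewrite lee_fin powR_ge0.
pose phi x := l (normalize q x).
have mphi : measurable_fun setT phi by exact: measurableT_comp ml (@measurable_normalize q n).
have phiE x : phi x = (((lpnorm q x)^-1 * lpnorm q' x) `^ e)%:E.
  by rewrite /phi /l lpnorm_scale// invr_ge0 lpnorm_ge0.
(* The radial law for p = +oo is the uniform law on the ball. *)
have [Q hQ] := exists_radial_law n (p := +oo%E) (ltry 0) q0.
have Zq : radial_mass +oo q n = omega q n by rewrite /radial_mass/= add0r Gamma1 mul1r.
have intQ (F : Rvec R n -> \bar R) : measurable_fun setT F -> (forall x, 0 <= F x)%E ->
    (\int[Q]_x F x = ((omega q n)^-1)%:E * \int[vol n]_(x in @lpball R q n) F x)%E.
  move=> mF F0; rewrite hQ// Zq -ge0_integralZl//; first last.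
  - by rewrite lee_fin invr_ge0 ltW.
  - exact: measurable_funTS.
  rewrite [RHS]integral_mkcond; apply: eq_integral => x _.
  rewrite patchE /=; case: ifPn; rewrite ?inE ?notin_setE /lpball /=.
    by move=> ->; rewrite mul1r.
  by move=> /negP/negbTE ->; rewrite mul0r mul0e.
pose push := measure_function_pushforward__canonical__measure_function_Measure Q (@measurable_normalize q n).
have EE : (\int[P]_w l (Theta w) = \int[Q]_x phi x)%E.
  transitivity (\int[distribution P Theta]_x l x)%E.
    by rewrite (ge0_integral_pushforward (measurable_funP Theta)).
  transitivity (\int[push]_x l x)%E; last first.
    by rewrite (ge0_integral_pushforward (@measurable_normalize q n)).
  apply: eq_measure_integral => A mA _.
  apply: etrans (cone_distributedE n0 q0 hT mA) _; rewrite muleC.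
  have mNA : measurable (@normalize q n @^-1` A).
    by rewrite -[X in measurable X]setTI; exact: measurable_normalize.
  transitivity (\int[Q]_x (\1_(@normalize q n @^-1` A) x)%:E)%E; last first.
    by rewrite integral_indic// setIT.
  rewrite intQ//; last exact/measurable_EFinP/measurable_indic.
  by rewrite integral_indic// setIC.
rewrite unlock -/l [X in fine X](_ : _ = \int[P]_w l (Theta w))%E// EE intQ//; last by move=> x; rewrite /phi.
have phi_ge0 x : (0 <= phi x)%E by rewrite /phi.
have phihom : homogeneous_integral (vol n) (fun x : Rvec R n => lpnorm q x) n%:R phi.
  rewrite -[n%:R]addr0; apply: homogeneous_vol => // s x s0; rewrite powRr0 mul1e !phiE.
  rewrite !lpnorm_scale ?(ltW s0)// invfM mulrACA mulVf ?mul1r// gt_eqF//.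
have [C C0 hC] := lpnorm_equiv n q'0 q0.
have phiC x : (phi x <= (C `^ e)%:E)%E.
  rewrite phiE lee_fin; apply: ge0_ler_powR; rewrite ?nnegrE ?mulr_ge0 ?invr_ge0 ?lpnorm_ge0 ?(ltW C0) ?(ltW e0)//.
  have [->|x0] := eqVneq (lpnorm q x) 0; first by rewrite invr0 mul0r ltW.
  by rewrite ler_pdivrMl ?lt_neqAle 1?eq_sym ?x0 ?lpnorm_ge0// mulrC.
pose i := fine (\int[vol n]_(x in @lpball R q n) phi x).
have iE : (\int[vol n]_(x in @lpball R q n) phi x = i%:E)%E.
  rewrite /i fineK// ge0_fin_numE; last exact: integral_ge0.
  apply: (@le_lt_trans _ _ (\int[vol n]_(x in @lpball R q n) ((C `^ e)%:E))%E).
    by apply: ge0_le_integral => //; exact: measurable_funTS.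
  by rewrite integral_cst// [X in (_ * X)%E]vE -EFinM ltry.
rewrite iE -EFinM /= (mulrA (omega q n)) divff ?gt_eqF// mul1r.
have np : 0 < n%:R :> R by rewrite ltr0n.
rewrite -(integral_ball_powR (@measurable_lpnorm R q n) (fun x => lpnorm_ge0 q x) np e0 mphi phi_ge0 phihom iE).
apply: eq_integral => x _; rewrite phiE -EFinM -powRM ?mulr_ge0 ?invr_ge0 ?lpnorm_ge0//.
have [Nx|x0] := eqVneq (lpnorm q x) 0; last by rewrite mulrAC mulVf ?mul1r.
by rewrite (lpnorm_eq0 q0 Nx) !lpnorm0// mulr0.
Qed.

(** The third moment required by Lindeberg's argument is the radial moment of exponent 3 e. *)
Lemma unit_mean_lpnorm p q q' n (P : probability (Rvec R n) R) (e : R) :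
  (0 < p)%E -> (0 < q)%E -> (0 < q')%E -> (0 < n)%N -> 0 < e -> radial_law p q P ->
  forall M, 0 < M -> (\int[P]_x (lpnorm q' x `^ e)%:E = M%:E)%E ->
  unit_mean P (fun x : Rvec R n => lpnorm q' x `^ e / M).
Proof.
move=> p0 q0 q'0 n0 e0 hP M M0 hM.
have ml (r : R) : measurable_fun setT (fun x : Rvec R n => lpnorm q' x `^ r).
  apply: (@measurableT_comp _ _ _ _ _ _ (fun y => y `^ r)); first exact: measurable_powR.
  exact: measurable_lpnorm.
split.
- exact: measurable_funM.
- by move=> x; rewrite divr_ge0 ?powR_ge0// ltW.
- have e30 : 0 < e * 3 by rewrite mulr_gt0.
  have [k [_ _ k3]] := radial_law_moment p0 q0 q'0 n0 e30 hP.
  apply/integrableP; split.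
    apply/measurable_EFinP; apply: measurable_funX; apply: measurableT_comp => //.
    exact: measurable_funM.
  rewrite (eq_integral (fun x : Rvec R n => (M^-1 ^+ 3)%:E * (lpnorm q' x `^ (e * 3))%:E)%E); last first.
    move=> x _; rewrite /= normrX normr_id ger0_norm; last by rewrite divr_ge0 ?powR_ge0// ltW.
    by rewrite -EFinM exprMn -powR_mulrn ?powR_ge0// -powRrM mulrC.
  rewrite ge0_integralZl_EFin//; first last.
  + by rewrite exprn_ge0// invr_ge0 ltW.
  + exact/measurable_EFinP.
  + by move=> x _; rewrite lee_fin powR_ge0.
  by rewrite k3 -EFinM ltry.
- rewrite /Rintegral (eq_integral (fun x : Rvec R n => (M^-1)%:E * (lpnorm q' x `^ e)%:E)%E); last first.
    by move=> x _; rewrite -EFinM mulrC.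
  rewrite ge0_integralZl_EFin//; first last.
  + by rewrite invr_ge0 ltW.
  + exact/measurable_EFinP.
  + by move=> x _; rewrite lee_fin powR_ge0.
  by rewrite hM -EFinM /= mulVf// gt_eqF.
Qed.

End cone_measure_theory.

(** * Positivity of the variance by continuity *)

Section nondegeneracy.
Context {R : realType}.
Implicit Types (p q : \bar R) (n : nat).

(** Continuity phrased with boxes, the sets to which [vol_box] assigns a positive volume. *)
Definition box_continuous n (f : Rvec R n -> R) := forall x e, 0 < e ->
  exists2 dl, 0 < dl & forall y : Rvec R n,
    (forall i, `|tnth y i - tnth x i| <= dl) -> `|f y - f x| <= e.

Lemma box_continuous_comp n (g : R -> R) (f : Rvec R n -> R) : continuous g ->
  box_continuous f -> box_continuous (fun x => g (f x)).
Proof.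
move=> cg cf x e e0; have /cvgrPdist_le/(_ _ e0) := cg (f x).
move=> /nbhs_ballP[h /= h0 hb].
have h20 : 0 < h / 2 by rewrite divr_gt0.
have [dl dl0 hdl] := cf x _ h20; exists dl => // y hy.
rewrite distrC; apply: hb; rewrite /ball/= distrC.
by apply: le_lt_trans (hdl y hy) _; lra.
Qed.

Lemma box_continuous2 n (g : R -> R -> R) (f1 f2 : Rvec R n -> R) :
  (forall a b c d e, `|a - c| <= e -> `|b - d| <= e -> `|g a b - g c d| <= 2 * e) ->
  box_continuous f1 -> box_continuous f2 -> box_continuous (fun x => g (f1 x) (f2 x)).
Proof.
move=> hg c1 c2 x e e0; have e20 : 0 < e / 2 by rewrite divr_gt0.
have [d1 d10 h1] := c1 x _ e20; have [d2 d20 h2] := c2 x _ e20.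
exists (Num.min d1 d2); first by rewrite lt_min d10.
move=> y hy; have -> : e = 2 * (e / 2) by field.
apply: hg.
  by apply: h1 => i; apply: le_trans (hy i) _; rewrite ge_min lexx.
by apply: h2 => i; apply: le_trans (hy i) _; rewrite ge_min lexx orbT.
Qed.

Lemma box_continuousB n (f1 f2 : Rvec R n -> R) :
  box_continuous f1 -> box_continuous f2 -> box_continuous (fun x => f1 x - f2 x).
Proof.
apply: (@box_continuous2 n (fun a b => a - b)) => a b c d e.
rewrite !ler_norml => /andP[? ?] /andP[? ?].
by apply/andP; split; lra.
Qed.

Lemma box_continuous_coord n i : box_continuous (fun x : Rvec R n => tnth x i).
Proof. by move=> x e e0; exists e. Qed.

Lemma box_continuous_cst n c : box_continuous (fun _ : Rvec R n => c).
Proof. by move=> x e e0; exists e => // y _; rewrite subrr normr0 ltW. Qed.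

Lemma box_continuous_sum n (s : seq 'I_n) (f : 'I_n -> Rvec R n -> R) :
  (forall i, box_continuous (f i)) -> box_continuous (fun x => \sum_(i <- s) f i x).
Proof.
move=> cf; elim: s => [|i s IH].
  by under [X in box_continuous X]funext do rewrite big_nil; exact: box_continuous_cst.
under [X in box_continuous X]funext do rewrite big_cons.
apply: box_continuous2 (cf i) IH => a b c d e; rewrite !ler_norml => /andP[? ?] /andP[? ?].
by apply/andP; split; lra.
Qed.

Lemma box_continuous_max n (s : seq 'I_n) (f : 'I_n -> Rvec R n -> R) :
  (forall i, box_continuous (f i)) -> box_continuous (fun x => \big[Num.max/0]_(i <- s) f i x).
Proof.
move=> cf; elim: s => [|i s IH].
  by under [X in box_continuous X]funext do rewrite big_nil; exact: box_continuous_cst.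
under [X in box_continuous X]funext do rewrite big_cons.
apply: box_continuous2 (cf i) IH => a b c d e; rewrite !ler_norml => /andP[? ?] /andP[? ?].
by have [?|?] := leP a b; have [?|?] := leP c d; apply/andP; split; lra.
Qed.

Lemma box_continuous_lpnorm q n : (0 < q)%E -> box_continuous (fun x : Rvec R n => lpnorm q x).
Proof.
case: q => [s s0|_|]//=.
  rewrite lte_fin in s0.
  have sV : 0 < s^-1 by rewrite invr_gt0.
  have := box_continuous_comp (continuous_norm_powR sV)
    (box_continuous_sum (index_enum 'I_n) (fun i => box_continuous_comp (continuous_norm_powR s0) (box_continuous_coord i))).
  congr box_continuous; apply/funext => x; rewrite ger0_norm//.
  by apply: sumr_ge0 => i _; exact: powR_ge0.
apply: (box_continuous_max (index_enum 'I_n)) => i.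
by apply: (box_continuous_comp (g := fun t => `|t|)); [exact: norm_continuous|exact: box_continuous_coord].
Qed.

Lemma box_continuous_lpnorm_powR q n r : (0 < q)%E -> 0 < r ->
  box_continuous (fun x : Rvec R n => lpnorm q x `^ r).
Proof.
move=> q0 r0; have := box_continuous_comp (continuous_norm_powR r0) (box_continuous_lpnorm (n := n) q0).
by congr box_continuous; apply/funext => x; rewrite ger0_norm// lpnorm_ge0.
Qed.

Lemma radial_weight_le p (s t : R) : (0 < p)%E -> 0 <= s -> s <= t ->
  radial_weight p t <= radial_weight p s.
Proof.
move=> p0 s0 st; case: p p0 => [r r0| _|]//=.
  rewrite lte_fin in r0; rewrite ler_expR lerN2.
  by apply: ge0_ler_powR; rewrite ?nnegrE ?(ltW r0)// (le_trans s0).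
by have [t1|//] := leP t 1; rewrite (le_trans st t1).
Qed.

(* f stays away from 0 on a small box around x0, and the density is bounded below
   on that box. *)
Lemma radial_law_sqr_gt0 p q n (P : probability (Rvec R n) R) (f : Rvec R n -> R) (x0 : Rvec R n) (K : R) :
  (0 < p)%E -> (0 < q)%E -> radial_law p q P -> measurable_fun setT f ->
  P.-integrable setT (EFin \o (fun x => f x ^+ 2)) ->
  box_continuous f -> f x0 != 0 -> lpnorm q x0 < K -> 0 < radial_weight p K ->
  0 < \int[P]_x (f x ^+ 2).
Proof.
move=> p0 q0 hP mf intf cf fx0 xK wK.
have Z0 := radial_mass_gt0 n p0 q0.
have c0 : 0 < `|f x0| / 2 by rewrite divr_gt0// normr_gt0.
have [d1 d10 h1] := cf x0 _ c0.
have K0 : 0 < K - lpnorm q x0 by rewrite subr_gt0.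
have [d2 d20 h2] := box_continuous_lpnorm q0 x0 K0.
pose dl := Num.min d1 d2.
have dl0 : 0 < dl by rewrite lt_min d10.
have [mB vB] := @vol_box R n (fun i => nth 0 x0 i) dl dl0.
set B := [set x | _] in mB vB.
have hB x : B x -> forall i, `|tnth x i - tnth x0 i| <= dl.
  move=> Bx i; have := Bx i; rewrite (tnth_nth 0 x0) ler_norml => /andP[b1 b2].
  by apply/andP; split; lra.
have hw t : 0 <= t -> t <= K -> radial_weight p K <= radial_weight p t.
  exact: radial_weight_le.
pose c := radial_weight p K / radial_mass p q n * (`|f x0| / 2) ^+ 2.
have cpos : 0 < c by rewrite mulr_gt0 ?exprn_gt0// divr_gt0.
have Ifin : (\int[P]_x (f x ^+ 2)%:E = (\int[P]_x (f x ^+ 2))%:E)%E.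
  by rewrite /Rintegral fineK//; exact: integrable_fin_num intf.
rewrite -lte_fin -Ifin hP//; last 2 first.
- by apply/measurable_EFinP; exact: measurable_funX.
- by move=> x; rewrite lee_fin sqr_ge0.
apply: (@lt_le_trans _ _ (\int[vol n]_x (c%:E * (\1_B x)%:E))%E).
  rewrite ge0_integralZl_EFin//; last 2 first.
  - exact/measurable_EFinP/measurable_indic.
  - exact: ltW.
  by rewrite integral_indic// setIT [X in (_ * X)%E]vB -EFinM lte_fin mulr_gt0// exprn_gt0// mulr_gt0.
apply: ge0_le_integral => //.
- by move=> x _; rewrite -EFinM lee_fin mulr_ge0// ltW.
- apply/measurable_EFinP; apply: measurable_funM => //; exact: measurable_indic.
- apply/measurable_EFinP; apply: measurable_funM; last exact: measurable_funX.
  by apply: measurable_funM => //; exact: measurable_radial_density.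
move=> x _; rewrite -!EFinM lee_fin indicE.
have [Bx|Bx] := boolP (x \in B); last first.
  by rewrite mulr0 mulr_ge0 ?sqr_ge0// divr_ge0 ?radial_weight_ge0// ltW.
rewrite mulr1; move: Bx; rewrite inE => /hB Bx.
have b1 i : `|tnth x i - tnth x0 i| <= d1 by apply: le_trans (Bx i) _; rewrite ge_min lexx.
have b2 i : `|tnth x i - tnth x0 i| <= d2 by apply: le_trans (Bx i) _; rewrite ge_min lexx orbT.
apply: ler_pM.
- by rewrite divr_ge0 ?radial_weight_ge0// ltW.
- exact: sqr_ge0.
- rewrite ler_pM2r ?invr_gt0//; have := h2 x b2; rewrite ler_norml => /andP[_ hN].
  by apply: hw; [exact: lpnorm_ge0|lra].
rewrite -[leRHS]real_normK ?num_real// lerXn2r ?nnegrE// ?(ltW c0)//.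
have := h1 x b1; have := ler_normB (f x0) (f x0 - f x).
have -> : f x0 - (f x0 - f x) = f x by ring.
move=> _; have := ler_normD (f x) (f x0 - f x).
have -> : f x + (f x0 - f x) = f x0 by ring.
by rewrite (distrC (f x0)); lra.
Qed.

(** The test vectors (1,0,..,0) and (1,1,0,..,0): all norms agree on the first one, while on the
    second one the norm determines q. *)
Lemma lpnorm_ones q n k : (0 < q)%E -> (k < 2)%N -> lpnorm q [tuple (i <= k)%N%:R | i < n.+2] =
  if q is s%:E then k.+1%:R `^ s^-1 else 1 :> R.
Proof.
move=> q0 k2; case: q q0 => [s s0|_|]//=.
  rewrite lte_fin in s0; congr (_ `^ _).
  rewrite (eq_bigr (fun i : 'I_n.+2 => (i <= k)%N%:R)); last first.
    move=> i _; rewrite tnth_mktuple; case: (i <= k)%N; first by rewrite normr1 one_powR.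
    by rewrite normr0 powR0// gt_eqF.
  rewrite !big_ord_recl/= big1 ?addr0; last by move=> i _; case: k k2 => [|[|]].
  by case: k k2 => [|[|]]//= _; rewrite -natrD.
apply/eqP; rewrite eq_le; apply/andP; split.
  elim/big_ind: _ => // [a b a1 b1|i _]; first by rewrite ge_max a1.
  by rewrite tnth_mktuple; case: (i <= k)%N; rewrite ?normr1 ?normr0.
by rewrite (bigD1 ord0)//= tnth_mktuple/= normr1 le_max lexx.
Qed.

End nondegeneracy.

(** * The limit of the volumes *)

Section sandwich_limit.
Context {R : realType} d (T : measurableType d) (P : probability T R).
Variables (a b : R) (x1 x2 : T -> R).
Hypotheses (a0 : 0 <= a) (b0 : 0 <= b) (u1 : unit_mean P x1) (u2 : unit_mean P x2).

Let E m r := tuple_measure P m (@mean_le_event R d T m a b r x1 x2).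

(** Of two opposite comparisons at least one holds, so an upper bound for the exchanged event is a
    lower bound for this one. *)
Lemma mean_le_event_swap m r :
  (1 - tuple_measure P m (@mean_le_event R d T m b a (- r) x2 x1) <= E m r)%E.
Proof.
have m1 := measurable_mean_le_event (m := m) a b r (unit_mean_measurable u1) (unit_mean_measurable u2).
have m2 := measurable_mean_le_event (m := m) b a (- r) (unit_mean_measurable u2) (unit_mean_measurable u1).
have tT := @tuple_measure_setT R d T P m (probability_setT P).
rewrite leeBlDr; last first.
  rewrite ge0_fin_numE//; apply: (@le_lt_trans _ _ 1%E); rewrite ?ltry// -tT.
  by apply: le_measure; rewrite ?inE.
rewrite -tT; apply: (@le_trans _ _ (tuple_measure P m (mean_le_event a b r x1 x2 `|` mean_le_event b a (- r) x2 x1))).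
  apply: le_measure; rewrite ?inE//; first exact: measurableU.
  move=> y _; rewrite /mean_le_event /=.
  have [?|h] := leP (mean x1 y `^ a) (expR r * mean x2 y `^ b); [by left|right].
  by rewrite /= expRN ler_pdivlMl ?expR_gt0// ltW.
exact: measureU2.
Qed.

Lemma expRN_small (e : R) : 0 < e -> exists K, forall x, K <= x -> expR (- x) <= e.
Proof.
move=> e0; exists (e^-1) => x ex.
have x0 : 0 < x by rewrite (lt_le_trans _ ex)// invr_gt0.
rewrite expRN invf_ple ?posrE ?expR_gt0//.
by apply: le_trans ex _; apply: le_trans (expR_ge1Dx x); rewrite lerDr.
Qed.

Lemma natr_sqrt_ge (K : R) : exists N, forall m, (N <= m)%N -> K <= Num.sqrt m%:R.
Proof.
exists (Num.truncn (K ^+ 2)).+1 => m mK.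
apply: le_trans (ler_norm K) _.
rewrite -sqrtr_sqr ler_sqrt//.
by rewrite ltW// -truncn_lt_nat// sqr_ge0.
Qed.

(** In the application v is the volume V(t), rho its logarithmic threshold and l = log(tA).
    Positivity of the variance is asked only at l = 0, where half of the mass must be split off. *)
Variables (v : nat -> \bar R) (rho : nat -> R) (l : R).
Hypothesis rhol : Num.sqrt m%:R * (rho m - l) @[m --> \oo] --> 0.
Hypothesis v1 : forall m, (0 < m)%N -> (v m <= 1)%E.
Hypothesis lv : forall m, (0 < m)%N -> (E m (rho m) <= v m)%E.
Hypothesis vu : forall m (h : R), (0 < m)%N -> 0 <= h ->
  (v m <= (expR (- (m%:R * h)))%:E + E m (rho m + h))%E.
Hypothesis nd : l = 0 -> 0 < \int[P]_y ((a * (x1 y - 1) - b * (x2 y - 1)) ^+ 2).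

Let rho_close (e : R) : 0 < e -> exists N, forall m, (N <= m)%N ->
  (0 < m)%N /\ Num.sqrt m%:R * `|rho m - l| <= e.
Proof.
move=> e0; have /cvgr0Pnorm_le/(_ _ e0)[N _ hN] := rhol.
exists N.+1 => m mN; split; first exact: leq_trans mN.
by have := hN m (ltnW mN); rewrite normrM (ger0_norm (sqrtr_ge0 _)).
Qed.

Let rho_close1 (e : R) : 0 < e -> exists N, forall m, (N <= m)%N ->
  (0 < m)%N /\ `|rho m - l| <= e.
Proof.
move=> /rho_close[N hN]; exists N => m /hN[m0 h]; split => //.
apply: le_trans h; rewrite ler_peMl// -[leLHS]sqrtr1 ler_sqrt ?ler1n//.
Qed.

Let lim_v : R := (if l < 0 then 0 else if l == 0 then 2^-1 else 1 : R).

Let lower (e : R) : 0 < e -> exists N, forall m, (N <= m)%N -> ((lim_v - e)%:E <= v m)%E.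
Proof.
move=> e0; rewrite /lim_v; have [l0|l0|l0] := ltgtP l 0.
- exists 1%N => m m0; apply: le_trans (lv m0); apply: le_trans (measure_ge0 _ _).
  by rewrite lee_fin; lra.
- have l20 : 0 < l / 2 by rewrite divr_gt0.
  have [N1 h1] := rho_close1 l20.
  have [N2 h2] := mean_le_event_small b0 a0 u2 u1 e0 l20.
  exists (maxn N1 N2) => m; rewrite geq_max => /andP[/h1[m0 +] /h2 h3].
  rewrite ler_norml => /andP[r1 _].
  apply: le_trans (lv m0); apply: le_trans (mean_le_event_swap _ _).
  rewrite EFinB; apply: leeB => //; apply: h3; lra.
- have v0 : 0 < \int[P]_y ((b * (x2 y - 1) - a * (x1 y - 1)) ^+ 2).
    rewrite (_ : (fun _ => _) = (fun y => (a * (x1 y - 1) - b * (x2 y - 1)) ^+ 2)) ?nd//.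
    by apply/funext => y; ring.
  have [dl dl0 [N2 h2]] := mean_le_event_half b0 a0 u2 u1 v0 e0.
  have [N1 h1] := rho_close dl0.
  exists (maxn N1 N2) => m; rewrite geq_max => /andP[/h1[m0 +] /h2 h3].
  rewrite l0 subr0 => r1.
  apply: le_trans (lv m0); apply: le_trans (mean_le_event_swap _ _).
  rewrite (_ : 2^-1 - e = 1 - (2^-1 + e)); last by field.
  rewrite EFinB; apply: leeB => //; apply: h3.
  apply: le_trans r1; rewrite mulrC ler_wpM2l ?sqrtr_ge0// -normrN; exact: ler_norm.
Qed.

Let upper (e : R) : 0 < e -> exists N, forall m, (N <= m)%N -> (v m <= (lim_v + e)%:E)%E.
Proof.
move=> e0; have e20 : 0 < e / 2 by rewrite divr_gt0.
have [K hK] := expRN_small e20.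
rewrite /lim_v; have [l0|l0|l0] := ltgtP l 0.
(* With h = -l/4 and rho within -l/4 of l, the threshold rho + h is at most l/2 < 0. *)
- have l40 : 0 < - l / 4 by rewrite divr_gt0 ?oppr_gt0.
  have l20 : 0 < - l / 2 by rewrite divr_gt0 ?oppr_gt0.
  have [N1 h1] := rho_close1 l40.
  have [N2 h2] := mean_le_event_small a0 b0 u1 u2 e20 l20.
  exists (maxn (maxn N1 N2) (Num.truncn (`|K| / (- l / 4))).+1) => m.
  rewrite !geq_max => /andP[/andP[/h1[m0 +] /h2 h3] mK].
  rewrite ler_norml => /andP[_ r1].
  apply: le_trans (vu m0 (ltW l40)) _.
  have -> : 0 + e = e / 2 + e / 2 by field.
  rewrite EFinD; apply: leeD; last by apply: h3; lra.
  rewrite lee_fin; apply: hK; apply: le_trans (ler_norm K) _.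
  by rewrite -ler_pdivrMr// ltW// -truncn_lt_nat// divr_ge0// ltW.
- by exists 1%N => m m0; apply: le_trans (v1 m0) _; rewrite lee_fin; lra.
- have [dl dl0 [N2 h2]] := mean_le_event_half a0 b0 u1 u2 (nd l0) e20.
  have dl20 : 0 < dl / 2 by rewrite divr_gt0.
  have [N1 h1] := rho_close dl20.
  have [N3 h3] := natr_sqrt_ge (K / (dl / 2)).
  exists (maxn (maxn N1 N2) N3) => m; rewrite !geq_max => /andP[/andP[/h1[m0 +] /h2 h4] /h3 h5].
  rewrite l0 subr0 => r1.
  have q0 : 0 < Num.sqrt m%:R :> R by rewrite sqrtr_gt0 ltr0n.
  have q2 : Num.sqrt m%:R ^+ 2 = m%:R :> R by rewrite sqr_sqrtr.
  (* With h = dl / (2 sqrt m) the loss exp(-m h) = exp(-sqrt m * dl/2) vanishes, while sqrt m * h =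
     dl/2 uses only half of the allowed threshold. *)
  apply: le_trans (vu m0 (h := dl / 2 / Num.sqrt m%:R) _) _; first by rewrite divr_ge0// ltW.
  have -> : 2^-1 + e = e / 2 + (2^-1 + e / 2) by field.
  rewrite EFinD; apply: leeD.
    rewrite lee_fin; apply: hK; rewrite -{1}q2.
    have -> : Num.sqrt m%:R ^+ 2 * (dl / 2 / Num.sqrt m%:R) = Num.sqrt m%:R * (dl / 2).
      by field; rewrite gt_eqF.
    by rewrite -ler_pdivrMr.
  apply: h4; rewrite mulrDl divfK ?gt_eqF//.
  have := ler_norm (rho m); rewrite -(ler_pM2l q0) mulrC [X in _ <= X -> _]mulrC.
  by rewrite mulrC in r1; lra.
Qed.

Lemma sandwich_limit :
  v m @[m --> \oo] --> (if l < 0 then 0 else if l == 0 then 2^-1 else 1 : R)%:E.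
Proof.
rewrite -/lim_v; have vfin m : (0 < m)%N -> v m \is a fin_num.
  move=> m0; rewrite ge0_fin_numE; last exact: le_trans (measure_ge0 _ _) (lv m0).
  by apply: le_lt_trans (v1 m0) _; rewrite ltry.
apply/fine_cvgP; split; first by exists 1%N.
apply/cvgrPdist_le => e e0.
have [N1 h1] := lower e0; have [N2 h2] := upper e0.
exists (maxn (maxn N1 N2) 1%N) => //= m /=; rewrite !geq_max => /andP[/andP[/h1 + /h2 +] m0].
by rewrite -(fineK (vfin m m0)) !lee_fin ler_norml => ? ?; apply/andP; split; lra.
Qed.

End sandwich_limit.

(** * The volume between two cone probabilities *)

Section volV_sandwich.
Context {R : realType}.
Implicit Types (p q : \bar R) (n : nat).

Lemma lpqnorm_mean (s : R) q m n (M : R) (x : Rmat R m n) : 0 < s -> (0 < m)%N -> 0 < M ->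
  lpqnorm s%:E q x =
  (m%:R * M) `^ s^-1 * mean (fun y : Rvec R n => lpnorm q y `^ s / M) x `^ s^-1.
Proof.
move=> s0 m0 M0; have mp : 0 < m%:R :> R by rewrite ltr0n.
rewrite -powRM; first last.
- by rewrite divr_ge0// sumr_ge0// => i _; rewrite divr_ge0 ?powR_ge0// ltW.
- by rewrite mulr_ge0// ltW.
rewrite {1}/lpqnorm {1}/lpnorm; congr (_ `^ _).
rewrite /mean -mulr_suml; set S := (X in _ = _ * (X / _ / _)).
have -> : m%:R * M * (S / M / m%:R) = S by field; rewrite !gt_eqF.
by apply: eq_bigr => i _; rewrite tnth_mktuple ger0_norm// lpnorm_ge0.
Qed.

Lemma lpq_volP p q m n : (0 < p)%E -> (0 < q)%E ->
  mxvol m n (lpqball p q) = (lpq_vol p q m n)%:E.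
Proof. by move=> p0 q0; rewrite lpq_volE// mxvol_lpqball. Qed.

Lemma radial_law_event_volE p q m n (P : probability (Rvec R n) R) (C : set (Rmat R m n)) :
  (0 < p)%E -> (0 < q)%E -> radial_law p q P -> measurable C ->
  (p = +oo%E \/ forall s x, 0 < s -> C (Defs.scalemx s x) = C x) ->
  (tuple_measure P m C = (lpq_vol p q m n)^-1%:E * mxvol m n (C `&` lpqball p q))%E.
Proof.
move=> p0 q0 hP mC inv; rewrite (radial_law_event p0 q0 hP mC inv); congr (_%:E * _)%E.
by rewrite lpq_volE// invf_div.
Qed.

Let measurable_lpqnorm_le p q m n (c : R) : measurable [set x : Rmat R m n | lpqnorm p q x <= c].
Proof.
by rewrite -[X in measurable X]setTI; apply: measurable_fun_le => //; exact: measurable_lpqnorm.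
Qed.

Let measurable_lpqnorm_le2 p q p' q' m n (c : R) :
  measurable [set x : Rmat R m n | lpqnorm p q x <= c * lpqnorm p' q' x].
Proof.
rewrite -[X in measurable X]setTI; apply: measurable_fun_le => //; first exact: measurable_lpqnorm.
by apply: measurable_funM => //; exact: measurable_lpqnorm.
Qed.

Lemma volV_le1 (p1 q1 p2 q2 : \bar R) m n (t : R) : (0 < p1)%E -> (0 < q1)%E ->
  (0 < p2)%E -> (0 < q2)%E -> (0 < m)%N -> (0 < n)%N -> 0 < t ->
  (volV p1 q1 p2 q2 m n t <= 1)%E.
Proof.
move=> p10 q10 p20 q20 m0 n0 t0; rewrite volVE//.
have v0 := lpq_vol_gt0 m n p10 q10.
rewrite lee_pdivrMl// mule1 -lpq_volP//.
apply: le_measure; rewrite ?inE//; last exact: measurable_lpqball.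
apply: measurableI; [exact: measurable_lpqball|exact: measurable_lpqnorm_le].
Qed.

Section cone_event.
Variables (p1 q1 p2 q2 : \bar R) (m n : nat) (P : probability (Rvec R n) R) (s : R).
Hypotheses (p10 : (0 < p1)%E) (q10 : (0 < q1)%E) (p20 : (0 < p2)%E) (q20 : (0 < q2)%E).
Hypotheses (m0 : (0 < m)%N) (n0 : (0 < n)%N) (s0 : 0 < s) (hP : radial_law p1 q1 P).

Let C r := [set x : Rmat R m n | lpqnorm p2 q2 x <= r * lpqnorm p1 q1 x].

Let CE r : 0 < r -> (tuple_measure P m (C r) = (lpq_vol p1 q1 m n)^-1%:E * mxvol m n (C r `&` lpqball p1 q1))%E.
Proof.
move=> r0; apply: radial_law_event_volE => //; first exact: measurable_lpqnorm_le2.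
right => c x c0; rewrite /C /mkset !lpqnorm_scale ?(ltW c0)//.
by rewrite mulrCA ler_pM2l.
Qed.

Let mball : measurable (@lpqball R p1 q1 m n). Proof. exact: measurable_lpqball. Qed.

Let mCap r : measurable (lpqball p1 q1 `&` [set x : Rmat R m n | lpqnorm p2 q2 x <= r]).
Proof. exact: measurableI mball (measurable_lpqnorm_le _ _ _). Qed.

(** Inside the unit ball the first norm is at most 1, so N2 <= s N1 implies N2 <= s. *)
Lemma cone_event_le_ball : (tuple_measure P m (C s) <=
  (lpq_vol p1 q1 m n)^-1%:E * mxvol m n (lpqball p1 q1 `&` [set x | (lpqnorm p2 q2 x <= s)%R]))%E.
Proof.
have v0 := lpq_vol_gt0 m n p10 q10.
rewrite CE//; apply: lee_wpmul2l; first by rewrite lee_fin invr_ge0 ltW.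
apply: le_measure; rewrite ?inE//.
  exact: measurableI (measurable_lpqnorm_le2 _ _ _ _ _) mball.
move=> x [hC hB]; split => //; apply: le_trans hC _.
by rewrite -[leRHS]mulr1 ler_pM2l.
Qed.

(* Off the ball of radius exp(-h), which has relative volume exp(-mnh), the bound
   N2 <= s implies N2 <= s exp(h) N1. *)
Lemma ball_le_cone_event h : 0 <= h ->
  ((lpq_vol p1 q1 m n)^-1%:E * mxvol m n (lpqball p1 q1 `&` [set x | (lpqnorm p2 q2 x <= s)%R]) <=
   (expR (- (m%:R * h)))%:E + tuple_measure P m (C (s * expR h)))%E.
Proof.
move=> h0; have v0 := lpq_vol_gt0 m n p10 q10.
have sh0 : 0 < s * expR h by rewrite mulr_gt0// expR_gt0.
have mC r : measurable (C r `&` lpqball p1 q1).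
  exact: measurableI (measurable_lpqnorm_le2 _ _ _ _ _) mball.
rewrite CE// lee_pdivrMl//.
apply: (@le_trans _ _ (mxvol m n ([set x | lpqnorm p1 q1 x <= expR (- h)] `|` (C (s * expR h) `&` lpqball p1 q1)))).
  apply: le_measure; rewrite ?inE//.
    exact: measurableU (measurable_lpqnorm_le _ _ _) (mC _).
  move=> x [hB hs]; have [?|N1] := leP (lpqnorm p1 q1 x) (expR (- h)); [by left|right].
  split => //; apply: le_trans hs _; rewrite -mulrA ler_peMr ?(ltW s0)//.
  by rewrite -ler_pdivrMl ?expR_gt0// mulr1 -expRN ltW.
apply: le_trans (measureU2 _ (measurable_lpqnorm_le _ _ _) (mC _)) _.
have EV := mxvol_lpqball_scale m n p10 q10 (expR_gt0 (- h)).
rewrite [X in (X + _)%E]EV lpq_volP// muleDr//.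
apply: leeD.
  (* exp(-mnh) <= exp(-mh) because n >= 1. *)
  rewrite -EFinM -EFinM lee_fin mulrC ler_pM2l// -expRM_natl ler_expR natrM mulrN lerN2.
  by rewrite -mulrA ler_wpM2l// ler_peMl// ler1n.
by rewrite muleA -EFinM divff ?gt_eqF// mul1e.
Qed.

End cone_event.

(** For p1 = +oo the law is uniform on the ball itself, so the volume is a probability exactly, with
    no passage to cones. *)
Lemma radial_law_oo_ball q1 p2 q2 m n (P : probability (Rvec R n) R) s :
  (0 < q1)%E -> radial_law +oo q1 P ->
  (tuple_measure P m [set x | (lpqnorm p2 q2 x <= s)%R] =
  (lpq_vol +oo q1 m n)^-1%:E * mxvol m n (lpqball +oo q1 `&` [set x | (lpqnorm p2 q2 x <= s)%R]))%E.
Proof.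
move=> q10 hP; rewrite setIC; apply: radial_law_event_volE => //; last by left.
Qed.

End volV_sandwich.

(** * Asymptotics of the normalizing radii *)

Section radius_asymptotics.
Context {R : realType}.
Implicit Types (p q : \bar R) (n : nat).

Lemma ln_o_sqrt (k e : R) : 0 < k -> 0 < e ->
  exists N, forall m, (N <= m)%N -> 2 + ln (m%:R * k) <= e * Num.sqrt m%:R.
Proof.
move=> k0 e0; have sk : 0 < Num.sqrt k by rewrite sqrtr_gt0.
(* ln y <= y - 1 is used at y = c sqrt(m k) = (e/4) sqrt m. Doubled, it takes half of the budget e
   sqrt m and leaves a constant for the other half. *)
pose c := e / (4 * Num.sqrt k).
have c0 : 0 < c by rewrite divr_gt0// mulr_gt0.
have [N hN] := natr_sqrt_ge ((2 - 2 * ln c) / (e / 2)).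
exists N.+1 => m mN; have mp : 0 < m%:R :> R by rewrite ltr0n (leq_trans _ mN).
have q0 : 0 < Num.sqrt m%:R :> R by rewrite sqrtr_gt0.
have : 2 - 2 * ln c <= e / 2 * Num.sqrt m%:R.
  by rewrite [leRHS]mulrC -ler_pdivrMr ?divr_gt0// hN// ltnW.
have : ln (c * (Num.sqrt m%:R * Num.sqrt k)) <= c * (Num.sqrt m%:R * Num.sqrt k) - 1.
  rewrite -[X in ln X](subrK 1) addrC; apply: le_ln1Dx.
  by rewrite ltrBrDr addNr mulr_gt0// mulr_gt0.
rewrite (lnM (x := c)) ?posrE//; last by rewrite mulr_gt0.
have -> : ln (m%:R * k) = 2 * ln (Num.sqrt m%:R * Num.sqrt k).
  rewrite -[in LHS](@sqr_sqrtr _ m%:R) ?ler0n// -[in LHS](@sqr_sqrtr _ k) ?(ltW k0)//.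
  by rewrite -exprMn lnXn ?mulr_gt0// mulr_natl.
have -> : c * (Num.sqrt m%:R * Num.sqrt k) = e / 4 * Num.sqrt m%:R.
  by rewrite /c; field; rewrite gt_eqF.
lra.
Qed.

Definition ln_exponent p : R := if p is r%:E then ln r else 0.

(** The volume is mass^m / Gamma(x + 1) with x = mn/p, and Stirling turns log Gamma(x + 1) / (mn)
    into (ln x - 1) / p up to order log m / m. *)
Lemma ln_lpq_radius_cvg p q n : (0 < p)%E -> (0 < q)%E -> (0 < n)%N ->
  Num.sqrt m%:R * (ln (lpq_radius p q m n) -
    (ln (radial_mass p q n) / n%:R -
     Defs.divp 1 p * (ln m%:R + ln n%:R - ln_exponent p - 1))) @[m --> \oo] --> (0 : R).
Proof.
move=> p0 q0 n0; have np : 0 < n%:R :> R by rewrite ltr0n.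
have Z0 := radial_mass_gt0 n p0 q0.
have lnr m : (0 < m)%N -> ln (lpq_radius p q m n) =
    ln (radial_mass p q n) / n%:R - ln (Gamma (Defs.divp (m * n)%:R p + 1)) / (m%:R * n%:R).
  move=> m0; have mp : 0 < m%:R :> R by rewrite ltr0n.
  have G0 : 0 < Gamma (Defs.divp (m * n)%:R p + 1) by rewrite Gamma_gt0// divp_ge0.
  rewrite /lpq_radius ln_powR -/(lpq_vol p q m n) lpq_volE// ln_div ?posrE ?exprn_gt0//.
  by rewrite lnXn// natrM -[_ *+ m]mulr_natl; field; rewrite !gt_eqF.
apply/cvgrPdist_le => e e0; case: p p0 Z0 lnr => [r r0| _|]// Z0 lnr; last first.
  exists 1%N => // m /= m0; rewrite lnr//= [0 + 1]add0r Gamma1 ln1 !mul0r !subr0 subrr mulr0 subr0 normr0.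
  exact: ltW.
rewrite lte_fin in r0; have k0 : 0 < n%:R / r by rewrite divr_gt0.
have en0 : 0 < e * n%:R by rewrite mulr_gt0.
have [N hN] := ln_o_sqrt k0 en0.
exists (maxn N (Num.truncn (2 / (n%:R / r))).+1) => // m /=; rewrite geq_max => /andP[/hN h mk].
have m0 : (0 < m)%N by apply: leq_trans mk.
have mp : 0 < m%:R :> R by rewrite ltr0n.
have x2 : 2 <= m%:R * (n%:R / r).
  by rewrite -ler_pdivrMr// ltW// -truncn_lt_nat// divr_ge0// ltW.
have := ln_Gamma_bound x2; set x := m%:R * _ in x2 h *.
have xE : x = (m * n)%:R / r by rewrite /x natrM mulrA.
rewrite lnr//= -xE; set G := ln (Gamma _) => /andP[G1 G2].
have q0' : 0 < Num.sqrt m%:R :> R by rewrite sqrtr_gt0.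
have lx : ln m%:R + ln n%:R - ln r = ln x.
  by rewrite xE natrM ln_div ?posrE ?mulr_gt0// lnM.
rewrite lx.
have lx0 : 0 <= ln x by rewrite ln_ge0//; lra.
have q2 : Num.sqrt m%:R ^+ 2 = m%:R :> R by rewrite sqr_sqrtr.
(* Here w is sqrt m: the scaled difference equals the Stirling error divided by n sqrt m. *)
have alg (w L Z : R) : 0 < w -> 0 - w * (Z / n%:R - G / (w ^+ 2 * n%:R) - (Z / n%:R - 1 / r * (L - 1))) =
    (G - (w ^+ 2 * (n%:R / r) * L - w ^+ 2 * (n%:R / r))) / (n%:R * w).
  by move=> w0; field; rewrite !gt_eqF.
have := alg _ (ln x) (ln (radial_mass r%:E q n)) q0'; rewrite q2 -/x => ->.
have d0 : 0 < n%:R * Num.sqrt m%:R :> R by rewrite mulr_gt0.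
rewrite normrM normfV (gtr0_norm d0) ler_pdivrMr//.
rewrite mulrA ler_norml; apply/andP; split; last by apply: le_trans h.
by rewrite lerNl; apply: le_trans h; lra.
Qed.

End radius_asymptotics.

Section mean_events.
Context {R : realType}.
Implicit Types (p q : \bar R) (n : nat).

(* The mean of |x|_q^p under radial_law p q; for p = +oo the normalized variable
   is the constant 1 and enters mean_le_event with exponent 0. *)
Definition radial_moment p n : R := if p is r%:E then n%:R / r else 1.

Definition radial_variable p q n (y : Rvec R n) : R :=
  if p is r%:E then lpnorm q y `^ r / (n%:R / r) else 1.

(* The r for which mean_le_event is the event |x|_(p2,q2) <= s |x|_(p1,q1), where
   s is t times the ratio of the normalizing radii. *)
Definition log_ratio (p1 q1 q2 : \bar R) (p2 M t : R) m n : R :=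
  ln (t * lpq_radius p1 q1 m n / lpq_radius p2%:E q2 m n) +
  Defs.divp 1 p1 * ln (m%:R * radial_moment p1 n) - p2^-1 * ln (m%:R * M).

Lemma radial_moment_gt0 p n : (0 < p)%E -> (0 < n)%N -> 0 < radial_moment p n.
Proof.
by case: p => [r| |]//=; rewrite lte_fin => r0 n0; rewrite divr_gt0// ltr0n.
Qed.

(** The logarithmic terms of the threshold undo the normalization of the two means. *)
Lemma mean_le_eventE m n (a b M1 M2 s : R) (x1 x2 : Rvec R n -> R)
    (y : m.-tuple (Rvec R n)) :
  (0 < m)%N -> 0 < M1 -> 0 < M2 -> 0 < s ->
  mean_le_event a b (ln s + b * ln (m%:R * M2) - a * ln (m%:R * M1)) x1 x2 y =
  ((m%:R * M1) `^ a * mean x1 y `^ a <= s * ((m%:R * M2) `^ b * mean x2 y `^ b)).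
Proof.
move=> m0 M10 M20 s0; have mp : 0 < m%:R :> R by rewrite ltr0n.
rewrite /mean_le_event/= expRD expRN expRD lnK ?posrE//.
rewrite -!ln_powR !lnK ?posrE ?powR_gt0 ?mulr_gt0//; congr is_true.
rewrite -[in RHS]ler_pdivlMl ?powR_gt0 ?mulr_gt0//.
by congr (_ <= _); ring.
Qed.

(** For finite p1 the events are the cones of the sandwich. For p1 = +oo the second mean has
    exponent 0, the lower bound is an equality, and the upper one is monotonicity in s. *)
Lemma volV_mean_bounds (p1 q1 q2 : \bar R) (p2 M1 t : R) m n (P : probability (Rvec R n) R) :
  (0 < p1)%E -> (0 < q1)%E -> 0 < p2 -> (0 < q2)%E -> 0 < M1 -> 0 < t ->
  (0 < m)%N -> (0 < n)%N -> radial_law p1 q1 P ->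
  let x1 := fun y : Rvec R n => lpnorm q2 y `^ p2 / M1 in
  let E r := tuple_measure P m (mean_le_event p2^-1 (Defs.divp 1 p1) r x1 (radial_variable p1 q1 (n := n))) in
  let rho := log_ratio p1 q1 q2 p2 M1 t m n in
  (E rho <= volV p1 q1 p2%:E q2 m n t)%E /\
  forall h, 0 <= h -> (volV p1 q1 p2%:E q2 m n t <= (expR (- (m%:R * h)))%:E + E (rho + h)%R)%E.
Proof.
move=> p10 q10 p20 q20 M10 t0 m0 n0 hP x1 E rho.
have p20E : (0 < p2%:E)%E by rewrite lte_fin.
pose s := t * lpq_radius p1 q1 m n / lpq_radius p2%:E q2 m n.
have s0 : 0 < s by rewrite divr_gt0 ?mulr_gt0 ?lpq_radius_gt0.
have M20 := radial_moment_gt0 p10 n0.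
have rhoh h : rho + h = ln (s * expR h) + Defs.divp 1 p1 * ln (m%:R * radial_moment p1 n) - p2^-1 * ln (m%:R * M1).
  by rewrite /rho /log_ratio -/s (lnM (x := s)) ?posrE ?expR_gt0// expRK; ring.
have sh0 h : 0 < s * expR h by rewrite mulr_gt0// expR_gt0.
rewrite volVE// -/s.
have hE h (y : Rmat R m n) : mean_le_event p2^-1 (Defs.divp 1 p1) (rho + h) x1 (radial_variable p1 q1 (n := n)) y =
  (lpqnorm p2%:E q2 y <= s * expR h * ((m%:R * radial_moment p1 n) `^ (Defs.divp 1 p1) * mean (radial_variable p1 q1 (n := n)) y `^ (Defs.divp 1 p1))) :> Prop.
  by rewrite rhoh mean_le_eventE// (lpqnorm_mean q2 y p20 m0 M10).
case: p1 p10 hP M20 @E @rho @s s0 sh0 rhoh hE => [r| |]// p10 hP M20 E rho s s0 sh0 rhoh hE.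
  have r0 : 0 < r by rewrite -lte_fin.
  have hE' h : E (rho + h) = tuple_measure P m [set x : Rmat R m n | lpqnorm p2%:E q2 x <= s * expR h * lpqnorm r%:E q1 x].
    congr (tuple_measure P m _); apply/funext => y; rewrite hE.
    by rewrite /mkset (lpqnorm_mean q1 y r0 m0 M20) /= div1r.
  split; last by move=> h h0; rewrite hE'; exact: ball_le_cone_event.
  by rewrite -[rho]addr0 hE' expR0 mulr1; exact: cone_event_le_ball.
have hE' h : E (rho + h) = tuple_measure P m [set x : Rmat R m n | lpqnorm p2%:E q2 x <= s * expR h].
  congr (tuple_measure P m _); apply/funext => y; rewrite hE /= !powRr0 !mulr1.
  by [].
have hv := radial_law_oo_ball p2%:E q2 m s q10 hP.
rewrite -hv; split; first by rewrite -[rho]addr0 hE' expR0 mulr1.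
have ml c : measurable [set x : Rmat R m n | lpqnorm p2%:E q2 x <= c].
  by rewrite -[X in measurable X]setTI; apply: measurable_fun_le => //; exact: measurable_lpqnorm.
move=> h h0; rewrite hE'; apply: le_trans (leeDr _ _); last by rewrite lee_fin expR_ge0.
apply: le_measure; rewrite ?inE// => x /= hx; apply: le_trans hx _.
by rewrite ler_peMr ?(ltW s0)// -expR0 ler_expR.
Qed.

(** The terms in log m cancel: each radius contributes -(log m)/p, and the unnormalized sum of p-th
    powers contributes (log m)/p with the same sign pattern. *)
Lemma log_ratio_cvg (p1 q1 q2 : \bar R) (p2 M t : R) n :
  (0 < p1)%E -> (0 < q1)%E -> 0 < p2 -> (0 < q2)%E -> 0 < M -> 0 < t -> (0 < n)%N ->
  Num.sqrt m%:R * (log_ratio p1 q1 q2 p2 M t m n -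
   (ln t + (ln (radial_mass p1 q1 n) - ln (radial_mass p2%:E q2 n)) / n%:R
    + (Defs.divp 1 p1 - p2^-1) * (1 - ln n%:R)
    + Defs.divp 1 p1 * (ln_exponent p1 + ln (radial_moment p1 n))
    - p2^-1 * (ln p2 + ln M))) @[m --> \oo] --> 0.
Proof.
move=> p10 q10 p20 q20 M0 t0 n0; have np : 0 < n%:R :> R by rewrite ltr0n.
have p20E : (0 < p2%:E)%E by rewrite lte_fin.
have M20 := radial_moment_gt0 p10 n0.
have := cvgB (ln_lpq_radius_cvg p10 q10 n0) (ln_lpq_radius_cvg p20E q20 n0).
move=> /(_ eventually_filter); rewrite subr0.
apply: cvg_trans; apply: near_eq_cvg; exists 1%N => // m /= m0.
have mp : 0 < m%:R :> R by rewrite ltr0n.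
have D (f g : nat -> R) : (f - g) m = f m - g m by [].
rewrite [LHS]D /log_ratio ln_div ?posrE ?mulr_gt0 ?lpq_radius_gt0//.
rewrite (lnM (x := t)) ?posrE ?lpq_radius_gt0// !(lnM (x := m%:R)) ?posrE//.
rewrite div1r -mulrBr; congr (_ * _).
move: (ln _) (ln _) (ln (radial_mass _ _ _)) (ln (radial_mass _ _ _)) => ? ? ? ?.
ring.
Qed.

End mean_events.

Section nondegenerate_pair.
Context {R : realType}.
Implicit Types (p q : \bar R) (n : nat).

(** The moment is Gamma(n/r + 2) / Gamma(n/r + 1) times n / (n + r), hence (n/r + 1) n / (n + r) =
    n/r. *)
Lemma radial_law_self_moment (r : R) q n (P : probability (Rvec R n) R) :
  0 < r -> (0 < q)%E -> (0 < n)%N -> radial_law r%:E q P ->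
  (\int[P]_x (lpnorm q x `^ r)%:E = (n%:R / r)%:E)%E.
Proof.
move=> r0 q0 n0 hP; have np : 0 < n%:R :> R by rewrite ltr0n.
have r0E : (0 < r%:E)%E by rewrite lte_fin.
have [k [kE _ ->]] := radial_law_moment r0E q0 q0 n0 r0 hP.
have h1 : homogeneous_integral (vol n) (fun x : Rvec R n => lpnorm q x) n%:R (fun=> 1%E).
  by rewrite -[n%:R]addr0; apply: homogeneous_vol => // s x s0; rewrite powRr0 mul1e.
have [vE v0] := omegaE n q0.
have I1 : (\int[vol n]_(x in [set x : Rvec R n | (lpnorm q x <= 1)%R]) 1 = (omega q n)%:E)%E.
  by rewrite integral_cst ?mul1e//; exact: measurable_lpball.
have := integral_ball_powR (@measurable_lpnorm R q n) (fun x => lpnorm_ge0 q x) np r0 (measurable_cst _) (fun=> lee01) h1 I1.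
under eq_integral do rewrite mul1e.
move=> e; move: kE; rewrite [LHS]e => -[<-]; congr EFin.
rewrite /radial_mass /=; have -> : (n%:R + r) / r + 1 = n%:R / r + 2 by field; rewrite gt_eqF.
rewrite Gamma_recurrence ?divr_gt0//.
have G0 : 0 < Gamma (n%:R / r + 1) by rewrite Gamma_gt0// divr_ge0// ltW.
by field; rewrite !gt_eqF//= addr_gt0.
Qed.

Lemma unit_mean_radial_variable p q n (P : probability (Rvec R n) R) :
  (0 < p)%E -> (0 < q)%E -> (0 < n)%N -> radial_law p q P ->
  unit_mean P (radial_variable p q (n := n)).
Proof.
case: p => [r r0|_|]// q0 n0 hP.
  have rp : 0 < r by rewrite -lte_fin.
  apply: (unit_mean_lpnorm (p := r%:E) (q := q)) => //; last exact: radial_law_self_moment.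
  by rewrite divr_gt0// ltr0n.
split => //; first exact: measurable_cst.
  have := finite_measure_integrable_cst P 1 (A := setT) measurableT.
  by apply: eq_integrable => // y _; rewrite /= normr1 expr1n.
by rewrite probability_Rintegral_cst.
Qed.

Lemma unit_mean_sqr_integrable d (T : measurableType d) (P : probability T R) (a b : R) (x1 x2 : T -> R) :
  unit_mean P x1 -> unit_mean P x2 ->
  measurable_fun setT (fun y => a * (x1 y - 1) - b * (x2 y - 1)) /\
  P.-integrable setT (EFin \o (fun y => (a * (x1 y - 1) - b * (x2 y - 1)) ^+ 2)).
Proof.
move=> u1 u2; have [m1 _ j1 _ _] := unit_mean_centered u1.
have [m2 _ j2 _ _] := unit_mean_centered u2.
have mf : measurable_fun setT (fun y => a * (x1 y - 1) - b * (x2 y - 1)).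
  by apply: measurable_funB; exact: measurable_funM.
split => //.
have iD : P.-integrable setT (EFin \o (fun y => 2 * a ^+ 2 * (x1 y - 1) ^+ 2 + 2 * b ^+ 2 * (x2 y - 1) ^+ 2)).
  have := integrableD measurableT (integrableZl measurableT (2 * a ^+ 2) j1) (integrableZl measurableT (2 * b ^+ 2) j2).
  by apply: eq_integrable.
apply: le_integrable iD => //; first by apply/measurable_EFinP; exact: measurable_funX.
move=> y _ /=; rewrite lee_fin [leLHS]ger0_norm ?sqr_ge0// [leRHS]ger0_norm; last first.
  by apply: addr_ge0; apply: mulr_ge0; rewrite ?sqr_ge0// mulr_ge0 ?sqr_ge0.
have := sqr_ge0 (a * (x1 y - 1) + b * (x2 y - 1)).
by rewrite !expr2; lra.
Qed.

(* The origin separates the two variables unless p1 = p2; if p1 = p2, equality at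
   (1,0,..,0) and at (1,1,0,..,0) would force q1 = q2. *)
Lemma radial_variable_nondegenerate (p1 q1 q2 : \bar R) (p2 M1 : R) n (P : probability (Rvec R n) R) :
  (0 < p1)%E -> (0 < q1)%E -> 0 < p2 -> (0 < q2)%E -> 0 < M1 -> (0 < n)%N ->
  (p1, q1) <> (p2%:E, q2) -> (n = 1%N -> p1 <> p2%:E) -> radial_law p1 q1 P ->
  unit_mean P (fun y : Rvec R n => lpnorm q2 y `^ p2 / M1) ->
  0 < \int[P]_y ((p2^-1 * (lpnorm q2 y `^ p2 / M1 - 1) -
                  Defs.divp 1 p1 * (radial_variable p1 q1 y - 1)) ^+ 2).
Proof.
move=> p10 q10 p20 q20 M10 n0 hne hn hP u1.
have u2 := unit_mean_radial_variable p10 q10 n0 hP.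
have [mf intf] := unit_mean_sqr_integrable (p2^-1) (Defs.divp 1 p1) u1 u2.
pose f (y : Rvec R n) := p2^-1 * (lpnorm q2 y `^ p2 / M1 - 1) -
                  Defs.divp 1 p1 * (radial_variable p1 q1 y - 1).
have aff (c k : R) : continuous (fun t : R => c * (t / k - 1)).
  move=> t; apply: cvgM; first exact: cvg_cst.
  by apply: cvgB; [apply: cvgM; [exact: cvg_id|exact: cvg_cst]|exact: cvg_cst].
have cf : box_continuous f.
  apply: box_continuousB.
    by apply: (box_continuous_comp (aff p2^-1 M1)); exact: box_continuous_lpnorm_powR.
  case: p1 p10 {f hne hn hP u2 mf intf} => [r r0| _|]//=.
    by apply: (box_continuous_comp (aff _ _)); exact: box_continuous_lpnorm_powR.
  exact: box_continuous_cst.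
have [K K0 wK] : exists2 K, 0 < K & 0 < radial_weight p1 K.
  by exists 1 => //; case: p1 p10 {hne hn hP u2 mf intf f cf} => [r r0| _|]//= ; rewrite ?expR_gt0// lexx.
suff [x0 fx0 [K' xK' wK']] : exists2 x0, f x0 != 0 & exists2 K', lpnorm q1 x0 < K' & 0 < radial_weight p1 K'.
  exact: (radial_law_sqr_gt0 p10 q10 hP mf intf cf fx0 xK' wK').
have a0 : 0 < p2^-1 by rewrite invr_gt0.
have f0 : f (vec0 n) = Defs.divp 1 p1 - p2^-1.
  rewrite /f lpnorm0// powR0 ?gt_eqF// mul0r.
  case: p1 p10 {hne hn hP u2 mf intf cf f wK} => [r r0| _|]//=; last by rewrite sub0r; ring.
  by rewrite lpnorm0// powR0 ?gt_eqF// mul0r; ring.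
have [ab|ab] := eqVneq (Defs.divp 1 p1) p2^-1; last first.
  exists (vec0 n); first by rewrite f0 subr_eq0.
  by exists K; rewrite ?lpnorm0.
have p1E : p1 = p2%:E.
  case: p1 ab {p10 hne hn hP u2 mf intf cf f f0 wK} => [r| |]//=.
  - by rewrite div1r => /invr_inj ->.
  - by move=> e; move: a0; rewrite -e ltxx.
  - by move=> e; move: a0; rewrite -e ltxx.
have q12 : q1 <> q2 by move=> e; apply: hne; rewrite p1E e.
(* In dimension 1 all the norms coincide and no second test vector exists; [hn] excludes that case
   once p1 = p2. *)
have n2 : (2 <= n)%N by case: (n) n0 (hn) => [|[|]]// _ /(_ erefl); rewrite p1E.
rewrite p1E in f {f0} cf *.
case: n {n0 hn} P n2 {hP u1 u2 mf intf} @f cf => [|[|n]]// _ _ f cf.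
have [f1|f1] := eqVneq (f [tuple (i <= 0)%N%:R | i < n.+2]) 0; last first.
  eexists; first exact: f1.
  by exists (lpnorm q1 [tuple (i <= 0)%N%:R | i < n.+2] + 1); rewrite ?ltrDl//= expR_gt0.
have [f2|f2] := eqVneq (f [tuple (i <= 1)%N%:R | i < n.+2]) 0; last first.
  eexists; first exact: f2.
  by exists (lpnorm q1 [tuple (i <= 1)%N%:R | i < n.+2] + 1); rewrite ?ltrDl//= expR_gt0.
exfalso; apply: q12.
have ones0 q : (0 < q)%E -> lpnorm q [tuple (i <= 0)%N%:R | i < n.+2] = 1 :> R.
  by move=> q0; rewrite lpnorm_ones//; case: q q0 => // r _; rewrite one_powR.
move: f1; rewrite /f /= !ones0// one_powR !div1r -mulrBr => /eqP.
rewrite mulf_eq0 (gt_eqF a0) /= opprB addrA subrK subr_eq0 => /eqP/invr_inj M1E.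
move: f2; rewrite /f /= div1r -mulrBr => /eqP.
rewrite mulf_eq0 (gt_eqF a0) /= opprB addrA subrK subr_eq0 -M1E => /eqP.
have M1n : M1^-1 != 0 by rewrite invr_eq0 gt_eqF.
move=> /(mulIf M1n).
move=> /(congr1 (fun t => t `^ p2^-1)); rewrite -!powRrM mulfV ?gt_eqF// !powRr1 ?lpnorm_ge0//.
rewrite !lpnorm_ones//.
have inj2 (x y : R) : 2 `^ x = 2 `^ y -> x = y.
  move=> /(congr1 (@ln R)); rewrite !ln_powR; apply: mulIf.
  by rewrite gt_eqF// ln_gt0// ltr1n.
have np2 (s : R) : 0 < s -> 2 `^ s^-1 <> 1.
  move=> s0 e2; have /inj2 e : 2 `^ s^-1 = 2 `^ 0 by rewrite powRr0.
  by move: s0; rewrite -invr_gt0 e ltxx.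
case: q1 q10 {hne cf f ones0} => [s1 s10| _|]//; case: q2 q20 => [s2 s20| _|]//.
- by move=> /inj2/invr_inj ->.
- by move=> /esym /(np2 _ s10).
- by move=> /(np2 _ s20).
Qed.

End nondegenerate_pair.

(** * Identification of the constant A *)

Section critical_constant.
Context {R : realType}.
Implicit Types (p q : \bar R) (n : nat).

(** Here M is the c-th moment under the radial law and E the one under the cone measure. The
    identity rewrites the product in A through the moments that normalize the two means. *)
Lemma Mom_radial_moment p n (c E M w : R) : (0 < p)%E -> (0 < n)%N -> 0 < c -> 0 < w ->
  M = Gamma (Defs.divp (n%:R + c) p + 1) / (Gamma (Defs.divp n%:R p + 1) * w) *
      (w * E * (n%:R / (n%:R + c))) ->
  Mom (p / n%:R%:E)%E (c / n%:R) * E = radial_moment p n `^ (- (c * Defs.divp 1 p)) * M.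
Proof.
move=> p0 n0 c0 w0 ->; have np : 0 < n%:R :> R by rewrite ltr0n.
have G0 : 0 < Gamma (Defs.divp n%:R p + 1) by rewrite Gamma_gt0// divp_ge0.
have nc : 0 < n%:R + c by rewrite addr_gt0.
rewrite inver gt_eqF//; case: p p0 G0 => [r r0|_|]// G0.
  rewrite lte_fin in r0; rewrite -EFinM /Mom /= div1r.
  have -> : c / n%:R / (r / n%:R) = c / r by field; rewrite !gt_eqF.
  have -> : (c / n%:R + 1) / (r / n%:R) = (n%:R + c) / r.
    by field; rewrite !gt_eqF.
  have -> : (r / n%:R) `^ (c / r) = (n%:R / r) `^ (- (c * (1 / r))).
    rewrite -(invf_div n%:R r) -(@powR_inv1 _ (n%:R / r)); last by rewrite divr_ge0// ltW.
    by rewrite -powRrM; congr (_ `^ _); ring.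
  rewrite invf_div.
  move: G0; rewrite /=; set g := Gamma (n%:R / r + 1) => G0.
  by field; rewrite !gt_eqF.
rewrite gt0_mulye ?lte_fin ?invr_gt0// /Mom /= one_powR add0r mul1r.
by rewrite Gamma1; field; rewrite !gt_eqF.
Qed.

(** The right-hand side is the limit found in [log_ratio_cvg] without ln t, so the threshold tends
    to log(tA). *)
Lemma ln_Acst (p1 q1 q2 : \bar R) (p2 M : R) n d (T : measurableType d) (P : probability T R)
    (Theta : {RV P >-> Rvec R n}) :
  (0 < p1)%E -> (0 < q1)%E -> 0 < p2 -> (0 < q2)%E -> (0 < n)%N -> 0 < M ->
  M = Gamma (Defs.divp (n%:R + p2) p1 + 1) / radial_mass p1 q1 n *
    (omega q1 n * fine ('E_P[fun w => (lpnorm q2 (Theta w) `^ p2)%R])%E * (n%:R / (n%:R + p2))) ->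
  0 < Acst p1 q1 p2 q2 Theta /\
  ln (Acst p1 q1 p2 q2 Theta) =
    (ln (radial_mass p1 q1 n) - ln (radial_mass p2%:E q2 n)) / n%:R
    + (Defs.divp 1 p1 - p2^-1) * (1 - ln n%:R)
    + Defs.divp 1 p1 * (ln_exponent p1 + ln (radial_moment p1 n))
    - p2^-1 * (ln p2 + ln M).
Proof.
move=> p10 q10 p20 q20 n0 M0 ME; have np : 0 < n%:R :> R by rewrite ltr0n.
have [_ w0] := omegaE n q10.
have p20E : (0 < p2%:E)%E by rewrite lte_fin.
have Z1 := radial_mass_gt0 n p10 q10; have Z2 := radial_mass_gt0 n p20E q20.
have K0 := radial_moment_gt0 p10 n0.
rewrite /Acst (Mom_radial_moment p10 n0 p20 w0 ME).
have -> : omega q1 n * Gamma (Defs.divp n%:R p1 + 1) = radial_mass p1 q1 n by rewrite mulrC.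
have -> : omega q2 n * Gamma (n%:R / p2 + 1) = radial_mass p2%:E q2 n by rewrite mulrC.
have pw0 : 0 < powp p1 1 by case: (p1) p10 => [r r0| _|]//=; rewrite powR_gt0.
have lnpw : ln (powp p1 1) = Defs.divp 1 p1 * ln_exponent p1.
  by case: (p1) => [r| |]/=; rewrite ?ln_powR// ln1 mul0r.
have e0 : 0 < expR 1 / n%:R :> R by rewrite divr_gt0// expR_gt0.
have KM0 : 0 < radial_moment p1 n `^ (- (p2 * Defs.divp 1 p1)) * M by rewrite mulr_gt0// powR_gt0.
have ZZ : 0 < radial_mass p1 q1 n / radial_mass p2%:E q2 n by rewrite divr_gt0.
have pp : 0 < powp p1 1 / p2 `^ p2^-1 by rewrite divr_gt0// powR_gt0.
split; first by rewrite !mulr_gt0 ?invr_gt0 ?powR_gt0.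
have ln4 (x y z w : R) : 0 < x -> 0 < y -> 0 < z -> 0 < w ->
    ln (x * y * z / w) = ln x + ln y + ln z - ln w.
  by move=> *; rewrite ln_div ?lnM ?posrE ?mulr_gt0.
rewrite ln4 ?powR_gt0// !ln_powR.
rewrite !ln_div ?posrE ?powR_gt0 ?expR_gt0// lnM ?posrE ?powR_gt0// !ln_powR expRK lnpw.
by field; rewrite !gt_eqF.
Qed.

Lemma lpnorm_tuple1 q (x : 1.-tuple R) : (0 < q)%E -> lpnorm q x = `|tnth x ord0|.
Proof.
case: q => [r r0|_|]//=; rewrite big_ord_recl big_ord0.
  by rewrite addr0 -powRrM mulfV ?powRr1// gt_eqF.
by rewrite max_l.
Qed.

(** For n = 1 the unit balls do not depend on q; this evaluates A in the degenerate case. *)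
Lemma radial_mass_dim1 p q q' : (0 < q)%E -> (0 < q')%E ->
  radial_mass p q 1 = radial_mass p q' 1 :> R.
Proof.
move=> q0 q'0; rewrite /radial_mass /omega; congr (_ * fine (vol 1 _)).
by apply/funext => x; rewrite /lpball/mkset !lpnorm_tuple1.
Qed.

End critical_constant.

(** [hdeg] removes one case: for n = 1 the norms do not see q, so with p1 = p2 the two normalized
    bodies coincide although q1 and q2 differ. Then A = 1, and at t = 1 the volume is 1 for every m
    >= 1, not 1/2. *)
Theorem corollary4 (R : realType) (p1 q1 q2 : \bar R) (p2 : R)
    (hp1 : (0 < p1)%E) (hq1 : (0 < q1)%E) (hq2 : (0 < q2)%E) (hp2 : 0 < p2)
    (hne : (p1, q1) <> (p2%:E, q2))
    (n : nat) (hn : (0 < n)%N) (t : R) (ht : 0 < t)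
    (hdeg : n = 1%N -> p1 = p2%:E -> t <> 1)
    (d : measure_display) (T : measurableType d) (P : probability T R)
    (Theta1 : {RV P >-> Rvec R n}) (hTheta1 : cone_distributed q1 Theta1) :
  let A := Acst p1 q1 p2 q2 Theta1 in
  volV p1 q1 p2%:E q2 m n t @[m --> \oo] -->
    (if t * A < 1 then 0 else if t * A == 1 then 2^-1 else 1 : R)%:E.
Proof.
move=> A; have np : 0 < n%:R :> R by rewrite ltr0n.
have p20E : (0 < p2%:E)%E by rewrite lte_fin.
have [Q hQ] := exists_radial_law n hp1 hq1.
have [k [kE k0 momE]] := radial_law_moment hp1 hq1 hq2 hn hp2 hQ.
(* [kEq] expresses the p2-th moment M of the radial law through the expectation over Theta1, which
   is how that expectation enters A. *)
have := cone_moment hn hq1 hq2 hp2 hTheta1; rewrite kE => -[kEq].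
set M := Gamma _ / _ * k in momE.
have M0 : 0 < M.
  apply: mulr_gt0 => //; apply: divr_gt0; last exact: radial_mass_gt0.
  by apply: Gamma_gt0; apply: divp_ge0 => //; rewrite addr_ge0// ltW.
have ME := erefl M; rewrite {2}/M kEq in ME.
have [A0 lnA] := ln_Acst hp1 hq1 hp2 hq2 hn M0 ME.
have u1 := unit_mean_lpnorm hp1 hq1 hq2 hn hp2 hQ M0 momE.
have u2 := unit_mean_radial_variable hp1 hq1 hn hQ.
have tA0 : 0 < t * A by rewrite mulr_gt0.
have lntA : ln (t * A) = ln t + ln A by rewrite lnM ?posrE.
have := log_ratio_cvg hp1 hq1 hp2 hq2 M0 ht hn.
have -> : ln t + (ln (radial_mass p1 q1 n) - ln (radial_mass p2%:E q2 n)) / n%:R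
    + (Defs.divp 1 p1 - p2^-1) * (1 - ln n%:R)
    + Defs.divp 1 p1 * (ln_exponent p1 + ln (radial_moment p1 n))
    - p2^-1 * (ln p2 + ln M) = ln (t * A).
  by rewrite lntA /A lnA; ring.
move=> hcvg.
have a0 : 0 <= p2^-1 by rewrite invr_ge0 ltW.
have b0 : 0 <= Defs.divp 1 p1 by exact: divp_ge0.
have hb m (m0 : (0 < m)%N) := volV_mean_bounds hp1 hq1 hp2 hq2 M0 ht m0 hn hQ.
have l0 : (ln (t * A) < 0) = (t * A < 1) by rewrite -[in RHS]ltr_ln ?posrE// ln1.
have l1 : (ln (t * A) == 0) = (t * A == 1) by rewrite ln_eq0.
rewrite -l0 -l1; apply: (sandwich_limit a0 b0 u1 u2 hcvg).
- by move=> m m0; exact: volV_le1.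
- by move=> m /hb[].
- by move=> m h /hb[_]; exact.
(* It remains to exclude n = 1 with p1 = p2: there M = n/p2 and the two masses agree, so ln A = 0,
   and a vanishing ln(tA) would give t = 1, against [hdeg]. *)
move=> tA; apply: radial_variable_nondegenerate => // n1 p1E.
have hQ' : radial_law p2%:E q1 Q by rewrite -p1E.
have MnE : M = n%:R / p2.
  apply/EFin_inj; rewrite -momE -(radial_law_self_moment hp2 hq1 hn hQ').
  apply: eq_integral => x _; congr ((_ `^ _)%:E).
  by move: (x : Rvec R n); rewrite n1 => y; rewrite !lpnorm_tuple1.
apply: (hdeg n1 p1E); move: tA; rewrite lntA /A lnA p1E MnE /= n1.
rewrite (radial_mass_dim1 _ hq1 hq2) div1r !subrr !mul0r !add0r subrr addr0.
by move/eqP; rewrite ln_eq0// => /eqP.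
Qed.
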